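(* Let $\{a_n\}_{n=1}^\infty$ be a sequence of positive numbers satisfying $\sup_{n\in\mathbb{N}}|a_n-n|\le C<\infty$. Let $p\in(0,\infty]$ and $f\in L_p(\mathbb{R})$. Then for all $\sigma>0$ the following hold. (a) If $p=\infty$, then $$A_\sigma(f)_\infty\le \liminf_{n\to\infty}E_n\left(f,L_\infty([-a_n/\sigma,a_n/\sigma])\right)\le \limsup_{n\to\infty}E_n\left(f,L_\infty([-a_n/\sigma,a_n/\sigma])\right)\le A_{\sigma-0}(f)_\infty.$$ (b) If $p\in(0,\infty)$, then $$\lim_{n\to\infty}E_n\left(f,L_p([-a_n/\sigma,a_n/\sigma])\right)=A_\sigma(f)_p.$$
   Context: $\mathbb{N}=\{1,2,\ldots\}$. $\mathcal{P}_n$ is the set of all algebraic polynomials with complex coefficients of degree at most $n$. For $\sigma\ge 0$, $B_\sigma$ is the set of all complex-valued entire functions of exponential type (at most) $\sigma$, i.e. entire $g$ such that for every $\varepsilon>0$ there is a constant $C_\varepsilon$ with $|g(z)|\le C_\varepsilon e^{(\sigma+\varepsilon)|z|}$ for all $z\in\mathbb{C}$. For measurable $\Omega\subseteq\mathbb{R}$, $L_p(\Omega)$ is the space of all measurable complex-valued functions on $\Omega$ with finite quasinorm $\|f\|_{L_p(\Omega)}=\left(\int_\Omega|f(x)|^p\,dx\right)^{1/p}$ for $0<p<\infty$ and $\|f\|_{L_\infty(\Omega)}=\operatorname{ess\,sup}_{x\in\Omega}|f(x)|$. For $a>0$ and $f\in L_p([-a,a])$, $E_n(f,L_p([-a,a])):=\inf_{P\in\mathcal{P}_n}\|f-P\|_{L_p([-a,a])}$.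 For a measurable function $f$ on $\mathbb{R}$ and $\sigma>0$, $A_\sigma(f)_p:=\inf_{g\in B_\sigma}\|f-g\|_{L_p(\mathbb{R})}\in[0,\infty]$, and $A_{\sigma-0}(f)_p:=\lim_{\tau\to\sigma-}A_\tau(f)_p$. *)

(* Defs.v *)
From HB Require Import structures.
From mathcomp Require Import all_boot all_order all_algebra.
From mathcomp Require Import complex.
From mathcomp Require Import all_classical all_reals all_analysis.
Import Order.TTheory GRing.Theory Num.Theory.
Import numFieldNormedType.Exports.

Set Implicit Arguments.
Unset Strict Implicit.
Unset Printing Implicit Defensive.

Local Open Scope classical_set_scope.
Local Open Scope ring_scope.

(* The modulus with values in R; the norm `|z| on R[i] takes its values in
   R[i] itself. *)
Notation cmod := ComplexField.Normc.normc.

(* The real line with its Lebesgue sigma-algebra, on which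
   completed_lebesgue_measure is defined; the canonical measurable structure
   on R is the Borel one. *)
Notation lebesgueType R := (caratheodory_type ((@wlength R idfun)^*)%mu).

Section Definitions.
Context {R : realType}.
Implicit Types (p : \bar R) (f : R -> R[i]) (g : R[i] -> R[i]).

(* Lebesgue (not merely Borel) measurability, componentwise. *)
Definition cmeasurable f : Prop :=
  measurable_fun (T := lebesgueType R) [set: R] (fun x => complex.Re (f x)) /\
  measurable_fun (T := lebesgueType R) [set: R] (fun x => complex.Im (f x)).

(* For 0 < p, extending |f| by zero outside of Omega changes neither the
   integral over Omega nor the essential supremum over Omega. *)
Definition Lpnorm p (Omega : set R) f : \bar R :=
  'N[@completed_lebesgue_measure R]_p[(fun x => (cmod (f x))%:E) \_ Omega].

Definition in_LpR p f : Prop :=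
  cmeasurable f /\ (Lpnorm p [set: R] f < +oo)%E.

(* Complex differentiability at every point: R[i]^o is the complex field seen
   as a normed space over itself. *)
Definition entire g : Prop :=
  forall z : R[i], derivable (g : R[i]^o -> R[i]^o) z 1.

Definition exp_type (sigma : R) g : Prop :=
  forall eps : R, 0 < eps -> exists C : R, forall z : R[i],
    cmod (g z) <= C * expR ((sigma + eps) * cmod z).

Definition B_ (sigma : R) : set (R[i] -> R[i]) :=
  [set g | entire g /\ exp_type sigma g].

Definition Poly_ (n : nat) : set {poly R[i]} :=
  [set P | (size P <= n.+1)%N].

Definition E_ (n : nat) f p (a : R) : \bar R :=
  ereal_inf [set Lpnorm p `[- a, a] (fun x => f x - P.[real_complex R x])
            | P in Poly_ n].

Definition A_ (sigma : R) f p : \bar R :=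
  ereal_inf [set Lpnorm p [set: R] (fun x => f x - g (real_complex R x))
            | g in B_ sigma].

(* The limit exists because tau |-> A_ tau f p is nonincreasing. *)
Definition A_left (sigma : R) f p : \bar R :=
  lim (A_ tau f p @[tau --> sigma^'-]).

End Definitions.

(* Main.v *)
Require Import Defs.
From mathcomp Require Import all_boot all_order all_algebra.
From mathcomp Require Import complex ring lra.
From mathcomp Require Import all_classical all_reals all_analysis.
From mathcomp Require Import measurable_realfun ess_sup_inf.
Import Order.TTheory GRing.Theory Num.Theory.
Import numFieldNormedType.Exports.

Set Implicit Arguments.
Unset Strict Implicit.
Unset Printing Implicit Defensive.

Local Open Scope classical_set_scope.
Local Open Scope ring_scope.

(** Write A_n = a_n / sigma, so that A_n is n / sigma up to a bounded error.
    The proof passes between polynomials of degree n on [-A_n, A_n] and entire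
    functions of exponential type, in both directions.

    Upper bounds.  Let g be of type tau < sigma with f - g in L_p.  Then g is
    in L_p too, and such a g satisfies |g(z)| <= C exp(lam |Im z|) for every
    lam between tau and sigma ([strip_bound], [phragmen_lindelof]).  The image
    of the circle |w| = rho under w |-> A_n (w + 1/w) / 2 is an ellipse of
    half-height A_n (rho - 1/rho) / 2, close to A_n ln rho when rho is close
    to 1.  On it |g| is at most about rho^(n lam / sigma), whereas cutting the
    Chebyshev expansion of g at degree n gains a factor rho^(-n); hence g is
    approximated on [-A_n, A_n] at a geometric rate ([chebyshev_truncation],
    [exponential_approx]), which in L_p beats the length of the interval.  So
    the upper limit of the E_n is at most A_tau for every tau < sigma
    ([E_upper_bound]).  When p is finite, type sigma is reached as well: the
    dilation x |-> g(rho x) has type rho sigma and tends to g in L_p as rho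
    tends to 1 from below ([dilation_approx]).

    Lower bound.  Suppose that E_n < l for infinitely many n and choose
    polynomials P_n realizing this; their L_p norms on [-A_n, A_n] are bounded.
    As n / A_n is bounded, a Nikolskii inequality bounds the polynomials
    Q_n(x) = P_n(x) (1 - x^2 / A_n^2)^j uniformly on [-A_n, A_n], for some
    fixed j ([nikolskii]); the weight absorbs the concentration which
    polynomials may have near the end points.  The Bernstein-Walsh inequality
    turns this into |Q_n(z)| <= M exp(s_n |z|) with s_n -> sigma
    ([bernstein_walsh]).  By compactness a subsequence converges to some g of
    type sigma ([montel_exp_type]); the weights tend to 1 pointwise, so the P_n
    converge to g on the real line along it, and Fatou's lemma (or, for
    p = oo, a countable union of null sets) gives |f - g|_p <= l
    ([A_lower_bound]).

    The function theory is built on complex differentiability at points.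
    Goursat's theorem on rectangles gives the mean value property, and that
    gives the maximum principle ([goursat], [mean_value], [maximum_modulus]).
    Comparing difference quotients through the maximum principle shows that
    the quotient (g(z) - g(0)) / z of an entire g is entire; dividing again and
    again produces Taylor polynomials together with a bound for the remainder
    ([entire_quotient], [taylor_polynomial]). *)

#[local] Arguments ComplexField.Normc.normc : simpl never.

(** * Modulus, complex differentiability and the exponential *)

Section ComplexBasics.
Context {R : realType}.
Implicit Types (x y z h w : R[i]) (g f : R[i] -> R[i]).

Lemma cmodE z : `|z| = real_complex R (cmod z).
Proof. by case: z. Qed.

Lemma cmod_ge0 z : 0 <= cmod z.
Proof. by case: z => a b; exact: sqrtr_ge0. Qed.

Lemma cmod0 : cmod (0 : R[i]) = 0.
Proof. exact: ComplexField.Normc.normc0. Qed.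

Lemma cmod1 : cmod (1 : R[i]) = 1.
Proof. exact: ComplexField.Normc.normc1. Qed.

Lemma cmodM x y : cmod (x * y) = cmod x * cmod y.
Proof. exact: ComplexField.Normc.normcM. Qed.

Lemma cmodV x : cmod x^-1 = (cmod x)^-1.
Proof. exact: ComplexField.Normc.normcV. Qed.

Lemma cmodX x n : cmod (x ^+ n) = cmod x ^+ n.
Proof. by elim: n => [|n IH]; rewrite ?cmod1 // !exprS cmodM IH. Qed.

Lemma cmodN x : cmod (- x) = cmod x.
Proof. by case: x => a b; rewrite /ComplexField.Normc.normc /= !sqrrN. Qed.

Lemma cmodD x y : cmod (x + y) <= cmod x + cmod y.
Proof. exact: le_normcD. Qed.

Lemma cmodB x y : cmod (x - y) <= cmod x + cmod y.
Proof. by rewrite -(cmodN y); exact: cmodD. Qed.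

Lemma cmodBC x y : cmod (x - y) = cmod (y - x).
Proof. by rewrite -cmodN opprB. Qed.

Lemma cmod_eq0 x : (cmod x == 0) = (x == 0).
Proof.
by apply/eqP/eqP => [|->]; [exact: ComplexField.Normc.eq0_normc|exact: cmod0].
Qed.

Lemma cmod_gt0 x : (0 < cmod x) = (x != 0).
Proof. by rewrite lt_def cmod_ge0 andbT cmod_eq0. Qed.

Lemma cmod_sqr z : cmod z ^+ 2 = complex.Re z ^+ 2 + complex.Im z ^+ 2.
Proof. by case: z => a b; rewrite /ComplexField.Normc.normc /= sqr_sqrtr // addr_ge0 // sqr_ge0. Qed.

Lemma cmod_real (a : R) : cmod (real_complex R a) = `|a|.
Proof. by rewrite /ComplexField.Normc.normc /= expr0n addr0 sqrtr_sqr. Qed.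

Lemma normRe_le z : `|complex.Re z| <= cmod z.
Proof.
rewrite -(@ler_pXn2r _ 2) ?nnegrE ?cmod_ge0 // cmod_sqr real_normK ?num_real //.
by rewrite lerDl sqr_ge0.
Qed.

Lemma normIm_le z : `|complex.Im z| <= cmod z.
Proof.
rewrite -(@ler_pXn2r _ 2) ?nnegrE ?cmod_ge0 // cmod_sqr real_normK ?num_real //.
by rewrite lerDr sqr_ge0.
Qed.

Lemma cmod_leReIm z : cmod z <= `|complex.Re z| + `|complex.Im z|.
Proof.
rewrite -(@ler_pXn2r _ 2) ?nnegrE ?cmod_ge0 ?addr_ge0 // cmod_sqr sqrrD !real_normK ?num_real //.
rewrite -addrA lerD2l lerDr mulrn_wge0 // mulr_ge0 //.
Qed.

Lemma ler_dist_cmod x y : `|cmod x - cmod y| <= cmod (x - y).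
Proof.
have H (a b : R[i]) : cmod a - cmod b <= cmod (a - b).
  by rewrite lerBlDr; have := cmodD (a - b) b; rewrite subrK.
by rewrite ler_norml H andbT lerNl opprB cmodBC H.
Qed.

Lemma cmod_sum (I : Type) (r : seq I) (T : pred I) (F : I -> R[i]) :
  cmod (\sum_(i <- r | T i) F i) <= \sum_(i <- r | T i) cmod (F i).
Proof.
elim/big_rec2: _ => [|j y z _ IH]; first by rewrite cmod0.
by rewrite (le_trans (cmodD _ _)) // lerD2l.
Qed.

Lemma cReD x y : complex.Re (x + y) = complex.Re x + complex.Re y.
Proof. by case: x y => a b [c d]. Qed.
Lemma cImD x y : complex.Im (x + y) = complex.Im x + complex.Im y.
Proof. by case: x y => a b [c d]. Qed.
Lemma cReB x y : complex.Re (x - y) = complex.Re x - complex.Re y.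
Proof. by case: x y => a b [c d]. Qed.
Lemma cImB x y : complex.Im (x - y) = complex.Im x - complex.Im y.
Proof. by case: x y => a b [c d]. Qed.
Lemma cReM x y : complex.Re (x * y) =
  complex.Re x * complex.Re y - complex.Im x * complex.Im y.
Proof. by case: x y => a b [c d]. Qed.
Lemma cImM x y : complex.Im (x * y) =
  complex.Re x * complex.Im y + complex.Im x * complex.Re y.
Proof. by case: x y => a b [c d]. Qed.

(** The derivative is taken through the R-valued modulus: estimates then live
    in R, where the order is total. *)
Definition cder g z (D : R[i]) := forall e : R, 0 < e -> exists2 d : R, 0 < d &
  forall h, cmod h <= d -> cmod (g (z + h) - g z - D * h) <= e * cmod h.

Definition cdiff g z := exists D, cder g z D.

Lemma nbhsC0P (P : R[i] -> Prop) :
  nbhs (0 : R[i]^o) P <-> exists2 d : R, 0 < d & forall h, cmod h < d -> P h.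
Proof.
split=> [/nbhs_ballP[e /= e0 H]|[d d0 H]].
  have [er ei] : 0 < complex.Re e /\ e = real_complex R (complex.Re e).
    by move: e0; rewrite ltcE => /andP[/eqP]; case: e {H} => a b /= -> ?.
  exists (complex.Re e) => // h hd; apply: H.
  by rewrite -ball_normE /= sub0r normrN cmodE ei ltcR.
apply/nbhs_ballP; exists (real_complex R d); first by rewrite /= ltcR.
by move=> h; rewrite -ball_normE /= sub0r normrN cmodE ltcR => /H.
Qed.

(** The bridge between differentiability in the statement and [cdiff]. *)
Lemma derivable_cdiff g z :
  derivable (g : R[i]^o -> R[i]^o) z 1 <-> cdiff g z.
Proof.
have sh (D h : R[i]) : h != 0 -> D - h^-1 *: (g (h *: 1 + z) - g z) =
   - (g (z + h) - g z - D * h) / h.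
  by move=> h0; rewrite scaler1 -[h^-1 *: _]/(h^-1 * _) [h + z]addrC; field.
split=> [/cvg_ex[D /= /cvgrPdist_lt HD]|[D HD]].
  exists D => e e0.
  have ec : 0 < real_complex R e by rewrite ltcR.
  have := HD _ ec; rewrite /dnbhs /within /= => /nbhsC0P[d d0 Hd].
  exists (d / 2); first by rewrite divr_gt0.
  move=> h hd; have [->|h0] := eqVneq h 0.
    by rewrite addr0 mulr0 subrr subrr cmod0 mulr0.
  have := Hd h _ h0; rewrite /= => /(_ _)/wrap[].
    by apply: le_lt_trans hd _; rewrite ltr_pdivrMr // ltr_pMr // ltr1n.
  rewrite sh // cmodE ltcR cmodM cmodN cmodV ltr_pdivrMr ?cmod_gt0 //.
  exact: ltW.
apply/cvg_ex; exists D; apply/cvgrPdist_le => /= e e0.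
have [er ei] : 0 < complex.Re e /\ e = real_complex R (complex.Re e).
  by move: e0; rewrite ltcE => /andP[/eqP]; case: e => a b /= -> ?.
have [d d0 Hd] := HD _ er.
rewrite /dnbhs; apply/nbhsC0P; exists d => // h hd /= h0.
rewrite sh // cmodE ei lecR cmodM cmodN cmodV ler_pdivrMr ?cmod_gt0 //.
by apply: Hd; exact: ltW.
Qed.

Lemma cdiff_cst c z : cdiff (fun=> c) z.
Proof. exact/derivable_cdiff/derivable_cst. Qed.

Lemma cdiff_id z : cdiff id z.
Proof. exact/derivable_cdiff/derivable_id. Qed.

Lemma cdiffD f g z : cdiff f z -> cdiff g z -> cdiff (fun w => f w + g w) z.
Proof.
by move=> /derivable_cdiff F /derivable_cdiff G; apply/derivable_cdiff/derivableD.
Qed.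

Lemma cdiffM f g z : cdiff f z -> cdiff g z -> cdiff (fun w => f w * g w) z.
Proof.
move=> /derivable_cdiff F /derivable_cdiff G; apply/derivable_cdiff.
exact: (@derivableM _ _ (f : R[i]^o -> R[i]^o) (g : R[i]^o -> R[i]^o) z 1 F G).
Qed.

Lemma cdiffV f z : f z != 0 -> cdiff f z -> cdiff (fun w => (f w)^-1) z.
Proof.
move=> f0 /derivable_cdiff F; apply/derivable_cdiff.
exact: (@derivableV _ _ (f : R[i]^o -> R[i]^o) z 1 f0 F).
Qed.

Definition ccont f := forall z (e : R), 0 < e -> exists2 d : R, 0 < d &
  forall h, cmod h <= d -> cmod (f (z + h) - f z) <= e.

Definition ccont_at f z := forall e : R, 0 < e -> exists2 d : R, 0 < d &
  forall h, cmod h <= d -> cmod (f (z + h) - f z) <= e.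

Lemma ccont_atM f g z : ccont_at f z -> ccont_at g z ->
  ccont_at (fun w => f w * g w) z.
Proof.
move=> cf cg e e0; pose S := cmod (f z) + cmod (g z) + 1.
have fz0 := cmod_ge0 (f z); have gz0 := cmod_ge0 (g z).
have S0 : 0 < S by rewrite /S; lra.
pose e' := Num.min 1 (e / S); have e'0 : 0 < e' by rewrite lt_min ltr01 divr_gt0.
have [d d0 H] := cf _ e'0; have [d' d'0 H'] := cg _ e'0.
exists (Num.min d d'); first by rewrite lt_min d0.
move=> h; rewrite le_min => /andP[/H {}H /H' {}H'].
have -> : f (z + h) * g (z + h) - f z * g z = (f (z + h) - f z) * (g (z + h) - g z)
  + (f (z + h) - f z) * g z + f z * (g (z + h) - g z) by ring.
rewrite (le_trans (cmodD _ _)) // (le_trans (lerD (cmodD _ _) (lexx _))) // !cmodM.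
have e'1 : e' <= 1 by rewrite ge_min lexx.
have e'S : e' * S <= e by rewrite -ler_pdivlMr // ge_min lexx orbT.
have P1 : cmod (f (z + h) - f z) * cmod (g (z + h) - g z) <= e' * 1.
  by apply: ler_pM; rewrite ?cmod_ge0 // (le_trans H').
have P2 : cmod (f (z + h) - f z) * cmod (g z) <= e' * cmod (g z).
  by rewrite ler_wpM2r.
have P3 : cmod (f z) * cmod (g (z + h) - g z) <= cmod (f z) * e'.
  by rewrite ler_wpM2l.
by move: e'S; rewrite /S; lra.
Qed.

Lemma ccont_atD f g z : ccont_at f z -> ccont_at g z ->
  ccont_at (fun w => f w + g w) z.
Proof.
move=> cf cg e e0; have e2 : 0 < e / 2 by rewrite divr_gt0.
have [d d0 H] := cf _ e2; have [d' d'0 H'] := cg _ e2.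
exists (Num.min d d'); first by rewrite lt_min d0.
move=> h; rewrite le_min => /andP[/H h1 /H' h2].
have -> : f (z + h) + g (z + h) - (f z + g z) =
  (f (z + h) - f z) + (g (z + h) - g z) by ring.
by rewrite (le_trans (cmodD _ _)) //; lra.
Qed.

Lemma ccont_at_near f g z (d : R) : 0 < d ->
  (forall h, cmod h <= d -> f (z + h) = g (z + h)) -> ccont_at f z -> ccont_at g z.
Proof.
move=> d0 fg cf e /cf[d' d'0 H].
have fz : f z = g z by have := fg 0; rewrite addr0 cmod0 => ->//; exact: ltW.
exists (Num.min d d'); first by rewrite lt_min d0.
by move=> h; rewrite le_min => /andP[/fg <- /H]; rewrite fz.
Qed.

Lemma cder_lip g z D : cder g z D -> exists2 d : R, 0 < d &
  forall h, cmod h <= d -> cmod (g (z + h) - g z) <= (cmod D + 1) * cmod h.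
Proof.
move=> /(_ 1 ltr01)[d d0 H]; exists d => // h /H hd.
have -> : g (z + h) - g z = (g (z + h) - g z - D * h) + D * h by rewrite subrK.
by rewrite (le_trans (cmodD _ _)) // cmodM mulrDl addrC lerD2l.
Qed.

Lemma cdiff_cont g z (e : R) : cdiff g z -> 0 < e -> exists2 d : R, 0 < d &
  forall h, cmod h <= d -> cmod (g (z + h) - g z) <= e.
Proof.
move=> [D /cder_lip[d d0 H]] e0; have D1 : 0 < cmod D + 1.
  by rewrite ltr_wpDl // cmod_ge0.
exists (Num.min d (e / (cmod D + 1))).
  by rewrite lt_min d0 divr_gt0.
move=> h; rewrite le_min => /andP[/H hd]; rewrite ler_pdivlMr // => he.
by rewrite (le_trans hd) // mulrC.
Qed.

Lemma cdiff_ccont g : (forall z, cdiff g z) -> ccont g.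
Proof. by move=> G z e; exact: cdiff_cont. Qed.

Lemma cdiff_comp f g z : cdiff f z -> cdiff g (f z) -> cdiff (fun w => g (f w)) z.
Proof.
move=> [F HF] [G HG]; exists (G * F) => e e0.
have F1 : 0 < cmod F + 1 by rewrite ltr_wpDl // cmod_ge0.
have G1 : 0 < cmod G + 1 by rewrite ltr_wpDl // cmod_ge0.
have e2 : 0 < e / 2 by rewrite divr_gt0.
have [d1 d10 H1] := HG (e / 2 / (cmod F + 1)) (divr_gt0 e2 F1).
have [d2 d20 H2] := HF (e / 2 / (cmod G + 1)) (divr_gt0 e2 G1).
have [d3 d30 H3] := cder_lip HF.
have [d4 d40 H4] := cdiff_cont (ex_intro _ F HF) d10.
exists (Num.min (Num.min d2 d3) d4); first by rewrite !lt_min d20 d30.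
move=> h; rewrite !le_min => /andP[/andP[hd2 hd3] hd4].
set k := f (z + h) - f z.
have -> : g (f (z + h)) - g (f z) - G * F * h =
  (g (f z + k) - g (f z) - G * k) + G * (k - F * h).
  rewrite /k [f z + _]addrC subrK; ring.
rewrite (le_trans (cmodD _ _)) // cmodM.
have B1 := H1 k (H4 h hd4); have B2 := H2 h hd2; have B3 := H3 h hd3.
rewrite -/k in B2 B3.
rewrite [leRHS](_ : _ = e / 2 * cmod h + e / 2 * cmod h); last by field.
apply: lerD.
  rewrite (le_trans B1) // -mulrA ler_pM2l ?divr_gt0 //.
  by rewrite ler_pdivrMl.
apply: (@le_trans _ _ ((cmod G + 1) * cmod (k - F * h))).
  by rewrite ler_wpM2r ?cmod_ge0 // lerDl.
rewrite (le_trans (ler_wpM2l (ltW G1) B2)) //.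
by rewrite mulrA [_ * (_ / _)]mulrC divfK ?gt_eqF.
Qed.

Lemma cdiffN f z : cdiff f z -> cdiff (fun w => - f w) z.
Proof.
move=> F; have := cdiffM (cdiff_cst (-1) z) F.
by under eq_fun do rewrite mulN1r.
Qed.

Lemma cdiffB f g z : cdiff f z -> cdiff g z -> cdiff (fun w => f w - g w) z.
Proof. by move=> F G; apply: cdiffD => //; exact: cdiffN. Qed.

Lemma cdiff_horner (p : {poly R[i]}) z : cdiff (fun w => p.[w]) z.
Proof.
elim/poly_ind: p => [|p c IH].
  by under eq_fun do rewrite horner0; exact: cdiff_cst.
under eq_fun do rewrite hornerMXaddC.
by apply: cdiffD; [apply: cdiffM => //; exact: cdiff_id|exact: cdiff_cst].
Qed.

Lemma cdiff_near f g z (d : R) : 0 < d ->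
  (forall h, cmod h <= d -> f (z + h) = g (z + h)) -> cdiff f z -> cdiff g z.
Proof.
move=> d0 fg [D H]; exists D => e /H[d' d'0 {}H].
have fz : f z = g z by have := fg 0; rewrite addr0 cmod0 => ->//; exact: ltW.
exists (Num.min d d'); first by rewrite lt_min d0.
by move=> h; rewrite le_min => /andP[/fg <- /H]; rewrite fz.
Qed.

Definition cexp w : R[i] :=
  Complex (expR (complex.Re w) * cos (complex.Im w))
          (expR (complex.Re w) * sin (complex.Im w)).

Lemma cexpD z w : cexp (z + w) = cexp z * cexp w.
Proof.
case: z w => a b [c d]; rewrite /cexp /= expRD sinD cosD.
by apply/eqP; rewrite eq_complex /=; apply/andP; split; apply/eqP; ring.
Qed.

Lemma cmod_cexp w : cmod (cexp w) = expR (complex.Re w).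
Proof.
rewrite /cexp /ComplexField.Normc.normc !exprMn -mulrDr cos2Dsin2 mulr1 sqrtr_sqr ger0_norm //.
Qed.

Lemma cexp0 : cexp 0 = 1.
Proof. by rewrite /cexp /= expR0 cos0 sin0 mulr0 mulr1. Qed.

Lemma is_derive_lip (u : R -> R) (x D : R) : is_derive x 1 u D ->
  forall e, 0 < e -> exists2 d : R, 0 < d &
  forall t : R, `|t| <= d -> `|u (x + t) - u x - D * t| <= e * `|t|.
Proof.
move=> [/cvg_ex[l hl] Dl] e e0.
have lD : l = D by rewrite -Dl /derive; apply/esym/cvg_lim.
have /cvgrPdist_le/(_ e e0) := hl; rewrite lD => /nbhs_ballP[d /= d0 H].
exists (d / 2); first by rewrite divr_gt0.
move=> h hd; have [->|h0] := eqVneq h 0.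
  by rewrite addr0 mulr0 subrr subr0 normr0 mulr0.
have := H h; rewrite /ball /= sub0r normrN => /(_ _ h0)/wrap[].
  by apply: le_lt_trans hd _; rewrite ltr_pdivrMr // ltr_pMr // ltr1n.
rewrite scaler1 -[h^-1 *: _]/(h^-1 * _) [h + x]addrC.
have -> : D - h^-1 * (u (x + h) - u x) = - (u (x + h) - u x - D * h) / h by field.
by rewrite normrM normrN normfV ler_pdivrMr ?normr_gt0.
Qed.

(** The real and imaginary parts have total differential (Re h, Im h) at 0,
    because exp, cos and sin have derivatives 1, 0 and 1 there. *)
Lemma cdiff_cexp0 : cder cexp 0 1.
Proof.
move=> e e0; pose e' : R := Num.min 1 (e / 6).
have e'0 : 0 < e' by rewrite lt_min ltr01 divr_gt0.
have [d1 d10 H1] := is_derive_lip (is_derive_expR 0) e'0.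
have [d2 d20 H2] := is_derive_lip (is_derive_cos 0) e'0.
have [d3 d30 H3] := is_derive_lip (is_derive_sin 0) e'0.
exists (Num.min (Num.min d1 (e' / 2)) (Num.min d2 d3)).
  by rewrite !lt_min d10 d20 d30 divr_gt0.
move=> h; rewrite !le_min => /andP[/andP[hd1 hd4] /andP[hd2 hd3]].
rewrite add0r cexp0 mul1r.
have ha := normRe_le h; have hb := normIm_le h.
case: h ha hb hd1 hd2 hd3 hd4 => a b; set n := cmod _ => /= ha hb hd1 hd2 hd3 hd4.
have := H1 a (le_trans ha hd1); rewrite add0r expR0 mul1r => E1.
have := H2 b (le_trans hb hd2); rewrite add0r cos0 sin0 oppr0 mul0r subr0 => E2.
have := H3 b (le_trans hb hd3); rewrite add0r cos0 sin0 mul1r subr0 => E3.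
have e'1 : e' <= 1 by rewrite ge_min lexx.
have e'6 : e' <= e / 6 by rewrite ge_min lexx orbT.
have n0 : 0 <= n by exact: cmod_ge0.
have E4 : `|expR a - 1| <= e'.
  have -> : expR a - 1 = (expR a - 1 - a) + a by ring.
  have := ler_normD (expR a - 1 - a) a; nra.
have E5 : 0 <= expR a <= 2.
  by rewrite expR_ge0 /=; move: E4; rewrite ler_norml => /andP[]; lra.
rewrite (le_trans (cmod_leReIm _)) // cReB cImB cReB cImB /=.
have -> : expR a * cos b - 1 - a = (expR a - 1 - a) + expR a * (cos b - 1) by ring.
have -> : expR a * sin b - 0 - b = expR a * (sin b - b) + (expR a - 1) * b by ring.
have T1 := ler_normD (expR a - 1 - a) (expR a * (cos b - 1)).
have T2 := ler_normD (expR a * (sin b - b)) ((expR a - 1) * b).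
rewrite !normrM (ger0_norm (expR_ge0 a)) in T1 T2.
case/andP: E5 => E50 E51.
have P1 : expR a * `|cos b - 1| <= 2 * (e' * n).
  by apply: ler_pM => //; rewrite (le_trans E2) // ler_pM2l.
have P2 : expR a * `|sin b - b| <= 2 * (e' * n).
  by apply: ler_pM => //; rewrite (le_trans E3) // ler_pM2l.
have P3 : `|expR a - 1| * `|b| <= e' * n by apply: ler_pM.
have P4 : e' * `|a| <= e' * n by rewrite ler_pM2l.
have P5 : e' * n <= e / 6 * n by rewrite ler_wpM2r.
lra.
Qed.

Lemma cdiff_cexp w : cdiff cexp w.
Proof.
exists (cexp w) => e e0; have ew : 0 < e / cmod (cexp w).
  by rewrite divr_gt0 // cmod_cexp expR_gt0.
have [d d0 H] := cdiff_cexp0 ew; exists d => // h /H.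
rewrite add0r cexp0 cexpD mul1r => hh.
have -> : cexp w * cexp h - cexp w - cexp w * h = cexp w * (cexp h - 1 - h).
  by ring.
rewrite cmodM -ler_pdivlMl ?cmod_cexp ?expR_gt0 // mulrCA mulrA.
by move: hh; rewrite cmod_cexp.
Qed.

End ComplexBasics.

(** * Integrals of continuous functions over segments *)

Section RealIntegral.
Context {R : realType}.
Implicit Types (a b c d x y : R) (u v : R -> R).
Notation mu := (@lebesgue_measure R).

Definition segint a b u : R := (\int[mu]_(t in `[a, b]) u t)%R.

Lemma cont_integrable a b u : continuous u -> mu.-integrable `[a, b] (EFin \o u).
Proof.
move=> cu; apply: continuous_compact_integrable; first exact: segment_compact.
by apply: continuous_subspaceT.
Qed.

Lemma segint_chasles a m b u : continuous u -> a <= m -> m <= b ->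
  segint a b u = segint a m u + segint m b u.
Proof.
move=> cu am mb; have := @Rintegral_itvB R u (BLeft a) (BRight b) m.
move=> /(_ (cont_integrable _ _ cu)); rewrite !bnd_simp => /(_ am mb) E.
rewrite /segint -[X in _ + X]Rintegral_itv_obnd_cbnd.
  by rewrite -E addrC subrK.
apply: integrableS (cont_integrable m b cu) => //.
by move=> t /=; rewrite !in_itv /= => /andP[/ltW -> ->].
Qed.

Lemma segintB a b u v : continuous u -> continuous v ->
  segint a b (fun t => u t - v t) = segint a b u - segint a b v.
Proof. by move=> cu cv; apply: RintegralB => //; exact: cont_integrable. Qed.

Lemma segint_cst a b c : a <= b -> segint a b (fun=> c) = c * (b - a).
Proof.
move=> ab; rewrite /segint Rintegral_cst //= lebesgue_measure_itv /= lte_fin.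
have [//|ba] := ltP a b; have -> /= : a = b by lra.
by rewrite subrr.
Qed.

Lemma segint_le a b u v : continuous u -> continuous v ->
  (forall t, a <= t <= b -> u t <= v t) -> segint a b u <= segint a b v.
Proof.
move=> cu cv uv; apply: le_Rintegral => //; exact: cont_integrable.
Qed.

Lemma segint_near a b u (k B : R) : continuous u -> a <= b ->
  (forall t, a <= t <= b -> `|u t - k| <= B) ->
  `|segint a b u - k * (b - a)| <= B * (b - a).
Proof.
move=> cu ab H.
have C (c : R) : continuous (fun _ : R => c) by move=> t; exact: cvg_cst.
have := @segint_le a b u _ cu (C (k + B)); have := @segint_le a b _ u (C (k - B)) cu.
rewrite !segint_cst // => H1 H2.
have /H1 h1 : forall t, a <= t <= b -> k - B <= u t.
  by move=> t /H; rewrite ler_norml; lra.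
have /H2 h2 : forall t, a <= t <= b -> u t <= k + B.
  by move=> t /H; rewrite ler_norml; lra.
by rewrite ler_norml; apply/andP; split; lra.
Qed.

Lemma eq_segint a b u v : (forall t, u t = v t) -> segint a b u = segint a b v.
Proof. by move=> uv; rewrite /segint; congr (Rintegral _ _ _); apply/funext. Qed.

(** The left ends increase and the right ends decrease, so the supremum of the
    left ends lies in every interval of the nested sequence. *)
Lemma nested_point (x : nat -> R) (w : R) : 0 <= w ->
  (forall k, x k <= x k.+1 <= x k + w / 2 ^+ k.+1) ->
  exists X, forall k, x k <= X <= x k + w / 2 ^+ k.
Proof.
move=> w0 H.
have dec k : x k.+1 + w / 2 ^+ k.+1 <= x k + w / 2 ^+ k.
  have /andP[_ h] := H k; rewrite exprS invfM.
  by move: h; rewrite exprS invfM; lra.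
have mono k j : x k <= x (j + k)%N.
  elim: j => // j IH; rewrite (le_trans IH) // addSn.
  by have /andP[] := H (j + k)%N.
have monod k j : x (j + k)%N + w / 2 ^+ (j + k) <= x k + w / 2 ^+ k.
  by elim: j => // j IH; rewrite addSn (le_trans (dec _)).
have ub j k : x j <= x k + w / 2 ^+ k.
  rewrite (le_trans (mono j k)) // addnC (le_trans _ (monod k j)) // lerDl.
  by rewrite divr_ge0 // exprn_ge0.
exists (sup (range x)) => k.
have hs : has_sup (range x).
  by split; [exists (x 0%N); exists 0%N|exists (x 0%N + w / 2 ^+ 0) => _ [j _ <-]].
apply/andP; split; first by apply: sup_upper_bound => //; exists k.
by apply: ge_sup; [exact: hs.1|move=> _ [j _ <-]].
Qed.

Lemma exists_pow_le (L d : R) : 0 <= L -> 0 < d -> exists k, L / 2 ^+ k <= d.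
Proof.
move=> L0 d0; exists (Num.truncn (L / d)).+1.
rewrite ler_pdivrMr ?exprn_gt0 // mulrC -ler_pdivrMr //.
rewrite (le_trans (ltW (truncnS_gt _))) // -natrX ler_nat.
exact/ltnW/ltn_expl.
Qed.

End RealIntegral.

(** * Goursat's theorem on rectangles *)

Section Goursat.
Context {R : realType}.
Implicit Types (a b c d x y : R) (F f : R[i] -> R[i]).

Lemma ccont_Re F c : ccont F -> continuous (fun x => complex.Re (F (Complex x c))).
Proof.
move=> cF x; apply/cvgrPdist_le => /= e e0.
have [d d0 H] := cF (Complex x c) e e0.
near=> t; rewrite distrC -cReB (le_trans (normRe_le _)) //.
have -> : Complex t c = Complex x c + Complex (t - x) 0.
  by apply/eqP; rewrite eq_complex /= addr0 addrC subrK !eqxx.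
apply: H; rewrite [cmod _](cmod_real (t - x)) distrC; near: t.
by apply: cvgr_dist_le => //; exact: cvg_id.
Unshelve. all: by end_near. Qed.

Arguments ccont_Re {F} c _.

Lemma ccont_Im F c : ccont F -> continuous (fun y => complex.Im (F (Complex c y))).
Proof.
move=> cF x; apply/cvgrPdist_le => /= e e0.
have [d d0 H] := cF (Complex c x) e e0.
near=> t; rewrite distrC -cImB (le_trans (normIm_le _)) //.
have -> : Complex c t = Complex c x + Complex 0 (t - x).
  by apply/eqP; rewrite eq_complex /= addr0 addrC subrK !eqxx.
apply: H; rewrite (le_trans (cmod_leReIm _)) //= normr0 add0r distrC; near: t.
by apply: cvgr_dist_le => //; exact: cvg_id.
Unshelve. all: by end_near. Qed.

Arguments ccont_Im {F} c _.

(** The real part of the integral of F along the boundary of the rectangle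
    [a, b] x [c, d].  The imaginary part is the real part for -iF, so this
    quantity suffices. *)
Definition bdint F a b c d : R :=
  (segint a b (fun x => complex.Re (F (Complex x c))) -
   segint a b (fun x => complex.Re (F (Complex x d)))) -
  (segint c d (fun y => complex.Im (F (Complex b y))) -
   segint c d (fun y => complex.Im (F (Complex a y)))).

Lemma bdint_splitx F a m b c d : ccont F -> a <= m -> m <= b ->
  bdint F a b c d = bdint F a m c d + bdint F m b c d.
Proof.
move=> cF am mb; rewrite /bdint.
rewrite !(segint_chasles (ccont_Re _ cF) am mb); ring.
Qed.

Lemma bdint_splity F a b c m d : ccont F -> c <= m -> m <= d ->
  bdint F a b c d = bdint F a b c m + bdint F a b m d.
Proof.
move=> cF am mb; rewrite /bdint.
rewrite !(segint_chasles (ccont_Im _ cF) am mb); ring.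
Qed.

(** An affine function F(z0) + D (z - z0) has boundary integral 0; what is
    left is bounded by the perimeter times the bound for the remainder. *)
Lemma bdint_local F a b c d z0 D (B : R) : ccont F -> a <= b -> c <= d ->
  (forall x y, a <= x <= b -> c <= y <= d ->
     cmod (F (Complex x y) - F z0 - D * (Complex x y - z0)) <= B) ->
  `|bdint F a b c d| <= 2 * B * ((b - a) + (d - c)).
Proof.
move=> cF ab cd H; rewrite /bdint.
rewrite -(segintB _ _ (ccont_Re _ cF) (ccont_Re _ cF)).
rewrite -(segintB _ _ (ccont_Im _ cF) (ccont_Im _ cF)).
pose k := complex.Im D; pose r z := F z - F z0 - D * (z - z0).
have E1 : `|segint a b (fun x => complex.Re (F (Complex x c)) -
                   complex.Re (F (Complex x d))) - k * (d - c) * (b - a)|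
      <= (2 * B) * (b - a).
  apply: segint_near => //.
    by move=> x; apply: cvgB; exact: ccont_Re.
  move=> t tab.
  have -> : complex.Re (F (Complex t c)) - complex.Re (F (Complex t d)) -
     k * (d - c) = complex.Re (r (Complex t c)) - complex.Re (r (Complex t d)).
    by rewrite /r !cReB !cReM !cReB !cImB /= /k; ring.
  rewrite (le_trans (ler_normB _ _)) // mulr2n mulrDl mul1r.
  by apply: lerD; rewrite (le_trans (normRe_le _)) //; apply: H => //; lra.
have E2 : `|segint c d (fun y => complex.Im (F (Complex b y)) -
                   complex.Im (F (Complex a y))) - k * (b - a) * (d - c)|
      <= (2 * B) * (d - c).
  apply: segint_near => //.
    by move=> x; apply: cvgB; exact: ccont_Im.
  move=> t tab.
  have -> : complex.Im (F (Complex b t)) - complex.Im (F (Complex a t)) -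
     k * (b - a) = complex.Im (r (Complex b t)) - complex.Im (r (Complex a t)).
    by rewrite /r !cImB !cImM !cReB !cImB /= /k; ring.
  rewrite (le_trans (ler_normB _ _)) // mulr2n mulrDl mul1r.
  by apply: lerD; rewrite (le_trans (normIm_le _)) //; apply: H => //; lra.
move: E1 E2; set I1 := segint _ _ _; set I2 := segint _ _ _.
by rewrite !ler_norml => /andP[e1 e2] /andP[e3 e4]; apply/andP; split; lra.
Qed.

(** Of the four quarters of the rectangle one carries at least a quarter of
    the boundary integral. *)
Lemma bdint_step F x y w h : ccont F -> 0 <= w -> 0 <= h ->
  exists p : R * R, [/\ x <= p.1 <= x + w / 2, y <= p.2 <= y + h / 2 &
    `|bdint F x (x + w) y (y + h)| <=
    4 * `|bdint F p.1 (p.1 + w / 2) p.2 (p.2 + h / 2)|].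
Proof.
move=> cF w0 h0.
have E : bdint F x (x + w) y (y + h) =
   bdint F x (x + w / 2) y (y + h / 2) +
   bdint F x (x + w / 2) (y + h / 2) (y + h / 2 + h / 2) +
   (bdint F (x + w / 2) (x + w / 2 + w / 2) y (y + h / 2) +
   bdint F (x + w / 2) (x + w / 2 + w / 2) (y + h / 2) (y + h / 2 + h / 2)).
  have -> : y + h = y + h / 2 + h / 2 by lra.
  have -> : x + w = x + w / 2 + w / 2 by lra.
  rewrite (@bdint_splitx F x (x + w / 2)) //; try lra.
  rewrite (@bdint_splity F x (x + w / 2) y (y + h / 2)) //; try lra.
  by rewrite (@bdint_splity F (x + w / 2) _ y (y + h / 2)) //; lra.
rewrite E; move: E => _.
set b1 := bdint _ _ _ _ _; set b2 := bdint _ _ _ _ _.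
set b3 := bdint _ _ _ _ _; set b4 := bdint _ _ _ _ _.
have N : `|b1 + b2 + (b3 + b4)| <= `|b1| + `|b2| + (`|b3| + `|b4|).
  by rewrite (le_trans (ler_normD _ _)) // lerD // ler_normD.
have w2 : 0 <= w / 2 by rewrite divr_ge0.
have h2 : 0 <= h / 2 by rewrite divr_ge0.
have [l1|l1] := leP (`|b1| + `|b2| + (`|b3| + `|b4|)) (4 * `|b1|).
  by exists (x, y); split; rewrite /= ?lexx ?lerDl ?w2 // (le_trans N).
have [l2|l2] := leP (`|b1| + `|b2| + (`|b3| + `|b4|)) (4 * `|b2|).
  by exists (x, y + h / 2); split; rewrite /= ?lexx ?lerDl ?w2 ?h2 // (le_trans N).
have [l3|l3] := leP (`|b1| + `|b2| + (`|b3| + `|b4|)) (4 * `|b3|).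
  by exists (x + w / 2, y); split; rewrite /= ?lexx ?lerDl ?w2 ?h2 // (le_trans N).
exists (x + w / 2, y + h / 2); split; rewrite /= ?lexx ?lerDl ?w2 ?h2 // (le_trans N) //.
rewrite -/b4; clear -l1 l2 l3; lra.
Qed.

(** Goursat's bisection: a nonzero boundary integral would survive, up to the
    factor 4^-k, on nested rectangles shrinking to a point X + iY, while
    differentiability there makes it o(4^-k). *)
Theorem goursat F a b c d : ccont F -> a <= b -> c <= d ->
  (forall x y, a <= x <= b -> c <= y <= d -> cdiff F (Complex x y)) ->
  bdint F a b c d = 0.
Proof.
move=> cF ab cd dF; apply: contrapT => /eqP; rewrite -normr_gt0.
pose w := b - a; pose h := d - c.
have w0 : 0 <= w by rewrite subr_ge0.
have h0 : 0 <= h by rewrite subr_ge0.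
have -> : b = a + w by rewrite /w; lra.
have -> : d = c + h by rewrite /h; lra.
set eta := `|_| => eta0.
pose W k (p : R * R) :=
  bdint F p.1 (p.1 + w / 2 ^+ k) p.2 (p.2 + h / 2 ^+ k).
pose bad k p := eta <= 4 ^+ k * `|W k p|.
have step k p : exists q, bad k p ->
   [/\ bad k.+1 q, p.1 <= q.1 <= p.1 + w / 2 ^+ k.+1 &
       p.2 <= q.2 <= p.2 + h / 2 ^+ k.+1].
  have wk : 0 <= w / 2 ^+ k by rewrite divr_ge0 // exprn_ge0.
  have hk : 0 <= h / 2 ^+ k by rewrite divr_ge0 // exprn_ge0.
  have [q [q1 q2 q3]] := bdint_step p.1 p.2 cF wk hk.
  exists q => bp; rewrite exprSr invfM !mulrA; split => //.
  rewrite /bad /W exprSr -mulrA (le_trans bp) // ler_wpM2l ?exprn_ge0 //.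
  by rewrite [2 ^+ k.+1]exprSr invfM !mulrA.
pose s := fix s k := if k is k'.+1 then sval (cid (step k' (s k'))) else (a, c).
have sS k : s k.+1 = sval (cid (step k (s k))) by [].
have sbad k : bad k (s k).
  elim: k => [|k IH]; first by rewrite /bad /W /= !divr1 mul1r.
  by rewrite sS; case: cid => q /= /(_ IH)[].
have [X HX] := @nested_point _ (fun k => (s k).1) w w0 (fun k =>
  (ltac:(by rewrite sS; case: cid => q /= /(_ (sbad k))[]) :
    (s k).1 <= (s k.+1).1 <= (s k).1 + w / 2 ^+ k.+1)).
have [Y HY] := @nested_point _ (fun k => (s k).2) h h0 (fun k =>
  (ltac:(by rewrite sS; case: cid => q /= /(_ (sbad k))[]) :
    (s k).2 <= (s k.+1).2 <= (s k).2 + h / 2 ^+ k.+1)).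
have [D HD] : cdiff F (Complex X Y).
  apply: dF; first by have := HX 0%N; rewrite /= divr1 /w; lra.
  by have := HY 0%N; rewrite /= divr1 /h; lra.
pose L := w + h; have L0 : 0 <= L by rewrite addr_ge0.
have Lq : 0 < 2 * L ^+ 2 + 1 by rewrite ltr_wpDl // mulr_ge0 // sqr_ge0.
have [r r0 Hr] := HD (eta / (2 * L ^+ 2 + 1)) (divr_gt0 eta0 Lq).
have [k Hk] := exists_pow_le L0 r0.
have := sbad k; rewrite /bad => B.
have p2 : 0 < 2 ^+ k :> R by rewrite exprn_gt0.
have wk : 0 <= w / 2 ^+ k by rewrite divr_ge0 // ltW.
have hk : 0 <= h / 2 ^+ k by rewrite divr_ge0 // ltW.
have loc x y : (s k).1 <= x <= (s k).1 + w / 2 ^+ k ->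
    (s k).2 <= y <= (s k).2 + h / 2 ^+ k ->
    cmod (F (Complex x y) - F (Complex X Y) - D * (Complex x y - Complex X Y))
    <= eta / (2 * L ^+ 2 + 1) * (L / 2 ^+ k).
  move=> hx hy; set z := Complex x y; set z0 := Complex X Y.
  have zz : cmod (z - z0) <= L / 2 ^+ k.
    rewrite (le_trans (cmod_leReIm _)) // cReB cImB /= /L mulrDl.
    have := HX k; have := HY k; clear -hx hy => ? ?.
    by apply: lerD; rewrite ler_norml; apply/andP; split; lra.
  have := Hr (z - z0) (le_trans zz Hk); rewrite [z0 + _]addrC subrK.
  move=> /le_trans; apply; rewrite ler_wpM2l // ltW // divr_gt0 //.
have sw : (s k).1 <= (s k).1 + w / 2 ^+ k by rewrite lerDl.
have sh : (s k).2 <= (s k).2 + h / 2 ^+ k by rewrite lerDl.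
have := bdint_local cF sw sh loc; rewrite -/(W k (s k)) => B2.
have {B B2} : eta <= eta / (2 * L ^+ 2 + 1) * (2 * L ^+ 2).
  rewrite (le_trans B) // -ler_pdivlMl ?exprn_gt0 // (le_trans B2) //.
  rewrite le_eqVlt; apply/orP; left; apply/eqP.
  have -> : (4 : R) = 2 * 2 by ring.
  by rewrite exprMn /L; field; rewrite gt_eqF // gt_eqF.
rewrite mulrAC ler_pdivlMr // ler_pM2l //; clear; lra.
Qed.

End Goursat.

(** * The mean value property *)

Section MeanValue.
Context {R : realType}.
Implicit Types (z w : R[i]) (F f g : R[i] -> R[i]).

Lemma ccont_comp f g : ccont f -> ccont g -> ccont (fun w => g (f w)).
Proof.
move=> cf cg z e /(cg (f z))[d d0 H].
have [d' d'0 H'] := cf z d d0; exists d' => // h /H' /H.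
by rewrite [f z + _]addrC subrK.
Qed.

Lemma cexp_2pi (x : R) : cexp (Complex x (2 * pi)) = cexp (Complex x 0).
Proof. by rewrite /cexp /= mulr2n mulrDl mul1r -mulr2n cos2pi sin2pi cos0 sin0. Qed.

(** In the coordinate w |-> z0 + exp w, circles about z0 are vertical segments
    of height 2 pi.  [goursat] on the rectangles between them makes the average
    independent of the radius, and continuity at z0 identifies its value.
    The centre is excepted from differentiability because the maximum principle
    has to apply to functions with isolated exceptional points. *)
Lemma mean_value f z0 (r : R) : 0 < r -> ccont f ->
  (forall z, 0 < cmod (z - z0) <= r -> cdiff f z) ->
  segint 0 (2 * pi) (fun y => complex.Im (f (z0 + cexp (Complex (ln r) y)))) =
  complex.Im (f z0) * (2 * pi).
Proof.
move=> r0 cf df; pose F w := f (z0 + cexp w).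
have cF : ccont F.
  apply: ccont_comp cf; apply: cdiff_ccont => w.
  by apply: cdiffD; [exact: cdiff_cst|exact: cdiff_cexp].
have dF w : complex.Re w <= ln r -> cdiff F w.
  move=> wr; apply: (@cdiff_comp _ (fun w => z0 + cexp w) f).
    by apply: cdiffD; [exact: cdiff_cst|exact: cdiff_cexp].
  apply: df; rewrite addrC addKr cmod_cexp expR_gt0 /=.
  by rewrite -[leRHS](lnK r0) ler_expR.
have pi0 : 0 <= 2 * pi :> R by rewrite mulr_ge0 // pi_ge0.
have inv L : L <= ln r -> segint 0 (2 * pi) (fun y => complex.Im (F (Complex (ln r) y)))
   = segint 0 (2 * pi) (fun y => complex.Im (F (Complex L y))).
  move=> Lr; have := @goursat _ F L (ln r) 0 (2 * pi) cF Lr pi0.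
  move=> /(_ _)/wrap[]; first by move=> x y xr _; apply: dF => /=; lra.
  rewrite /bdint; under eq_segint do rewrite /F -cexp_2pi.
  by rewrite subrr sub0r => /eqP; rewrite oppr_eq0 subr_eq0 => /eqP.
apply/eqP; rewrite -subr_eq0 -normr_eq0; apply/eqP/le_anti; rewrite normr_ge0 andbT.
apply/ler_addgt0Pl => e e0; rewrite addr0.
have [d d0 H] := cf z0 (e / (2 * pi)) (divr_gt0 e0 (mulr_gt0 (ltr0Sn _ _) (pi_gt0 R))).
pose L := Num.min (ln r) (ln d).
have Lr : L <= ln r by rewrite ge_min lexx.
have Ld : L <= ln d by rewrite ge_min lexx orbT.
have -> : e = e / (2 * pi) * (2 * pi - 0).
  by rewrite subr0 divfK // mulf_neq0 // gt_eqF // pi_gt0.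
rewrite (inv L Lr) -[X in _ - _ * X]subr0.
apply: segint_near => //; first exact: ccont_Im.
move=> y _; rewrite -cImB (le_trans (normIm_le _)) // H //.
by rewrite cmod_cexp -[leRHS](lnK d0) ler_expR.
Qed.

Definition rcont (u : R[i] -> R) := forall z (e : R), 0 < e ->
  exists2 d : R, 0 < d & forall h, cmod h <= d -> `|u (z + h) - u z| <= e.

Lemma rcont_continuous (u : R[i] -> R) : rcont u ->
  continuous (fun p : R * R => u (Complex p.1 p.2)).
Proof.
move=> cu [x y]; apply/cvgrPdist_le => /= e e0.
have [d d0 H] := cu (Complex x y) e e0.
have d2 : 0 < d / 2 by rewrite divr_gt0.
have N (t : R) : \forall s \near t, `|t - s| <= d / 2.
  by apply/nbhs_ballP; exists (d / 2) => //= s; exact: ltW.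
have N1 : \forall p \near (x, y), `|x - p.1| <= d / 2.
  by exists ([set s | `|x - s| <= d / 2], setT) => [|[s t] []//];
    split; [exact: N|exact: filterT].
have N2 : \forall p \near (x, y), `|y - p.2| <= d / 2.
  by exists (setT, [set s | `|y - s| <= d / 2]) => [|[s t] []//];
    split; [exact: filterT|exact: N].
near=> p; rewrite distrC.
have -> : Complex p.1 p.2 = Complex x y + Complex (p.1 - x) (p.2 - y).
  by apply/eqP; rewrite eq_complex /= ![_ + (_ - _)]addrC !subrK !eqxx.
apply: H; rewrite (le_trans (cmod_leReIm _)) //=.
suff [h1 h2] : `|x - p.1| <= d / 2 /\ `|y - p.2| <= d / 2.
  by rewrite distrC [`|p.2 - _|]distrC; lra.
by split; near: p.
Unshelve. all: by end_near. Qed.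

(** Compact sets are described as bounded sublevel sets phi <= 0 of a
    continuous function, so that the topological boundary is contained in
    phi = 0 and interior points are those where phi < 0. *)
Lemma rcont_max (phi u : R[i] -> R) (B : R) z1 : rcont phi -> rcont u ->
  (forall z, phi z <= 0 -> cmod z <= B) -> phi z1 <= 0 ->
  exists2 z0, phi z0 <= 0 & forall z, phi z <= 0 -> u z <= u z0.
Proof.
move=> cphi cu bd h1.
pose A := [set p : R * R | phi (Complex p.1 p.2) <= 0].
have A0 : A !=set0 by exists (complex.Re z1, complex.Im z1); case: z1 h1.
have clA : closed A.
  have := @closed_comp _ _ (fun p : R * R => phi (Complex p.1 p.2)) [set x | x <= 0].
  by apply; [move=> p _; exact: rcont_continuous|exact: closed_le].
have cA : compact A.
  apply: (subclosed_compact clA (compact_setX (@segment_compact _ (- B) B)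
     (@segment_compact _ (- B) B))).
  move=> [x y] /bd hb; split; rewrite /= in_itv /= -ler_norml.
    exact: le_trans (normRe_le _) hb.
  exact: le_trans (normIm_le _) hb.
have [[x y]] := @compact_EVT_max _ _ (fun p : R * R => u (Complex p.1 p.2)) A A0 cA
   (continuous_subspaceT (rcont_continuous cu)).
rewrite inE => Axy H; exists (Complex x y) => //.
by case=> a b ab; have := H (a, b); rewrite inE; exact.
Qed.

End MeanValue.

(** * The maximum principle *)

Section MaximumModulus.
Context {R : realType}.
Implicit Types (z w : R[i]) (F f g : R[i] -> R[i]) (u v phi : R[i] -> R).

Lemma rcontD u v : rcont u -> rcont v -> rcont (fun z => u z + v z).
Proof.
move=> cu cv z e e0; have e2 : 0 < e / 2 by rewrite divr_gt0.
have [d d0 H] := cu z _ e2; have [d' d'0 H'] := cv z _ e2.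
exists (Num.min d d'); first by rewrite lt_min d0.
move=> h; rewrite le_min => /andP[/H h1 /H' h2].
have -> : u (z + h) + v (z + h) - (u z + v z) =
  (u (z + h) - u z) + (v (z + h) - v z) by ring.
by rewrite (le_trans (ler_normD _ _)) //; lra.
Qed.

Lemma rcont_cst (c : R) : rcont (fun=> c).
Proof. by move=> z e e0; exists 1 => // h _; rewrite subrr normr0 ltW. Qed.

Lemma rcont_Im f : ccont f -> rcont (fun z => complex.Im (f z)).
Proof.
move=> cf z e /(cf z)[d d0 H]; exists d => // h /H.
by rewrite -cImB; apply: le_trans; exact: normIm_le.
Qed.

Lemma rcont_Re f : ccont f -> rcont (fun z => complex.Re (f z)).
Proof.
move=> cf z e /(cf z)[d d0 H]; exists d => // h /H.
by rewrite -cReB; apply: le_trans; exact: normRe_le.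
Qed.

Lemma rcont_cmod f : ccont f -> rcont (fun z => cmod (f z)).
Proof.
move=> cf z e /(cf z)[d d0 H]; exists d => // h /H.
by apply: le_trans; exact: ler_dist_cmod.
Qed.

Lemma rcont_neg phi z : rcont phi -> phi z < 0 ->
  exists2 d : R, 0 < d & forall h, cmod h <= d -> phi (z + h) < 0.
Proof.
move=> cphi p0; have e0 : 0 < - phi z / 2 by rewrite divr_gt0 // oppr_gt0.
have [d d0 H] := cphi z _ e0; exists d => // h /H.
by rewrite ler_norml; lra.
Qed.

(** Isolated exceptional points are allowed anywhere: combinations of difference
    quotients have one at each of their base points. *)
Definition iso_cdiff f := forall z0, exists2 r : R, 0 < r &
  forall z, 0 < cmod (z - z0) <= r -> cdiff f z.

(** Adding dl |z|^2 to Im f makes the maximum principle strict.  At an interior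
    maximum z0 the mean value property is applied to f corrected by an affine
    term; as |z0 + s|^2 = |z0|^2 + 2 Re (conj z0 s) + |s|^2, the average of the
    corrected function over a circle of radius r would fall below its value at
    the centre by dl r^2. *)
Lemma max_imaginary f phi (B M : R) : rcont phi ->
  (forall z, phi z <= 0 -> cmod z <= B) -> ccont f -> iso_cdiff f ->
  (forall z, phi z = 0 -> complex.Im (f z) <= M) ->
  forall z, phi z <= 0 -> complex.Im (f z) <= M.
Proof.
move=> cphi bd cf df fM z1 p1; apply/ler_addgt0Pr => e e0.
have B0 : 0 <= B by apply: le_trans (bd _ p1); exact: cmod_ge0.
pose dl := e / (B ^+ 2 + 1).
have B1 : 0 < B ^+ 2 + 1 by rewrite ltr_wpDl // sqr_ge0.
have dl0 : 0 < dl by rewrite divr_gt0.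
(* dl B^2 <= e, so the perturbation costs at most e on the set. *)
pose u z := complex.Im (f z) + cmod (real_complex R dl * (z * z)).
have uE z : u z = complex.Im (f z) + dl * cmod z ^+ 2.
  by rewrite /u !cmodM cmod_real ger0_norm // ltW.
have cu : rcont u.
  apply: rcontD; [exact: rcont_Im|apply/rcont_cmod/cdiff_ccont => z].
  by apply: cdiffM (cdiffM (cdiff_id z) (cdiff_id z)); exact: cdiff_cst.
have [z0 p0 max0] := rcont_max cphi cu bd p1.
suff pz0 : phi z0 = 0.
  have H1 := max0 _ p1; rewrite !uE in H1; have H2 := fM _ pz0.
  have H3 : dl * cmod z0 ^+ 2 <= e.
    rewrite /dl mulrAC ler_pdivrMr // (ler_pM2l e0).
    apply: (@le_trans _ _ (B ^+ 2)); last by rewrite lerDl.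
    by rewrite ler_pXn2r ?nnegrE ?cmod_ge0 // bd.
  have H4 : 0 <= dl * cmod z1 ^+ 2 by rewrite mulr_ge0 ?sqr_ge0 // ltW.
  lra.
apply/eqP; rewrite eq_le p0 leNgt; apply/negP => pneg.
have [r1 r10 H1] := rcont_neg cphi pneg; have [r2 r20 H2] := df z0.
pose r := Num.min r1 r2.
have r0 : 0 < r by rewrite lt_min r10.
(* The affine term has imaginary part 2 dl Re (conj z0 (z - z0)), the linear part of dl |z|^2. *)
pose G z := f z + real_complex R (2 * dl) * (Complex 0 1 * conjc z0 * (z - z0)).
have dL z : cdiff (fun z => real_complex R (2 * dl) *
    (Complex 0 1 * conjc z0 * (z - z0))) z.
  apply: cdiffM (cdiff_cst _ _) (cdiffM (cdiff_cst _ _) _).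
  exact: cdiffB (cdiff_id _) (cdiff_cst _ _).
have cG : ccont G.
  move=> z; apply: (@ccont_atD R f (fun z =>
    real_complex R (2 * dl) * (Complex 0 1 * conjc z0 * (z - z0)))); first exact: cf.
  exact: (cdiff_ccont dL).
have := @mean_value _ G z0 r r0 cG (fun z hz => cdiffD
  (H2 z (ltac:(by move: hz => /andP[-> /= /le_trans]; apply; rewrite ge_min lexx orbT)))
  (dL z)).
have -> : complex.Im (G z0) = complex.Im (f z0).
  by rewrite /G subrr !mulr0 addr0.
move=> MV.
have pi0 : 0 < 2 * pi :> R by rewrite mulr_gt0 // pi_gt0.
have : complex.Im (f z0) * (2 * pi) <= (complex.Im (f z0) - dl * r ^+ 2) * (2 * pi - 0).
  rewrite -MV -(@segint_cst _ 0 (2 * pi) (complex.Im (f z0) - dl * r ^+ 2) (ltW pi0)).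
  apply: segint_le.
  - apply: (@ccont_Im _ (fun w => G (z0 + cexp w))).
    apply: ccont_comp cG; apply: cdiff_ccont => w.
    by apply: cdiffD; [exact: cdiff_cst|exact: cdiff_cexp].
  - by move=> x; exact: cvg_cst.
  move=> t _; set s := cexp _.
  have sr : cmod s = r by rewrite /s cmod_cexp /= lnK.
  have := max0 (z0 + s); rewrite !uE => /(_ _)/wrap[].
    by apply/ltW/H1; rewrite sr ge_min lexx.
  rewrite /G cImD [z0 + s - _]addrC addKr.
  have -> : complex.Im (real_complex R (2 * dl) * (Complex 0 1 * conjc z0 * s)) =
    2 * dl * (complex.Re z0 * complex.Re s + complex.Im z0 * complex.Im s).
    by case: z0 s {max0 p0 pneg H1 H2 G dL cG MV sr} => a b [c d] /=; ring.
  have := cmod_sqr s; rewrite sr !cmod_sqr cReD cImD => ->.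
  by move=> h; clear -h; lra.
rewrite subr0 ler_pM2r // lerDl oppr_ge0 leNgt mulr_gt0 // exprn_gt0 //.
Qed.

(** At a given point, multiply f by the number of modulus 1 which rotates the
    value onto the positive imaginary axis, and use [max_imaginary]. *)
Theorem maximum_modulus f phi (B M : R) : rcont phi ->
  (forall z, phi z <= 0 -> cmod z <= B) -> ccont f -> iso_cdiff f ->
  (forall z, phi z = 0 -> cmod (f z) <= M) ->
  forall z, phi z <= 0 -> cmod (f z) <= M.
Proof.
move=> cphi bd cf df fM z1 p1.
have [f0|f0] := eqVneq (cmod (f z1)) 0.
  have : complex.Im (f z1) <= M.
    apply: (max_imaginary cphi bd cf df _ p1) => z /fM.
    by apply: le_trans; exact: le_trans (ler_norm _) (normIm_le _).
  by have /eqP := f0; rewrite cmod_eq0 => /eqP ->; rewrite cmod0.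
(* The rotation sending f z1 to i |f z1|. *)
pose c := Complex 0 1 * conjc (f z1) / real_complex R (cmod (f z1)).
have c1 : cmod c = 1.
  rewrite /c !cmodM cmodV cmod_real ger0_norm ?cmod_ge0 //.
  have -> : cmod (conjc (f z1)) = cmod (f z1).
    by case: (f z1) => a b; rewrite /ComplexField.Normc.normc /= sqrrN.
  have -> : cmod (Complex 0 1 : R[i]) = 1.
    by rewrite /ComplexField.Normc.normc /= expr0n expr1n add0r sqrtr1.
  by rewrite mul1r divff.
have -> : cmod (f z1) = complex.Im (c * f z1).
  have -> : c * f z1 = real_complex R (cmod (f z1)) * Complex 0 1.
    have f0' : real_complex R (cmod (f z1)) != 0.
      by apply: contra f0 => /eqP/(congr1 (@complex.Re R)) /= ->.
    apply: (mulIf f0'); rewrite /c mulrAC divfK // -mulrA.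
    have -> : conjc (f z1) * f z1 = real_complex R (cmod (f z1) ^+ 2).
      rewrite cmod_sqr; case: (f z1) => a b /=.
      by apply/eqP; rewrite eq_complex /=; apply/andP; split; apply/eqP; ring.
    by rewrite mulrAC -rmorphM /= mulrC expr2.
  by rewrite cImM /=; ring.
apply: (max_imaginary (f := fun z => c * f z) cphi bd _ _ _ p1).
- move=> z e e0; have [d d0 H] := cf z e e0; exists d => // h /H.
  by rewrite -mulrBr cmodM c1 mul1r.
- move=> z0; have [r r0 H] := df z0; exists r => // z /H fz.
  exact: cdiffM (cdiff_cst _ _) fz.
move=> z /fM; apply: le_trans; rewrite (le_trans (ler_norm _)) //.
by rewrite (le_trans (normIm_le _)) // cmodM c1 mul1r.
Qed.

Lemma cdiff_iso f : (forall z, cdiff f z) -> iso_cdiff f.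
Proof. by move=> df z0; exists 1. Qed.

Lemma maximum_modulus_disc f (r M : R) : ccont f -> iso_cdiff f ->
  (forall z, cmod z = r -> cmod (f z) <= M) ->
  forall z, cmod z <= r -> cmod (f z) <= M.
Proof.
move=> cf df fM z zr.
apply: (@maximum_modulus f (fun z => cmod z + - r) r M) => //.
- apply: rcontD (rcont_cst _); apply: (@rcont_cmod id).
  exact: cdiff_ccont (@cdiff_id R).
- by move=> w; rewrite subr_le0.
- by move=> w /eqP; rewrite subr_eq0 => /eqP; exact: fM.
- by rewrite subr_le0.
Qed.

End MaximumModulus.

(** * Removable singularities and Taylor polynomials *)

Section TaylorPolynomials.
Context {R : realType}.
Implicit Types (z w t h : R[i]) (F f g q : R[i] -> R[i]).

(** The difference quotient, extended by the prescribed value D at z0; with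
    D the derivative of g at z0 it is continuous. *)
Definition dquot g z0 (D : R[i]) z :=
  if z == z0 then D else (g z - g z0) / (z - z0).

Lemma dquot_near g z0 D z : z != z0 -> exists2 d : R, 0 < d &
  forall h, cmod h <= d ->
    (fun w => (g w + - g z0) * (w - z0)^-1) (z + h) = dquot g z0 D (z + h).
Proof.
move=> zz; have d0 : 0 < cmod (z - z0) / 2.
  by rewrite divr_gt0 // cmod_gt0 subr_eq0.
exists (cmod (z - z0) / 2) => // h hd; rewrite /dquot ifN //.
apply/eqP => E; move: hd d0; rewrite -E opprD addNKr cmodN; lra.
Qed.

Lemma dquot_cdiff g z0 D z : z != z0 -> cdiff g z -> cdiff (dquot g z0 D) z.
Proof.
move=> zz dg; have [d d0 H] := dquot_near g D zz; apply: (cdiff_near d0 H).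
apply: cdiffM.
  by apply: (@cdiffD _ g (fun=> - g z0)) => //; exact: cdiff_cst.
apply: (@cdiffV _ (fun w => w - z0)); first by rewrite subr_eq0.
by apply: cdiffB; [exact: cdiff_id|exact: cdiff_cst].
Qed.

Lemma dquot_ccont g z0 D : ccont g -> cder g z0 D -> ccont (dquot g z0 D).
Proof.
move=> cg dg z; have [->|zz] := eqVneq z z0; last first.
  have [d d0 H] := dquot_near g D zz; apply: (ccont_at_near d0 H).
  apply: ccont_atM.
    by apply: (@ccont_atD R g (fun=> - g z0)); [exact: cg|apply/cdiff_ccont/cdiff_cst].
  move=> e; apply: cdiff_cont; apply: (@cdiffV _ (fun w => w - z0)); first by rewrite subr_eq0.
  by apply: cdiffB; [exact: cdiff_id|exact: cdiff_cst].
move=> e e0; have [d d0 H] := dg e e0; exists d => // h hd; rewrite /dquot eqxx.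
case: eqVneq => [_|hz]; first by rewrite subrr cmod0 ltW.
have h0 : h != 0 by apply: contra hz => /eqP ->; rewrite addr0.
have -> : (g (z0 + h) - g z0) / (z0 + h - z0) - D =
  (g (z0 + h) - g z0 - D * h) / h.
  by rewrite [z0 + h - _]addrC addKr; field.
by rewrite cmodM cmodV ler_pdivrMr ?cmod_gt0 // H.
Qed.

Lemma real_cauchy (c : nat -> R) :
  (forall e : R, 0 < e -> exists N, forall n m, (N <= n)%N -> (N <= m)%N ->
     `|c n - c m| <= e) ->
  exists D, forall e : R, 0 < e -> exists N, forall n, (N <= n)%N -> `|c n - D| <= e.
Proof.
move=> H; have : cvg (c @ \oo).
  apply/cauchy_cvgP/cauchy_ballP => e e0.
  have e2 : 0 < e / 2 by rewrite divr_gt0.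
  have [N HN] := H _ e2; exists ([set x | exists2 n, (N <= n)%N & c n = x],
     [set x | exists2 n, (N <= n)%N & c n = x]) => /=.
    by split; exists N => // n /= Nn; exists n.
  move=> [x y] /= [[n Nn <-] [m Nm <-]]; rewrite /ball /=.
  by rewrite (le_lt_trans (HN _ _ Nn Nm)) // ltr_pdivrMr // ltr_pMr // ltr1n.
move=> /cvg_ex[D /cvgrPdist_le cD]; exists D => e /cD[N _ HN]; exists N => n /HN.
by rewrite distrC.
Qed.

Lemma complex_cauchy (c : nat -> R[i]) :
  (forall e : R, 0 < e -> exists N, forall n m, (N <= n)%N -> (N <= m)%N ->
     cmod (c n - c m) <= e) ->
  exists D, forall e : R, 0 < e -> exists N, forall n, (N <= n)%N -> cmod (c n - D) <= e.
Proof.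
move=> H.
have [|a Ha] := @real_cauchy (fun n => complex.Re (c n)).
  move=> e /H[N HN]; exists N => n m Nn Nm.
  by rewrite -cReB (le_trans (normRe_le _)) // HN.
have [|b Hb] := @real_cauchy (fun n => complex.Im (c n)).
  move=> e /H[N HN]; exists N => n m Nn Nm.
  by rewrite -cImB (le_trans (normIm_le _)) // HN.
exists (Complex a b) => e e0; have e2 : 0 < e / 2 by rewrite divr_gt0.
have [N HN] := Ha _ e2; have [N' HN'] := Hb _ e2; exists (maxn N N') => n.
rewrite geq_max => /andP[/HN h1 /HN' h2].
by rewrite (le_trans (cmod_leReIm _)) // cReB cImB /=; lra.
Qed.

Lemma iso_cdiff_off f (s : seq R[i]) :
  (forall t, t \notin s -> cdiff f t) -> iso_cdiff f.
Proof.
move=> H z0; suff [r r0 Hr] : exists2 r : R, 0 < r &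
    forall x, x \in s -> x != z0 -> r < cmod (x - z0).
  exists r => // z /andP[z1 z2]; apply: H; apply/negP => /Hr.
  by rewrite -subr_eq0 -cmod_gt0 z1 ltNge z2 => /(_ isT).
elim: s {H} => [|x s [r r0 IH]]; first by exists 1.
have [->|xz] := eqVneq x z0.
  by exists r => // y; rewrite inE => /predU1P[->|/IH//]; rewrite eqxx.
have d0 : 0 < cmod (x - z0) by rewrite cmod_gt0 subr_eq0.
exists (Num.min r (cmod (x - z0) / 2)); first by rewrite lt_min r0 divr_gt0.
move=> y; rewrite inE gt_min => /predU1P[-> _|/IH h /h ->//].
by rewrite ltr_pdivrMr // ltr_pMr // ltr1n orbT.
Qed.

(** A singularity at which q is continuous is removable.  The difference of the
    quotients of q at z and w is, as a function of t, differentiable off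
    {0, z, w}, so by the maximum principle its value at t = 0 is controlled on
    |t| = 1, where it is small when z and w are close to 0.  Hence the
    difference quotients of q at 0 are Cauchy. *)
Lemma cdiff_removable q : ccont q -> (forall z, z != 0 -> cdiff q z) -> cdiff q 0.
Proof.
move=> cq dq.
have [z1 z1p Mq] := @rcont_max _ (fun z => cmod z + - 1) (fun z => cmod (q z)) 1 0
  (rcontD (rcont_cmod (cdiff_ccont (@cdiff_id R))) (rcont_cst _)) (rcont_cmod cq)
  (ltac:(by move=> z; rewrite subr_le0)) (ltac:(by rewrite /= cmod0 add0r lerN10)).
set M := cmod (q z1) in Mq; have M0 : 0 <= M by exact: cmod_ge0.
pose phi z := (q z - q 0) / z.
have key (e : R) : 0 < e -> exists2 d : R, 0 < d & forall z w, z != 0 -> w != 0 ->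
    cmod z <= d -> cmod w <= d -> cmod (phi z - phi w) <= e.
  move=> e0; have e24 : 0 < e / 24 by rewrite divr_gt0.
  have [d1 d10 H1] := cq 0 _ e24.
  have d20 : 0 < e / (32 * (M + 1)) by rewrite divr_gt0 // mulr_gt0 //; lra.
  exists (Num.min (Num.min (1 / 2) d1) (e / (32 * (M + 1)))).
    by rewrite !lt_min d10 d20 divr_gt0.
  move=> z w z0 w0; rewrite !le_min => /andP[/andP[z12 /H1 qz] zd].
  move=> /andP[/andP[w12 /H1 qw] wd].
  have [Dz HDz] := dq z z0; have [Dw HDw] := dq w w0.
  (* K 0 is the difference of the quotients of q at 0 towards z and w. *)
  pose K t := dquot q z Dz t - dquot q w Dw t.
  have -> : phi z - phi w = K 0.
    rewrite /K /dquot [0 == z]eq_sym [0 == w]eq_sym (negbTE z0) (negbTE w0) /phi.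
    by field; apply/andP.
  have cK : ccont K.
    move=> t; apply: (@ccont_atD R (dquot q z Dz) (fun x => - dquot q w Dw x)).
      exact: dquot_ccont.
    move=> e' e'0; have [d d0 H] := dquot_ccont cq HDw t e'0.
    by exists d => // h /H; rewrite -opprD cmodN.
  have dK t : t != 0 -> t != z -> t != w -> cdiff K t.
    by move=> t0 tz tw; apply: cdiffB; apply: dquot_cdiff => //; exact: dq.
  have iK : iso_cdiff K.
    apply: (@iso_cdiff_off K [:: 0; z; w]) => t.
    by rewrite !inE !negb_or => /and3P[]; exact: dK.
  apply: (@maximum_modulus_disc _ K 1) => //; last by rewrite cmod0.
  move=> t t1.
  have tz : 1 / 2 <= cmod (t - z).
    have := ler_dist_cmod t z; rewrite t1 ler_norml; lra.
  have tw : 1 / 2 <= cmod (t - w).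
    have := ler_dist_cmod t w; rewrite t1 ler_norml; lra.
  have tz0 : t - z != 0 by rewrite -cmod_gt0; lra.
  have tw0 : t - w != 0 by rewrite -cmod_gt0; lra.
  have -> : K t = ((q t - q z) * (z - w) + (q w - q z) * (t - z)) / ((t - z) * (t - w)).
    rewrite /K /dquot -subr_eq0 (negbTE tz0) -[t == w]subr_eq0 (negbTE tw0).
    by field; apply/andP.
  rewrite cmodM cmodV ler_pdivrMr ?cmod_gt0 ?mulf_neq0 //.
  have B1 : cmod (q t - q z) <= 2 * M.
    rewrite (le_trans (cmodB _ _)) // mulr2n mulrDl mul1r.
    by apply: lerD; apply: Mq; rewrite subr_le0 ?t1 //; lra.
  have B2 : cmod (z - w) <= 2 * (e / (32 * (M + 1))).
    by rewrite (le_trans (cmodB _ _)) //; lra.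
  have B3 : cmod (q w - q z) <= 2 * (e / 24).
    rewrite !add0r in qz qw.
    have -> : q w - q z = (q w - q 0) - (q z - q 0) by ring.
    by rewrite (le_trans (cmodB _ _)) //; lra.
  have B4 : cmod (t - z) <= 3 / 2.
    by rewrite (le_trans (cmodB _ _)) // t1; lra.
  have P1 : cmod (q t - q z) * cmod (z - w) <= 2 * M * (2 * (e / (32 * (M + 1)))).
    by apply: ler_pM; rewrite ?cmod_ge0.
  have P2 : cmod (q w - q z) * cmod (t - z) <= 2 * (e / 24) * (3 / 2).
    by apply: ler_pM; rewrite ?cmod_ge0.
  have P3 : 2 * M * (2 * (e / (32 * (M + 1)))) <= e / 8.
    rewrite [leLHS](_ : _ = e / 8 * (M / (M + 1))); last by field; rewrite gt_eqF //; lra.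
    rewrite -[leRHS]mulr1 ler_pM2l ?divr_gt0 // ler_pdivrMr; lra.
  have P4 : 1 / 2 * (1 / 2) <= cmod ((t - z) * (t - w)).
    by rewrite cmodM; apply: ler_pM.
  apply: (@le_trans _ _ (e * (1 / 2 * (1 / 2)))); last by rewrite ler_pM2l.
  by rewrite (le_trans (cmodD _ _)) // !cmodM; lra.
have eps0 (n : nat) : 0 < (n.+1%:R : R)^-1 by rewrite invr_gt0.
pose s n : R[i] := real_complex R (n.+1%:R^-1).
have cs n : cmod (s n) = n.+1%:R^-1 by rewrite cmod_real ger0_norm // ltW.
have s0 n : s n != 0 by rewrite -cmod_gt0 cs.
have small (d : R) : 0 < d -> exists N, forall n, (N <= n)%N -> cmod (s n) <= d.
  move=> d0; exists (Num.truncn d^-1) => n Nn.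
  rewrite cs invf_ple ?posrE // (le_trans (ltW (truncnS_gt _))) // ler_nat ltnS //.
have [|D HD] := @complex_cauchy (fun n => phi (s n)).
  move=> e /key[d d0 H]; have [N HN] := small d d0; exists N => n m Nn Nm.
  by apply: H => //; exact: HN.
exists D => e e0; have e2 : 0 < e / 2 by rewrite divr_gt0.
have [d d0 H] := key _ e2; exists d => // h hd.
have [->|h0] := eqVneq h 0.
  by rewrite addr0 mulr0 subrr subr0 cmod0 mulr0.
have [N HN] := small d d0; have [N' HN'] := HD _ e2.
pose n := maxn N N'.
have H1 := H h (s n) h0 (s0 n) hd (HN _ (leq_maxl _ _)).
have H2 := HN' n (leq_maxr _ _).
have -> : q (0 + h) - q 0 - D * h = (phi h - D) * h.
  by rewrite add0r /phi; field.
rewrite cmodM ler_pM2r ?cmod_gt0 //.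
have -> : phi h - D = (phi h - phi (s n)) + (phi (s n) - D) by ring.
by rewrite (le_trans (cmodD _ _)) //; lra.
Qed.

(** The only possible singularity of the difference quotient is removable. *)
Lemma entire_quotient g : (forall z, cdiff g z) ->
  exists2 q, (forall z, cdiff q z) & forall z, g z = g 0 + z * q z.
Proof.
move=> dg; have [D HD] := dg 0; exists (dquot g 0 D).
  move=> z; have [->|z0] := eqVneq z 0; last exact: dquot_cdiff.
  apply: cdiff_removable; first by apply: dquot_ccont => //; exact: cdiff_ccont.
  by move=> w w0; exact: dquot_cdiff.
move=> z; rewrite /dquot; case: eqVneq => [->|z0]; first by rewrite mul0r addr0.
by rewrite subr0; field.
Qed.

(** Iterating [entire_quotient] gives g = P + z^n G with G entire.  The maximum
    principle bounds G by its size on |z| = r; the factor 2^n comes from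
    bounding the successive remainders by induction. *)
Theorem taylor_polynomial g (r M : R) n : (forall z, cdiff g z) -> 0 < r ->
  (forall z, cmod z <= r -> cmod (g z) <= M) ->
  exists2 P : {poly R[i]}, (size P <= n)%N &
    forall z, cmod z <= r -> cmod (g z - P.[z]) <= M * (2 * cmod z / r) ^+ n.
Proof.
move=> dg r0 gM.
have M0 : 0 <= M by apply: le_trans (gM 0 _); rewrite ?cmod_ge0 // cmod0 ltW.
have bd P G k : (forall z, cdiff G z) -> (forall z, g z = P.[z] + z ^+ k * G z) ->
    (forall z, cmod z <= r -> cmod P.[z] <= (2 ^+ k - 1) * M) ->
    forall z, cmod z <= r -> cmod (G z) <= 2 ^+ k * M / r ^+ k.
  move=> dG gE PM; apply: maximum_modulus_disc.
  - exact: cdiff_ccont.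
  - exact: cdiff_iso.
  move=> z zr; rewrite ler_pdivlMr ?exprn_gt0 // -zr -cmodX -cmodM mulrC.
  have -> : z ^+ k * G z = g z - P.[z] by rewrite gE addrC addKr.
  have h1 := gM z (ltac:(by rewrite zr)); have h2 := PM z (ltac:(by rewrite zr)).
  rewrite (le_trans (cmodB _ _)) //; lra.
have [P [G [sP dG gE PM]]] : exists P : {poly R[i]}, exists G, [/\ (size P <= n)%N,
    (forall z, cdiff G z), (forall z, g z = P.[z] + z ^+ n * G z) &
    (forall z, cmod z <= r -> cmod P.[z] <= (2 ^+ n - 1) * M)].
  elim: n => [|n [P [G [sP dG gE PM]]]].
    exists 0; exists g; split => //; first by rewrite size_poly0.
      by move=> z; rewrite horner0 add0r expr0 mul1r.
    by move=> z _; rewrite horner0 cmod0 expr0 subrr mul0r.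
  have [q dq Gq] := entire_quotient dG.
  exists (P + (G 0)%:P * 'X^n); exists q; split => //.
  - rewrite (leq_trans (size_polyD _ _)) // geq_max (leq_trans sP) //=.
    rewrite (leq_trans (size_polyMleq _ _)) // size_polyXn addnS /=.
    by rewrite -[n.+1]add1n leq_add2r size_polyC leq_b1.
  - by move=> z; rewrite gE [in LHS]Gq !hornerE exprSr; ring.
  move=> z zr; rewrite !hornerE (le_trans (cmodD _ _)) //.
  have h0 := bd _ _ _ dG gE PM 0 (ltac:(by rewrite cmod0 ltW)).
  have h1 := PM z zr.
  have h2 : cmod (G 0 * z ^+ n) <= 2 ^+ n * M.
    rewrite cmodM cmodX -[leRHS](divfK (lt0r_neq0 (exprn_gt0 n r0))).
    apply: ler_pM => //; rewrite ?exprn_ge0 ?cmod_ge0 //.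
    by apply: lerXn2r => //; rewrite nnegrE ?cmod_ge0 // ltW.
  by rewrite exprS; lra.
exists P => // z zr.
have -> : g z - P.[z] = z ^+ n * G z by rewrite gE addrC addKr.
rewrite cmodM cmodX (le_trans (ler_wpM2l _ (bd _ _ _ dG gE PM z zr))) ?exprn_ge0 ?cmod_ge0 //.
by rewrite !exprMn exprVn le_eqVlt; apply/orP; left; apply/eqP; ring.
Qed.

End TaylorPolynomials.

(** * Elementary trigonometric inequalities *)

Section RealTrigonometry.
Context {R : realType}.
Implicit Types (s t x y : R).

Lemma sinh_ge s : 0 <= s -> 2 * s <= expR s - expR (- s).
Proof.
move=> s0; have [||c cs] := @MVT_segment R (fun x => expR x - expR (- x))
    (fun x => expR x + expR (- x)) 0 s s0.
- move=> x _; apply: is_derive_eq; by rewrite mulrN1 opprK.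
- apply: continuous_subspaceT => x; apply: cvgB; first exact: continuous_expR.
  apply: (@continuous_comp _ _ _ -%R expR); first exact: opp_continuous.
  exact: continuous_expR.
rewrite oppr0 subrr oppr0 !addr0 => ->.
apply: ler_wpM2r => //.
have := expR_gt0 c; rewrite expRN => e0.
have : 0 <= (expR c - 1) ^+ 2 / expR c by rewrite divr_ge0 ?sqr_ge0 // ltW.
rewrite [X in 0 <= X](_ : _ = expR c + (expR c)^-1 - 2); first by lra.
by field; rewrite gt_eqF.
Qed.

Lemma sin_lip x y : `|sin x - sin y| <= `|x - y|.
Proof.
wlog xy : x y / y <= x.
  move=> H; have [/H//|/ltW/H] := leP y x.
  by rewrite distrC [`|y - x|]distrC.
have [|c cs ->] := @MVT_segment R (@sin R) (@cos R) y x xy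
  (fun z _ => is_derive_sin z).
  by apply: continuous_subspaceT; exact: continuous_sin.
by rewrite normrM ler_piMl // cos_max.
Qed.

Lemma cos_lip x y : `|cos x - cos y| <= `|x - y|.
Proof.
have -> : cos x = sin (x + pi / 2) by rewrite sinDpihalf.
have -> : cos y = sin (y + pi / 2) by rewrite sinDpihalf.
by rewrite (le_trans (sin_lip _ _)) // opprD addrACA subrr addr0.
Qed.

Lemma sin_ge_linear y : 0 <= y -> y <= 1 -> cos 1 * y <= sin y.
Proof.
move=> y0 y1; have [|c] := @MVT_segment R (@sin R) (@cos R) 0 y y0
  (fun z _ => is_derive_sin z).
  by apply: continuous_subspaceT; exact: continuous_sin.
rewrite in_itv sin0 !subr0 => /andP[/= c0 cy] ->; apply: ler_wpM2r => //.
have p1 : 1 <= pi :> R by have := @pi_ge2 R; lra.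
by rewrite leNgt ltr_cos ?in_itv /= -?leNgt; lra.
Qed.

Lemma cexp_lip x y : cmod (cexp (Complex 0 x) - cexp (Complex 0 y)) <= 2 * `|x - y|.
Proof.
rewrite (le_trans (cmod_leReIm _)) // cReB cImB /cexp /= expR0 !mul1r.
by have := sin_lip x y; have := cos_lip x y; lra.
Qed.

End RealTrigonometry.

(** * Cauchy estimates for polynomial coefficients *)

Section RootsOfUnity.
Context {R : realType}.
Implicit Types (z w : R[i]).

Lemma cexpMn z n : cexp z ^+ n = cexp (z *+ n).
Proof.
by elim: n => [|n IH]; rewrite ?cexp0 // exprS mulrS cexpD IH.
Qed.

Lemma cexp_i_neq1 (t : R) : 0 < t -> t < 2 * pi -> cexp (Complex 0 t) != 1.
Proof.
move=> t0 t2; rewrite eq_complex /= expR0 !mul1r; apply/negP => /andP[/eqP ct /eqP st].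
have [tp|tp] := ltP t pi.
  by have := sin_gt0_pi (x := t); rewrite t0 tp st ltxx => /(_ isT).
move: tp; rewrite le_eqVlt => /predU1P[tp|tp].
  by move: ct; rewrite -tp cospi; lra.
have := sin_gt0_pi (x := t - pi); rewrite subr_gt0 tp /=.
rewrite ltrBlDr -mulr2n -mulr_natl t2 => /(_ isT).
have -> : sin (t - pi) = - sin t.
  by rewrite sinB cospi sinpi mulr0 mulrN1 subr0.
by rewrite st oppr0 ltxx.
Qed.

Lemma unity_root_exists n : (0 < n)%N -> exists w : R[i],
  [/\ cmod w = 1, w ^+ n = 1 & forall k, (0 < k < n)%N -> w ^+ k != 1].
Proof.
move=> n0; have n0' : 0 < n%:R :> R by rewrite ltr0n.
have imM (t : R) k : Complex 0 t *+ k = Complex 0 (t *+ k).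
  by elim: k => [|k IH] //; rewrite !mulrS IH; apply/eqP; rewrite eq_complex /= addr0 !eqxx.
exists (cexp (Complex 0 (2 * pi / n%:R))); split.
- by rewrite cmod_cexp /= expR0.
- rewrite cexpMn imM -[_ *+ n]mulr_natr divfK ?gt_eqF //.
  by rewrite cexp_2pi -[RHS]cexp0.
move=> k /andP[k0 kn]; rewrite cexpMn imM; apply: cexp_i_neq1.
  by rewrite pmulrn_lgt0 // divr_gt0 // mulr_gt0 // pi_gt0.
rewrite -[_ *+ k]mulr_natr mulrAC ltr_pdivrMr // ltr_pM2l ?ltr_nat //.
by rewrite mulr_gt0 // pi_gt0.
Qed.

(** Averaging p(r w^j) w^(-jk) over an n-th root of unity w isolates the
    coefficient of index k, which is the Cauchy estimate without integrals. *)
Lemma coef_bound (p : {poly R[i]}) (r S : R) k : 0 < r ->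
  (forall z, cmod z = r -> cmod p.[z] <= S) -> cmod p`_k * r ^+ k <= S.
Proof.
move=> r0 pS.
have S0 : 0 <= S.
  by apply: le_trans (pS (real_complex R r) _); rewrite ?cmod_ge0 // cmod_real ger0_norm // ltW.
have [kn|nk] := ltnP k (size p); last by rewrite nth_default // cmod0 mul0r.
set n := size p in kn; have n0 : (0 < n)%N by exact: leq_ltn_trans kn.
have [w [w1 wn wk]] := unity_root_exists n0.
have wU : w != 0 by rewrite -cmod_gt0 w1.
pose rc := real_complex R r.
have cv (j : nat) : cmod (w ^- j) = 1 by rewrite cmodV cmodX w1 expr1n invr1.
have sumE : \sum_(j < n) p.[rc * w ^+ j] * w ^- (j * k) = n%:R * (p`_k * rc ^+ k).
  transitivity (\sum_(j < n) \sum_(m < n) p`_m * rc ^+ m * (w ^+ m / w ^+ k) ^+ j).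
    apply: eq_bigr => j _; rewrite horner_coef mulr_suml; apply: eq_bigr => m _.
    rewrite exprMn -!mulrA; congr (_ * (_ * _)).
    by rewrite exprMn exprVn -!exprM mulnC [(k * j)%N]mulnC.
  rewrite exchange_big /= (bigD1 (Ordinal kn)) //= [X in _ + X]big1 => [|m mk].
    rewrite addr0 divff ?expf_neq0 //.
    under eq_bigr do rewrite expr1n mulr1.
    by rewrite sumr_const card_ord mulr_natl.
  rewrite -mulr_sumr; set x := _ / _.
  have xn : x ^+ n = 1 by rewrite exprMn exprVn -!exprM ![(_ * n)%N]mulnC !exprM wn !expr1n divr1.
  have x1 : x != 1.
    apply/negP => /eqP xE; have wE : w ^+ m = w ^+ k.
      by rewrite -[LHS](divfK (expf_neq0 k wU)) -/x xE mul1r.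
    have mk' : (m != k :> nat) by apply: contra mk => /eqP E; apply/eqP/val_inj.
    have [lt|lt|E] := ltngtP (m : nat) k; last by rewrite E eqxx in mk'.
      have := wk (k - m)%N; rewrite subn_gt0 lt (leq_ltn_trans (leq_subr _ _) kn).
      by rewrite expfB // -wE divff ?expf_neq0 // eqxx => /(_ isT).
    have := wk (m - k)%N; rewrite subn_gt0 lt (leq_ltn_trans (leq_subr _ _) (ltn_ord m)).
    by rewrite expfB // wE divff ?expf_neq0 // eqxx => /(_ isT).
  have : (x - 1) * (\sum_(i < n) x ^+ i) = 0 by rewrite -subrX1 xn subrr.
  by move=> /eqP; rewrite mulf_eq0 subr_eq0 (negbTE x1) => /eqP ->; rewrite mulr0.
have rc0 : cmod rc = r by rewrite cmod_real ger0_norm // ltW.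
have : cmod (n%:R * (p`_k * rc ^+ k)) <= n%:R * S.
  rewrite -sumE; have -> : n%:R * S = \sum_(j < n) S.
    by rewrite sumr_const card_ord mulr_natl.
  apply: le_trans (cmod_sum _ _ _) _; apply: ler_sum => j _.
  rewrite cmodM cv mulr1; apply: pS.
  by rewrite cmodM cmodX w1 expr1n mulr1.
rewrite !cmodM cmodX rc0 -(rmorph_nat (real_complex R)) cmod_real normr_nat.
by rewrite ler_pM2l // ltr0n.
Qed.

End RootsOfUnity.

(** * The Bernstein-Walsh inequality and the Joukowski map *)

Section Joukowski.
Context {R : realType}.
Implicit Types (z w u : R[i]) (P Q : {poly R[i]}) (A M : R) (N : nat).
Notation "x %:C" := (real_complex R x).

Lemma cmod_nat n : cmod (n%:R : R[i]) = n%:R.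
Proof. by rewrite -(rmorph_nat (real_complex R)) cmod_real normr_nat. Qed.

(** The Joukowski map, scaled so that the unit circle is sent onto [-A, A] and
    circles |w| = rho onto ellipses. *)
Definition jk A w : R[i] := A%:C * (w + w^-1) / 2.

(** The polynomial w^N P(jk A w) in w: it transports P from the segment
    [-A, A] to the unit circle. *)
Definition jkpoly A N P : {poly R[i]} :=
  \sum_(k < N.+1) (P`_k * (A%:C / 2) ^+ k) *: (('X ^+ 2 + 1) ^+ k * 'X^(N - k)).

Lemma jkpolyE A N P w : (size P <= N.+1)%N -> w != 0 ->
  (jkpoly A N P).[w] = w ^+ N * P.[jk A w].
Proof.
move=> sP w0; rewrite (horner_coef_wide _ sP) mulr_sumr horner_sum.
apply: eq_bigr => k _; rewrite !hornerE.
have kN : (k <= N)%N by rewrite -ltnS.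
have -> : w ^+ N = w ^+ (N - k) * w ^+ k by rewrite -exprD subnK.
have -> : w ^+ 2 + 1 = w * (w + w^-1) by field.
have -> : jk A w = A%:C / 2 * (w + w^-1) by rewrite /jk; ring.
by rewrite /= !exprMn; ring.
Qed.

Lemma jkV A w : jk A w^-1 = jk A w.
Proof. by rewrite /jk invrK addrC. Qed.

Lemma jkpoly_sym A N P w : (size P <= N.+1)%N -> w != 0 ->
  (jkpoly A N P).[w] = w ^+ (2 * N) * (jkpoly A N P).[w^-1].
Proof.
move=> sP w0; rewrite !jkpolyE ?invr_neq0 // jkV mulrA; congr (_ * _).
by rewrite mul2n -addnn exprD exprVn mulfK // expf_neq0.
Qed.

Lemma jk_unit A w : cmod w = 1 -> jk A w = (A * complex.Re w)%:C.
Proof.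
move=> w1; have w0 : w != 0 by rewrite -cmod_gt0 w1.
have -> : jk A w = A%:C * ((w + conjc w) / 2).
  rewrite /jk -mulrA; congr (_ * (_ / _)); congr (_ + _).
  apply: (mulfI w0); rewrite divff //.
  have := cmod_sqr w; rewrite w1; case: w {w1 w0} => a b /= E.
  by apply/eqP; rewrite eq_complex /= expr1n in E *; apply/andP; split; apply/eqP;
    [rewrite E|]; ring.
by rewrite -ReJ_add -rmorphM.
Qed.

Definition seg_bounded P A M :=
  forall x : R, - A <= x <= A -> cmod P.[x%:C] <= M.

Lemma jkpoly_disc A N P M w : 0 < A -> (size P <= N.+1)%N -> seg_bounded P A M ->
  cmod w <= 1 -> cmod (jkpoly A N P).[w] <= M.
Proof.
move=> A0 sP PM; apply: (@maximum_modulus_disc _ (fun w => (jkpoly A N P).[w]) 1).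
- exact: cdiff_ccont (cdiff_horner _).
- exact: cdiff_iso (cdiff_horner _).
move=> z z1; have z0 : z != 0 by rewrite -cmod_gt0 z1.
rewrite jkpolyE // jk_unit // cmodM cmodX z1 expr1n mul1r; apply: PM.
have := normRe_le z; rewrite z1 ler_norml => /andP[h1 h2].
by apply/andP; split; nra.
Qed.

(** The preimages of z are t + s and t - s with t = z / A and s^2 = t^2 - 1.
    Their product is 1, so one of them lies in the unit disc.  The bound on
    |1/w| is sinh x >= x for x = ln |1/w|, as 2 sinh x = |1/w| - |w| is at most
    2 |t|. *)
Lemma jk_surj A z : 0 < A -> exists w, [/\ w != 0, cmod w <= 1, jk A w = z &
  (cmod w)^-1 <= expR (cmod z / A)].
Proof.
move=> A0; have Ac0 : A%:C != 0 :> R[i].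
  by rewrite -cmod_gt0 cmod_real normr_gt0 gt_eqF.
pose t := z / A%:C; pose s := sqrtc (t ^+ 2 - 1).
have E : (t + s) * (t - s) = 1.
  have := sqr_sqrtc (t ^+ 2 - 1); rewrite -/s => s2.
  by rewrite mulrC -subr_sqr s2; ring.
have [w [w0 w1 wE]] : exists w, [/\ w != 0, cmod w <= 1 & w + w^-1 = 2 * t].
  have c1 : cmod (t + s) * cmod (t - s) = 1 by rewrite -cmodM E cmod1.
  have n1 : t + s != 0 by apply: contraTneq isT => H; move: E; rewrite H mul0r => /esym/eqP; rewrite oner_eq0.
  have n2 : t - s != 0 by apply: contraTneq isT => H; move: E; rewrite H mulr0 => /esym/eqP; rewrite oner_eq0.
  have [l|g] := leP (cmod (t + s)) 1.
    exists (t + s); split => //.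
    have -> : (t + s)^-1 = t - s by apply: (mulfI n1); rewrite divff // E.
    by ring.
  exists (t - s); split => //; last first.
    have -> : (t - s)^-1 = t + s by apply: (mulIf n2); rewrite mulVf // E.
    by ring.
  have := cmod_ge0 (t - s); nra.
exists w; split => //; first by rewrite /jk wE /t; field.
have cw0 : 0 < cmod w by rewrite cmod_gt0.
have zA : cmod t = cmod z / A by rewrite /t cmodM cmodV cmod_real ger0_norm // ltW.
rewrite -zA; pose x := ln (cmod w)^-1.
have ex : expR x = (cmod w)^-1 by rewrite lnK // posrE invr_gt0.
rewrite -ex ler_expR.
have x0 : 0 <= x by rewrite ln_ge0 // invf_ge1.
have := sinh_ge x0; rewrite expRN ex invrK => H.
have : (cmod w)^-1 <= 2 * cmod t + cmod w.
  have -> : 2 * cmod t = cmod (w + w^-1).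
    by rewrite wE cmodM cmod_nat.
  rewrite -cmodV; have := cmodB (w + w^-1) w.
  by rewrite [w + _ - _]addrC addKr.
lra.
Qed.

(** The polynomial [jkpoly] is bounded by M on the unit disc by the maximum
    principle; dividing by w^N and using the bound on |1/w| in [jk_surj] gives
    the growth of P in the whole plane. *)
Theorem bernstein_walsh A N P M z : 0 < A -> (size P <= N.+1)%N ->
  seg_bounded P A M -> cmod P.[z] <= M * expR (N%:R * (cmod z / A)).
Proof.
move=> A0 sP PM; have [w [w0 w1 <- we]] := jk_surj z A0.
have cw0 : 0 < cmod w by rewrite cmod_gt0.
have H := jkpoly_disc A0 sP PM w1; rewrite jkpolyE // cmodM cmodX in H.
have M0 : 0 <= M by apply: le_trans H; rewrite mulr_ge0 ?exprn_ge0 ?cmod_ge0.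
rewrite mulrC -ler_pdivlMr ?exprn_gt0 // in H.
rewrite (le_trans H) // ler_wpM2l // expRM_natl -exprVn.
apply: lerXn2r => //; rewrite ?nnegrE ?expR_ge0 // invr_ge0; exact: ltW.
Qed.

(** A Bernstein inequality for [jkpoly] at points of the unit circle: the
    reflection w |-> 1/w extends the bound M to a neighbourhood of width 1/(2N)
    at the cost of the factor e, and the maximum principle bounds the
    difference quotient there. *)
Lemma jkpoly_osc A N P M w0 u : 0 < A -> (0 < N)%N -> (size P <= N.+1)%N ->
  seg_bounded P A M -> cmod w0 = 1 -> cmod u <= (2 * N%:R)^-1 ->
  cmod ((jkpoly A N P).[w0 + u] - (jkpoly A N P).[w0]) <=
    4 * expR 1 * M * N%:R * cmod u.
Proof.
move=> A0 N0 sP PM w01 ul; set F := jkpoly A N P; set e := expR 1.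
have NR : 0 < 2 * N%:R :> R by rewrite mulr_gt0 // ltr0n.
have M0 : 0 <= M.
  by apply: le_trans (jkpoly_disc A0 sP PM (_ : cmod w0 <= 1)); rewrite ?cmod_ge0 ?w01.
have e1 : 1 <= e by have := expR_ge1Dx (1 : R); rewrite -/e; lra.
have FB v : cmod v <= (2 * N%:R)^-1 -> cmod F.[w0 + v] <= M * e.
  move=> vl; have [w1|w1] := leP (cmod (w0 + v)) 1.
    by rewrite (le_trans (jkpoly_disc A0 sP PM w1)) // ler_peMr.
  have w0v : w0 + v != 0 by rewrite -cmod_gt0; lra.
  rewrite /F jkpoly_sym // cmodM mulrC.
  apply: ler_pM; rewrite ?cmod_ge0 //.
    by apply: jkpoly_disc => //; rewrite cmodV invf_le1 //; lra.
  rewrite cmodX.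
  have : cmod (w0 + v) <= expR (2 * N%:R)^-1.
    by rewrite (le_trans (cmodD _ _)) // w01 (le_trans _ (expR_ge1Dx _)) // lerD2l.
  move=> /(lerXn2r (2 * N)) H; apply: le_trans (H _ _) _; rewrite ?nnegrE ?cmod_ge0 ?expR_ge0 //.
  by rewrite -expRM_natl natrM divff // gt_eqF.
pose f v := F.[w0 + v].
have df v : cdiff f v.
  apply: (@cdiff_comp _ (fun v => w0 + v) (fun w => F.[w])); last exact: cdiff_horner.
  by apply: cdiffD; [exact: cdiff_cst|exact: cdiff_id].
have [q dq fq] := entire_quotient df.
have -> : F.[w0 + u] - F.[w0] = u * q u.
  by have := fq u; rewrite /f addr0 => ->; rewrite addrC addKr.
rewrite cmodM mulrC ler_wpM2r ?cmod_ge0 //.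
apply: (@maximum_modulus_disc _ q (2 * N%:R)^-1) => //.
- exact: cdiff_ccont.
- exact: cdiff_iso.
move=> v vN; have v0 : 0 < cmod v by rewrite vN invr_gt0.
rewrite -(ler_pM2l v0) -cmodM.
have -> : v * q v = F.[w0 + v] - F.[w0].
  by have := fq v; rewrite /f addr0 => ->; rewrite addrC addKr.
have h1 := FB v (ltac:(by rewrite vN)).
have := FB 0; rewrite cmod0 addr0 invr_ge0 => /(_ (ltW NR)) h2.
rewrite (le_trans (cmodB _ _)) // vN.
have -> : (2 * N%:R)^-1 * (4 * e * M * N%:R) = 2 * (M * e).
  by field; rewrite gt_eqF // ltr0n.
lra.
Qed.

Lemma sin_le_mid (a b x : R) : 0 <= a -> a <= x -> x <= b -> b <= pi ->
  sin x <= 2 * sin ((a + b) / 2).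
Proof.
move=> a0 ax xb bp.
have s0 : 0 <= sin (a + b - x) by apply: sin_ge0_pi; lra.
have m0 : 0 <= sin ((a + b) / 2) by apply: sin_ge0_pi; lra.
pose m := (a + b) / 2; pose d := x - m.
have Ex : x = m + d by rewrite /d; ring.
have Ey : a + b - x = m - d by rewrite /d /m; field.
have c1 := cos_le1 d; rewrite Ey sinB in s0; rewrite -/m in m0 *.
rewrite Ex sinD; nra.
Qed.

Lemma jk_cexp A (t : R) : jk A (cexp (Complex 0 t)) = (A * cos t)%:C.
Proof. by rewrite jk_unit ?cmod_cexp /= expR0 ?mul1r. Qed.

(** In the angle t with x = A cos t, P varies by at most M/2 over an interval
    of length d of order 1/N containing the maximum point.  The corresponding
    interval in x has length of order A S / N, where S is the size of sin t on
    it; the factor S, small near the end points, is recorded because the weight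
    1 - (x/A)^2 = sin^2 t will compensate for it. *)
Theorem nikolskii_interval A N P M (x0 : R) :
  0 < A -> (0 < N)%N -> (size P <= N.+1)%N -> seg_bounded P A M ->
  - A <= x0 <= A -> cmod P.[x0%:C] = M ->
  exists u v S : R, [/\ - A <= u, v <= A, 0 < S <= 1,
    cos 1 / (32 * expR 1) * A * S / N%:R <= v - u &
    forall x, u <= x <= v -> M / 2 <= cmod P.[x%:C] /\ 1 - (x / A) ^+ 2 <= S ^+ 2].
Proof.
move=> A0 N0 sP PM xA xM; set e := expR 1.
have e1 : 1 <= e by have := expR_ge1Dx (1 : R); rewrite -/e; lra.
have N1 : 1 <= N%:R :> R by rewrite ler1n.
have M0 : 0 <= M by rewrite -xM cmod_ge0.
have p2 := @pi_ge2 R.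
have inI (y : R) : - A <= y <= A -> -1 <= y / A <= 1.
  by move=> /andP[h1 h2]; rewrite ler_pdivlMr // ler_pdivrMr // mulN1r mul1r h1.
(* With this d, the bound of jkpoly_osc at distance 2 d is M / 2. *)
pose d : R := (16 * e * N%:R)^-1.
have eN : 1 <= e * N%:R by rewrite mulr_ege1.
have eN0 : 0 < 16 * e * N%:R by rewrite -mulrA mulr_gt0 //; lra.
have d0 : 0 < d by rewrite invr_gt0.
have d1 : d <= 1 / 16.
  by rewrite /d div1r lef_pV2 ?posrE // -mulrA; lra.
pose t0 := acos (x0 / A).
have ct0 : A * cos t0 = x0.
  by rewrite /t0 acosK ?in_itv /= ?inI // mulrC divfK // gt_eqF.
have t00 : 0 <= t0 by apply: acos_ge0; exact: inI.
have t0p : t0 <= pi by apply: acos_lepi; exact: inI.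
have [a [b [a0 bp bE [at0 t0b]]]] : exists a b, [/\ 0 <= a, b <= pi, b = a + d &
    a <= t0 /\ t0 <= b].
  have [h|h] := leP d t0; first by exists (t0 - d), t0; split; try split; lra.
  by exists t0, (t0 + d); split; try split; lra.
set m := (a + b) / 2.
have m0 : 0 < sin m by apply: sin_gt0_pi; rewrite /m bE; lra.
pose S := Num.min 1 (2 * sin m).
have S0 : 0 < S by rewrite lt_min ltr01 /=; lra.
have S1 : S <= 1 by rewrite ge_min lexx.
have S2 : S <= 2 * sin m by rewrite ge_min lexx orbT.
exists (A * cos b), (A * cos a), S; split.
- by have := cos_geN1 b; nra.
- by have := cos_le1 a; nra.
- by rewrite S0.
- have -> : A * cos a - A * cos b = A * (2 * sin m * sin (d / 2)).
    have -> : a = m - d / 2 by rewrite /m bE; field.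
    have -> : b = m + d / 2 by rewrite /m bE; field.
    by rewrite cosB cosD; ring.
  have sd : cos 1 * (d / 2) <= sin (d / 2) by apply: sin_ge_linear; lra.
  have c1 := @cos1_gt0 R.
  have -> : cos 1 / (32 * e) * A * S / N%:R = A * (S * (cos 1 * (d / 2))).
    by rewrite /d; field; rewrite !gt_eqF //; lra.
  rewrite ler_pM2l //; apply: ler_pM => //; first exact: ltW.
  by rewrite mulr_ge0 // ?ltW // divr_gt0.
move=> x /andP[hx1 hx2].
have xA' : - A <= x <= A.
  by have := cos_geN1 b; have := cos_le1 a; move=> ? ?; apply/andP; split; nra.
pose t := acos (x / A).
have ct : A * cos t = x.
  by rewrite /t acosK ?in_itv /= ?inI // mulrC divfK // gt_eqF.
have tt0 : 0 <= t by apply: acos_ge0; exact: inI.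
have ttp : t <= pi by apply: acos_lepi; exact: inI.
have at_ : a <= t.
  rewrite leNgt -ltr_cos ?in_itv /= ?tt0 ?a0 //; last by lra.
  by rewrite -leNgt -(ler_pM2l A0) ct.
have tb : t <= b.
  rewrite leNgt -ltr_cos ?in_itv /= ?tt0 ?bp ?ttp //; last by rewrite andbT; lra.
  by rewrite -leNgt -(ler_pM2l A0) ct.
split; last first.
  have -> : 1 - (x / A) ^+ 2 = sin t ^+ 2.
    by rewrite sin2cos2 -ct mulrC mulKf // gt_eqF.
  have s0 : 0 <= sin t by apply: sin_ge0_pi; rewrite tt0.
  apply: lerXn2r; rewrite ?nnegrE ?(ltW S0) //.
  by rewrite le_min sin_le1 /= sin_le_mid.
pose w0 := cexp (Complex 0 t0) : R[i]; pose w := cexp (Complex 0 t) : R[i].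
have cw0 : cmod w0 = 1 by rewrite cmod_cexp expR0.
have cw : cmod w = 1 by rewrite cmod_cexp expR0.
have uw : cmod (w - w0) <= 2 * d.
  rewrite (le_trans (cexp_lip _ _)) // ler_pM2l // ler_norml; lra.
have uN : cmod (w - w0) <= (2 * N%:R)^-1.
  rewrite (le_trans uw) // /d.
  have -> : 2 * (16 * e * N%:R)^-1 = (2 * N%:R)^-1 * (4 * e)^-1.
    by field; rewrite !gt_eqF //; lra.
  rewrite ler_piMr ?invr_ge0 ?mulr_ge0 ?ler0n // invf_le1; lra.
have := jkpoly_osc A0 N0 sP PM cw0 uN; rewrite [w0 + _]addrC subrK.
rewrite !jkpolyE -?cmod_gt0 ?cw ?cw0 // !jk_cexp ct ct0 => H.
have B : 4 * expR 1 * M * N%:R * cmod (w - w0) <= M / 2.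
  have -> : M / 2 = 4 * expR 1 * M * N%:R * (2 * d).
    by rewrite -/e /d; field; rewrite !gt_eqF //; lra.
  by rewrite ler_wpM2l // !mulr_ge0 ?ler0n // expR_ge0.
have := ler_dist_cmod (w ^+ N * P.[x%:C]) (w0 ^+ N * P.[x0%:C]).
rewrite !cmodM !cmodX cw cw0 expr1n !mul1r xM => H2.
have := le_trans H2 (le_trans H B); rewrite ler_norml; lra.
Qed.

End Joukowski.

(** * Truncation of Chebyshev expansions *)

Section ChebyshevTruncation.
Context {R : realType}.
Implicit Types (z w u : R[i]) (P Q : {poly R[i]}) (A M : R) (N : nat).
Notation "x %:C" := (real_complex R x).

Lemma bernstein_walsh_shift A N P M (x0 : R) z : 0 < A -> (size P <= N.+1)%N ->
  (forall x, x0 - A <= x <= x0 + A -> cmod P.[x%:C] <= M) ->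
  cmod P.[x0%:C + z] <= M * expR (N%:R * (cmod z / A)).
Proof.
move=> A0 sP PM; have := @bernstein_walsh _ A N (P \Po ('X + (x0%:C)%:P)) M z A0.
rewrite horner_comp !hornerE [z + _]addrC; apply.
  by rewrite size_comp_poly2 // size_XaddC.
move=> x xA; rewrite horner_comp !hornerE -rmorphD; apply: PM.
lra.
Qed.

Fixpoint cheb_pair k : {poly R[i]} * {poly R[i]} :=
  if k is k'.+1 then
    ((cheb_pair k').2, 2 *: ('X * (cheb_pair k').2) - (cheb_pair k').1)
  else (1, 'X).

Definition cheb k := (cheb_pair k).1.

Lemma chebSS k : cheb k.+2 = 2 *: ('X * cheb k.+1) - cheb k.
Proof. by []. Qed.

Lemma nat_ind2 (T : nat -> Prop) : T 0%N -> T 1%N ->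
  (forall k, T k -> T k.+1 -> T k.+2) -> forall k, T k.
Proof.
move=> T0 T1 TS k; suff [] : T k /\ T k.+1 by [].
by elim: k => [//|k [h1 h2]]; split => //; exact: TS.
Qed.

(** This identity is what makes Chebyshev polynomials natural in the
    coordinate w. *)
Lemma cheb_jk k w : w != 0 -> (cheb k).[(w + w^-1) / 2] = (w ^+ k + w ^- k) / 2.
Proof.
move=> w0; elim/nat_ind2: k => [||k IH0 IH1].
- by rewrite -[cheb 0]/1 hornerC !expr0; field.
- by rewrite -[cheb 1]/'X hornerX !expr1.
rewrite chebSS hornerD hornerN hornerZ mulrC hornerM hornerX IH0 IH1 !exprS.
have x0 : w ^+ k != 0 by rewrite expf_neq0.
by move: (w ^+ k) x0 => x x0; field; rewrite ?x0 ?w0.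
Qed.

Lemma size_cheb k : (size (cheb k) <= k.+1)%N.
Proof.
elim/nat_ind2: k => [||k IH0 IH1].
- by rewrite -[cheb 0]/1 size_poly1.
- by rewrite -[cheb 1]/'X size_polyX.
rewrite chebSS (leq_trans (size_polyD _ _)) // geq_max size_polyN.
apply/andP; split; last by apply: leq_trans IH0 _; exact: leqW.
rewrite (leq_trans (size_scale_leq _ _)) // (leq_trans (size_polyMleq _ _)) //.
by rewrite size_polyX.
Qed.

Lemma cheb_lead k : (cheb k)`_k != 0.
Proof.
elim/nat_ind2: k => [||k IH0 IH1].
- by rewrite -[cheb 0]/1 coef1 oner_eq0.
- by rewrite -[cheb 1]/'X coefX oner_eq0.
rewrite chebSS coefB coefZ coefXM /= (nth_default 0 (_ : size (cheb k) <= k.+2)%N).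
  by rewrite subr0 mulf_neq0 // pnatr_eq0.
by rewrite (leq_trans (size_cheb k)).
Qed.

Lemma cheb_expansion N Q : (size Q <= N)%N ->
  exists b : nat -> R[i], Q = \sum_(k < N) b k *: cheb k.
Proof.
elim: N Q => [|N IH] Q sQ.
  by exists (fun=> 0); rewrite big_ord0; apply/eqP; rewrite -size_poly_leq0.
pose c := Q`_N / (cheb N)`_N.
have /IH[b bE] : (size (Q - c *: cheb N)%R <= N)%N.
  apply/leq_sizeP => j; rewrite leq_eqVlt => /predU1P[<-|Nj].
    by rewrite coefB coefZ divfK ?cheb_lead // subrr.
  rewrite coefB coefZ !nth_default ?mulr0 ?subr0 //.
    by rewrite (leq_trans (size_cheb N)).
  by rewrite (leq_trans sQ).
exists (fun k => if (k < N)%N then b k else c).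
rewrite big_ord_recr /= ltnn -[LHS](subrK (c *: cheb N)) bE; congr (_ + _).
by apply: eq_bigr => i _; rewrite ltn_ord.
Qed.

Lemma cheb_bound k (x : R) : -1 <= x <= 1 -> cmod (cheb k).[x%:C] <= 1.
Proof.
move=> x1; pose w := cexp (Complex 0 (acos x)) : R[i].
have w1 : cmod w = 1 by rewrite cmod_cexp expR0.
have w0 : w != 0 by rewrite -cmod_gt0 w1.
have -> : x%:C = (w + w^-1) / 2.
  by have := jk_cexp 1 (acos x); rewrite /jk mul1r acosK ?in_itv //= -/w rmorph1 mul1r => ->.
rewrite cheb_jk // cmodM cmodV cmod_nat ler_pdivrMr // mul1r.
by rewrite (le_trans (cmodD _ _)) // cmodV cmodX w1 expr1n invr1.
Qed.

Lemma geometric_tail (q : R) n m : 0 <= q -> q < 1 ->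
  \sum_(n <= k < m) q ^+ k <= q ^+ n / (1 - q).
Proof.
move=> q0 q1; have q1' : 0 < 1 - q by rewrite subr_gt0.
rewrite ler_pdivlMr //.
have [mn|nm] := leqP m n.
  by rewrite big_geq // mul0r exprn_ge0.
have -> : (\sum_(n <= k < m) q ^+ k) * (1 - q) = q ^+ n - q ^+ m.
  rewrite mulr_suml (eq_bigr (fun k => - (q ^+ k.+1 - q ^+ k))).
    by rewrite sumrN telescope_sumr ?(ltnW nm) // opprB.
  by move=> k _; rewrite exprSr; ring.
by rewrite gerBl exprn_ge0.
Qed.

(** In the coordinate w, multiplying by w^N turns the Chebyshev expansion of Q
    into a polynomial whose coefficients are half those of the expansion.
    [coef_bound] on |w| = rho bounds the k-th one by a multiple of rho^-k, and
    the tail of the expansion is a geometric series on [-A, A], where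
    Chebyshev polynomials are bounded by 1. *)
Theorem chebyshev_truncation A (rho S : R) Q n : 0 < A -> 1 < rho ->
  (forall w, cmod w = rho -> cmod Q.[jk A w] <= S) ->
  exists2 P : {poly R[i]}, (size P <= n.+1)%N &
    forall x, - A <= x <= A ->
      cmod (Q.[x%:C] - P.[x%:C]) <= 2 * S * (rho^-1 ^+ n.+1 / (1 - rho^-1)).
Proof.
move=> A0 rho1 QS; have rho0 : 0 < rho by lra.
have Ac0 : A%:C != 0 :> R[i] by rewrite -cmod_gt0 cmod_real normr_gt0 gt_eqF.
have S0 : 0 <= S.
  apply: le_trans (QS (rho%:C) _); first exact: cmod_ge0.
  by rewrite cmod_real ger0_norm // ltW.
pose N := (size Q + n).+1.
have [b bE] := @cheb_expansion N (Q \Po (A%:C *: 'X)) (ltac:(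
  rewrite (leq_trans (size_comp_poly_leq _ _)) // ltnS;
  rewrite size_scale // size_polyX muln1;
  by rewrite (leq_trans (leq_pred _)) // leq_addr)).
have QE z : Q.[z] = \sum_(k < N) b k * (cheb k).[z / A%:C].
  have -> : Q.[z] = (Q \Po (A%:C *: 'X)).[z / A%:C].
    by rewrite horner_comp hornerZ hornerX mulrC divfK.
  by rewrite bE horner_sum; apply: eq_bigr => k _; rewrite hornerZ.
have bb k : (0 < k < N)%N -> cmod (b k) <= 2 * S * rho^-1 ^+ k.
  move=> /andP[k0 kN].
  (* F w = w^N Q (jk A w): the coefficient of b k / 2 sits at N + k. *)
  pose F : {poly R[i]} := \sum_(j < N) (b j / 2) *: ('X^(N + j) + 'X^(N - j)).
  have Fk : F`_(N + k) = b k / 2.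
    rewrite coef_sum (bigD1 (Ordinal kN)) //= big1 ?addr0 => [|j jk].
      rewrite coefZ coefD !coefXn eqxx [(_ == _ - _)%N]gtn_eqF ?addr0 ?mulr1 //.
      by rewrite (leq_ltn_trans (leq_subr _ _)) // -[X in (X < _)%N]addn0 ltn_add2l.
    rewrite coefZ coefD !coefXn eqn_add2l [(_ == _ - _)%N]gtn_eqF; last first.
      by rewrite (leq_ltn_trans (leq_subr _ _)) // -[X in (X < _)%N]addn0 ltn_add2l.
    have -> : (k == j :> nat) = false.
      by apply/negbTE; apply: contra jk => /eqP E; apply/eqP/val_inj.
    by rewrite addr0 mulr0.
  have := @coef_bound _ F rho (rho ^+ N * S) (N + k) rho0.
  rewrite Fk cmodM cmodV cmod_nat => /(_ _)/wrap[].
    move=> w wr; have w0 : w != 0 by rewrite -cmod_gt0 wr.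
    have -> : F.[w] = w ^+ N * Q.[jk A w].
      rewrite QE horner_sum mulr_sumr; apply: eq_bigr => j _.
      have -> : jk A w / A%:C = (w + w^-1) / 2 by
        rewrite /jk; move: (A%:C) Ac0 => B B0; field; rewrite ?B0 ?w0.
      rewrite cheb_jk // !hornerE /= exprD expfB_cond; last by rewrite (negbTE w0) /= add0n ltnW.
      by field; rewrite expf_neq0.
    by rewrite cmodM cmodX wr ler_pM2l ?exprn_gt0 // QS.
  rewrite exprD mulrCA ler_pM2l ?exprn_gt0 // => H.
  by rewrite exprVn ler_pdivlMr ?exprn_gt0 //; lra.
exists (\sum_(k < n.+1) b k *: (cheb k \Po (A%:C^-1 *: 'X))).
  apply: (leq_trans (size_sum _ _ _)); apply/bigmax_leqP => k _.
  rewrite (leq_trans (size_scale_leq _ _)) // (leq_trans (size_comp_poly_leq _ _)) //.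
  rewrite size_scale ?invr_eq0 // size_polyX muln1 ltnS.
  by rewrite -ltnS (leq_trans _ (ltn_ord k)) // ltnS -subn1 leq_subLR add1n size_cheb.
move=> x xA; rewrite QE horner_sum.
have -> : \sum_(k < n.+1) (b k *: (cheb k \Po (A%:C^-1 *: 'X))).[x%:C] =
    \sum_(0 <= k < n.+1) b k * (cheb k).[x%:C / A%:C].
  rewrite big_mkord; apply: eq_bigr => k _.
  by rewrite hornerZ horner_comp hornerZ hornerX [_^-1 * _]mulrC.
rewrite -(big_mkord xpredT (fun k => b k * (cheb k).[x%:C / A%:C])).
rewrite (big_cat_nat (n := n.+1)) //=; last by rewrite ltnS leq_addl.
rewrite addrC addrK (le_trans (cmod_sum _ _ _)) //.
have xA1 : -1 <= x / A <= 1.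
  by case/andP: xA => h1 h2; rewrite ler_pdivlMr // ler_pdivrMr // mulN1r mul1r h1.
have -> : x%:C / A%:C = (x / A)%:C by rewrite fmorph_div.
apply: (@le_trans _ _ (\sum_(n.+1 <= k < N) 2 * S * rho^-1 ^+ k)).
  rewrite big_nat [leRHS]big_nat; apply: ler_sum => k /andP[nk kN].
  rewrite cmodM -[leRHS]mulr1; apply: ler_pM; rewrite ?cmod_ge0 ?cheb_bound //.
  by apply: bb; rewrite kN andbT (leq_trans _ nk).
rewrite -mulr_sumr ler_wpM2l ?mulr_ge0 // geometric_tail ?invr_ge0 ?ltW //.
by rewrite invf_lt1.
Qed.

End ChebyshevTruncation.

(** * A Phragmen-Lindelof theorem and geometric approximation *)

Section PhragmenLindelof.
Context {R : realType}.
Implicit Types (z w : R[i]) (g : R[i] -> R[i]).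
Notation "x %:C" := (real_complex R x).

Lemma rcont_maxr (u v : R[i] -> R) : rcont u -> rcont v ->
  rcont (fun z => Num.max (u z) (v z)).
Proof.
move=> cu cv z e e0; have [d d0 H] := cu z _ e0; have [d' d'0 H'] := cv z _ e0.
exists (Num.min d d'); first by rewrite lt_min d0.
move=> h; rewrite le_min => /andP[/H h1 /H' h2].
move: h1 h2; rewrite !ler_norml => /andP[h1 h2] /andP[h3 h4].
by have [a1|a1] := leP (u (z + h)) (v (z + h)); have [a2|a2] := leP (u z) (v z);
  apply/andP; split; lra.
Qed.

(** The signs s and t select the quadrant.  Multiply g by a function of modulus
    exp(- lam |y| - 2 d |x| |y|) and apply the maximum principle on the square
    of side L in the quadrant.  On the coordinate sides the two growth
    hypotheses bound the product by C and by M; on the far sides the factor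
    with d wins as soon as 2 d L >= K + lam.  Finally d tends to 0. *)
Lemma quadrant_bound g (s t lam M K C : R) : (s = 1 \/ s = -1) -> (t = 1 \/ t = -1) ->
  (forall z, cdiff g z) -> 0 <= lam -> 0 <= M -> 0 <= K -> 0 <= C ->
  (forall z, cmod (g z) <= C * expR (lam * cmod z)) ->
  (forall (x : R) z, cmod (g (x%:C + z)) <= M * expR (K * cmod z)) ->
  forall z, 0 <= s * complex.Re z -> 0 <= t * complex.Im z ->
    cmod (g z) <= (M + C) * expR (lam * (t * complex.Im z)).
Proof.
move=> s1 t1 dg lam0 M0 K0 C0 gC gM z0 sx ty.
have ss : s * s = 1 by case: s1 => ->; ring.
have tt : t * t = 1 by case: t1 => ->; ring.
have normx (x : R) : 0 <= s * x -> `|x| = s * x.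
  by case: s1 => ->; rewrite ?mul1r ?mulN1r ?oppr_ge0; [exact: ger0_norm|exact: ler0_norm].
have normy (y : R) : 0 <= t * y -> `|y| = t * y.
  by case: t1 => ->; rewrite ?mul1r ?mulN1r ?oppr_ge0; [exact: ger0_norm|exact: ler0_norm].
suff H (d : R) : 0 < d -> cmod (g z0) * expR (- (lam * (t * complex.Im z0)) -
    2 * d * (s * complex.Re z0) * (t * complex.Im z0)) <= M + C.
  set X := s * complex.Re z0 in sx H *; set Y := t * complex.Im z0 in ty H *.
  have MC0 : 0 <= M + C by rewrite addr_ge0.
  rewrite -ler_pdivrMr ?expR_gt0 // -expRN.
  apply/ler_addgt0Pr => e e0.
  pose b := ln (1 + e / (M + C + 1)).
  have b0 : 0 < b by rewrite ln_gt0 // ltrDl divr_gt0 //; lra.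
  have q0 : 0 < 2 * (X * Y + 1) by have := mulr_ge0 sx ty; lra.
  have := H (b / (2 * (X * Y + 1))) (divr_gt0 b0 q0).
  have small : 2 * (b / (2 * (X * Y + 1))) * X * Y <= b.
    have -> : 2 * (b / (2 * (X * Y + 1))) * X * Y = b * (X * Y / (X * Y + 1)).
      by field; rewrite gt_eqF //; lra.
    by rewrite ler_piMr ?(ltW b0) // ler_pdivrMr; [lra|lra].
  rewrite expRB [cmod _ * (_ / _)]mulrA ler_pdivrMr ?expR_gt0 // => /le_trans; apply.
  apply: le_trans (ler_wpM2l MC0 (_ : _ <= expR b)) _; first by rewrite ler_expR.
  rewrite /b lnK ?posrE ?addr_gt0 // ?divr_gt0 //; last by lra.
  rewrite mulrDr mulr1 lerD2l mulrCA ler_piMr ?(ltW e0) // ler_pdivrMr; lra.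
move=> d0.
(* In the quadrant |E z| = exp (- lam |y| - 2 d |x| |y|), because Im (z^2) = 2 x y. *)
pose E z := cexp (Complex 0 (t * lam) * z + Complex 0 (s * t * d) * (z * z)).
pose G z := g z * E z.
have dE z : cdiff E z.
  apply: (@cdiff_comp _ (fun z => Complex 0 (t * lam) * z + Complex 0 (s * t * d) * (z * z)) cexp).
    apply: cdiffD; first exact: cdiffM (cdiff_cst _ _) (cdiff_id _).
    exact: cdiffM (cdiff_cst _ _) (cdiffM (cdiff_id _) (cdiff_id _)).
  exact: cdiff_cexp.
have cE z : cmod (E z) = expR (- (lam * (t * complex.Im z)) -
    2 * d * (s * complex.Re z) * (t * complex.Im z)).
  by rewrite cmod_cexp; congr expR; case: z => x y /=; ring.
have dG z : cdiff G z by exact: cdiffM.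
(* Large enough for the far sides to be harmless and for z0 to lie in the square. *)
pose L := (K + lam) / (2 * d) + s * complex.Re z0 + t * complex.Im z0.
have L1 : 0 <= (K + lam) / (2 * d) by rewrite divr_ge0 ?addr_ge0 // mulr_ge0 // ltW.
have Ld : K + lam <= 2 * d * L.
  have -> : K + lam = 2 * d * ((K + lam) / (2 * d)) by field; rewrite gt_eqF.
  by rewrite ler_pM2l ?mulr_gt0 // /L; lra.
pose phi z := Num.max (Num.max (- (s * complex.Re z)) (s * complex.Re z + - L))
  (Num.max (- (t * complex.Im z)) (t * complex.Im z + - L)).
have cid : ccont (@id R[i]) by exact: cdiff_ccont (@cdiff_id R).
have cre (k : R) : rcont (fun z => k * complex.Re z).
  have := @rcont_Re R (fun z => k%:C * z) (cdiff_ccont (fun z => cdiffM (cdiff_cst k%:C z) (cdiff_id z))).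
  move=> H z e e0; have [d' d'0 H'] := H z e e0; exists d' => // h /H'.
  by rewrite !cReM /= !mul0r !subr0.
have cim (k : R) : rcont (fun z => k * complex.Im z).
  have := @rcont_Im R (fun z => k%:C * z) (cdiff_ccont (fun z => cdiffM (cdiff_cst k%:C z) (cdiff_id z))).
  move=> H z e e0; have [d' d'0 H'] := H z e e0; exists d' => // h /H'.
  by rewrite !cImM /= !mul0r !addr0.
have ext (u v : R[i] -> R) : rcont u -> (forall z, u z = v z) -> rcont v.
  by move=> cu uv z e /(cu z)[d' d'0 H']; exists d' => // h /H'; rewrite !uv.
have cphi : rcont phi.
  apply: rcont_maxr; apply: rcont_maxr.
  - by apply: ext (cre (- s)) _ => z; rewrite mulNr.
  - by apply: rcontD (cre s) (rcont_cst _).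
  - by apply: ext (cim (- t)) _ => z; rewrite mulNr.
  - by apply: rcontD (cim t) (rcont_cst _).
have phiP z : (phi z <= 0) = [&& 0 <= s * complex.Re z, s * complex.Re z <= L,
    0 <= t * complex.Im z & t * complex.Im z <= L].
  by rewrite /phi !ge_max !oppr_le0 !subr_le0 -!andbA.
have Gz0 : cmod (G z0) = cmod (g z0) * expR (- (lam * (t * complex.Im z0)) -
    2 * d * (s * complex.Re z0) * (t * complex.Im z0)) by rewrite /G cmodM cE.
rewrite -Gz0.
apply: (@maximum_modulus _ G phi (2 * L)) => //.
- move=> z; rewrite phiP => /and4P[h1 h2 h3 h4].
  by rewrite (le_trans (cmod_leReIm _)) // normx // normy //; lra.
- exact: cdiff_ccont.
- exact: cdiff_iso.
- move=> z pz; have : phi z <= 0 by rewrite pz.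
  rewrite phiP => /and4P[h1 h2 h3 h4].
  have gs : cmod (g z) <= C * expR (lam * (s * complex.Re z + t * complex.Im z)).
    rewrite (le_trans (gC z)) // ler_wpM2l // ler_expR ler_wpM2l //.
    by rewrite (le_trans (cmod_leReIm _)) // normx // normy.
  have gy : cmod (g z) <= M * expR (K * (t * complex.Im z)).
    have := gM (complex.Re z) (Complex 0 (complex.Im z)).
    have -> : (complex.Re z)%:C + Complex 0 (complex.Im z) = z.
      by case: z {pz h1 h2 h3 h4 gs} => x y; apply/eqP; rewrite eq_complex /= addr0 add0r !eqxx.
    have -> : cmod (Complex 0 (complex.Im z)) = t * complex.Im z.
      by rewrite /ComplexField.Normc.normc /= expr0n add0r sqrtr_sqr normy.
    by [].
  rewrite /G cmodM cE.
  set X := s * complex.Re z in h1 h2 gs *; set Y := t * complex.Im z in h3 h4 gs gy *.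
  have finC : X = 0 \/ Y = L -> cmod (g z) * expR (- (lam * Y) - 2 * d * X * Y) <= C.
    move=> XY; rewrite (le_trans (ler_wpM2r (expR_ge0 _) gs)) //.
    rewrite -[leLHS]mulrA -expRD ler_piMr // expR_le1.
    case: XY => ->; first by lra.
    have -> : lam * (X + L) + (- (lam * L) - 2 * d * X * L) = X * (lam - 2 * d * L) by ring.
    by rewrite mulr_ge0_le0 //; lra.
  have finM : Y = 0 \/ X = L -> cmod (g z) * expR (- (lam * Y) - 2 * d * X * Y) <= M.
    move=> XY; rewrite (le_trans (ler_wpM2r (expR_ge0 _) gy)) //.
    rewrite -[leLHS]mulrA -expRD ler_piMr // expR_le1.
    case: XY => ->; first by lra.
    have -> : K * Y + (- (lam * Y) - 2 * d * L * Y) = Y * (K - lam - 2 * d * L) by ring.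
    by rewrite mulr_ge0_le0 //; lra.
  move: pz; rewrite /phi -/X -/Y => pz.
  have : [\/ X = 0, X = L, Y = 0 | Y = L].
    clearbody L X Y; move: pz; clear => pz; move: pz.
    have [a1|a1] := leP (- X) (X + - L); have [a2|a2] := leP (- Y) (Y + - L);
      have [a3|a3] := leP _ _ => E0;
      [apply: Or44|apply: Or42|apply: Or43|apply: Or42|apply: Or44|apply: Or41|apply: Or43|apply: Or41]; lra.
  case=> XY.
  + by rewrite (le_trans (finC (or_introl XY))) // lerDr.
  + by rewrite (le_trans (finM (or_intror XY))) // lerDl.
  + by rewrite (le_trans (finM (or_introl XY))) // lerDl.
  + by rewrite (le_trans (finC (or_intror XY))) // lerDr.
- by rewrite phiP sx ty /= /L; apply/andP; split; lra.
Qed.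

(** Boundedness in horizontal strips, in the uniform form of the second growth
    hypothesis, upgrades growth in |z| to growth in |Im z|, with the same
    rate lam. *)
Theorem phragmen_lindelof g (lam M K C : R) : (forall z, cdiff g z) -> 0 <= lam ->
  (forall z, cmod (g z) <= C * expR (lam * cmod z)) ->
  (forall (x : R) z, cmod (g (x%:C + z)) <= M * expR (K * cmod z)) ->
  exists C', forall z, cmod (g z) <= C' * expR (lam * `|complex.Im z|).
Proof.
move=> dg lam0 gC gM.
have C0 : 0 <= C.
  by have := gC 0; rewrite cmod0 mulr0 expR0 mulr1; apply: le_trans; exact: cmod_ge0.
have M0 : 0 <= M.
  by have := gM 0 0; rewrite cmod0 mulr0 expR0 mulr1; apply: le_trans; exact: cmod_ge0.
have gM' (x : R) z : cmod (g (x%:C + z)) <= M * expR (`|K| * cmod z).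
  rewrite (le_trans (gM x z)) // ler_wpM2l // ler_expR ler_wpM2r ?cmod_ge0 //.
  exact: ler_norm.
exists (M + C) => z.
pose sg (x : R) : R := if 0 <= x then 1 else -1.
have sg1 x : sg x = 1 \/ sg x = -1 by rewrite /sg; case: ifP; [left|right].
have sgE x : `|x| = sg x * x.
  rewrite /sg; case: leP => [x0|x0]; first by rewrite mul1r ger0_norm.
  by rewrite mulN1r ltr0_norm.
rewrite sgE; apply: (@quadrant_bound g (sg (complex.Re z)) _ lam M `|K| C) => //;
  by rewrite -sgE.
Qed.

Lemma jk_cmod A w (rho : R) : 0 <= A -> 1 <= rho -> cmod w = rho ->
  cmod (jk A w) <= A * rho /\ `|complex.Im (jk A w)| <= A * ((rho - rho^-1) / 2).
Proof.
move=> A0 r1 wr; have r0 : 0 < rho by lra.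
have w0 : w != 0 by rewrite -cmod_gt0 wr.
have rV : rho^-1 <= rho by rewrite (le_trans _ r1) // invf_le1.
split.
  rewrite /jk -mulrA cmodM cmod_real ger0_norm // ler_wpM2l //.
  rewrite cmodM cmodV cmod_nat ler_pdivrMr // (le_trans (cmodD _ _)) // cmodV wr.
  lra.
have wV : w^-1 = (rho ^- 2)%:C * conjc w.
  apply: (mulfI w0); rewrite divff //; have := cmod_sqr w; rewrite wr.
  case: w {wr w0} => a b /= E; rewrite E.
  have n0 : a ^+ 2 + b ^+ 2 != 0 by rewrite -E expf_neq0 // gt_eqF.
  by apply/eqP; rewrite eq_complex /=; apply/andP; split; apply/eqP; field.
have -> : complex.Im (jk A w) = A * ((1 - rho ^- 2) / 2 * complex.Im w).
  rewrite /jk wV; have -> : (2 : R[i])^-1 = (2^-1)%:C by rewrite fmorphV rmorph_nat.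
  by case: w {wr w0 wV} => a b /=; ring.
rewrite normrM (ger0_norm A0) ler_wpM2l // normrM ger0_norm; last first.
  by rewrite divr_ge0 // subr_ge0 invf_le1 ?exprn_gt0 // exprn_ege1.
apply: le_trans (ler_wpM2l _ (normIm_le w)) _.
  by rewrite divr_ge0 // subr_ge0 invf_le1 ?exprn_gt0 // exprn_ege1.
rewrite wr [leRHS](_ : _ = (1 - rho ^- 2) / 2 * rho) //.
by field; rewrite gt_eqF.
Qed.

Lemma polynomial_approx_disc g (r delta : R) : (forall z, cdiff g z) -> 0 < r ->
  (exists M, forall z, cmod z <= 4 * r -> cmod (g z) <= M) -> 0 < delta ->
  exists Q : {poly R[i]}, forall z, cmod z <= r -> cmod (g z - Q.[z]) <= delta.
Proof.
move=> dg r0 [M gM] dl0; have r4 : 0 < 4 * r by rewrite mulr_gt0.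
have M0 : 0 <= M.
  by apply: le_trans (gM 0 _); rewrite ?cmod_ge0 // cmod0 ltW.
have [k Hk] := exists_pow_le M0 dl0.
have [P _ HP] := taylor_polynomial k dg r4 gM.
exists P => z zr; rewrite (le_trans (HP z _)) ?(le_trans zr) //; first by lra.
apply: le_trans Hk; rewrite ler_wpM2l // -exprVn.
apply: lerXn2r; rewrite ?nnegrE ?divr_ge0 ?mulr_ge0 ?cmod_ge0 ?invr_ge0 ?(ltW r0) //.
by rewrite ler_pdivrMr //; lra.
Qed.

(** On the ellipse of parameter rho the imaginary part is at most
    A_n (rho - 1/rho) / 2 <= A_n rho ln rho, so |g| grows there no faster than
    rho^(kap rho n), with kap = lam / sigma.  Choosing rho with kap rho < 1, the
    gain rho^-n of [chebyshev_truncation] prevails.  Since that result is about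
    polynomials, g is first replaced by a very good polynomial approximation Q
    of uncontrolled degree. *)
Theorem exponential_approx g (lam sigma C D : R) (a : nat -> R) :
  (forall z, cdiff g z) -> 0 < lam -> lam < sigma ->
  (forall z, cmod (g z) <= C * expR (lam * `|complex.Im z|)) ->
  (forall n, (0 < n)%N -> 0 < a n) -> (forall n, (0 < n)%N -> a n <= n%:R + D) ->
  exists K q : R, [/\ 0 <= K, 0 < q < 1 & forall n, (0 < n)%N ->
    exists2 P : {poly R[i]}, (size P <= n.+1)%N &
      forall x, - (a n / sigma) <= x <= a n / sigma ->
        cmod (g x%:C - P.[x%:C]) <= K * q ^+ n].
Proof.
move=> dg lam0 ls gC a0 aD; have s0 : 0 < sigma by exact: lt_trans ls.
have C0 : 0 <= C.
  by have := gC 0; rewrite normr0 mulr0 expR0 mulr1; apply: le_trans; exact: cmod_ge0.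
pose kap := lam / sigma.
have k0 : 0 < kap by rewrite divr_gt0.
have k1 : kap < 1 by rewrite ltr_pdivrMr // mul1r.
(* Any rho strictly between 1 and sigma / lam would do. *)
pose rho := (1 + kap^-1) / 2.
have kV : 1 < kap^-1 by rewrite invf_gt1.
have rho1 : 1 < rho by rewrite /rho; lra.
have rho0 : 0 < rho by lra.
have krho : kap * rho < 1.
  have : kap * kap^-1 = 1 by rewrite divff // gt_eqF.
  by rewrite /rho; nra.
pose eta := ln rho; have eta0 : 0 < eta by rewrite ln_gt0.
have eE : expR eta = rho by rewrite lnK.
have sh : (rho - rho^-1) / 2 <= rho * eta.
  have := expR_ge1Dx (- (2 * eta)).
  have -> : - (2 * eta) = - eta + - eta by ring.
  rewrite expRD expRN eE => H.
  have : rho * (1 + (- eta + - eta)) <= rho * (rho^-1 * rho^-1) by rewrite ler_pM2l.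
  rewrite mulrA divff ?gt_eqF // mul1r; lra.
set h := (rho - rho^-1) / 2 in sh.
have h0 : 0 <= h.
  by rewrite divr_ge0 // subr_ge0 (le_trans _ (ltW rho1)) // invf_le1 // ltW.
(* q = exp (kap h) / rho; it is less than 1 because h <= rho ln rho and kap rho < 1. *)
pose q := expR (kap * h - eta).
have q1 : q < 1.
  rewrite expR_lt1 subr_lt0 (le_lt_trans (ler_wpM2l (ltW k0) sh)) // mulrA.
  by rewrite gtr_pMl.
have qr : rho^-1 <= q by rewrite -eE -expRN ler_expR lerDr mulr_ge0 // ltW.
pose K0 := C * expR (kap * `|D| * h) + 1.
have ek (n : nat) : rho^-1 ^+ n * expR (kap * h * n%:R) = q ^+ n.
  by rewrite -eE -expRN -!expRM_natl -expRD /q; congr expR; ring.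
have rV0 : 0 < 1 - rho^-1 by rewrite subr_gt0 invf_lt1.
exists (1 + 2 * K0 / (1 - rho^-1)), q; split.
- have : 0 <= 2 * K0 / (1 - rho^-1).
    by rewrite divr_ge0 ?(ltW rV0) // mulr_ge0 // addr_ge0 // mulr_ge0 // expR_ge0.
  by lra.
- by rewrite expR_gt0.
move=> n n0; pose A := a n / sigma; have A0 : 0 < A by rewrite divr_gt0 // a0.
have r0 : 0 < A * rho by rewrite mulr_gt0.
have qn0 : 0 < q ^+ n by rewrite exprn_gt0 // expR_gt0.
have qn1 : q ^+ n <= 1 by rewrite exprn_ile1 ?expR_ge0 // ltW.
have [|Q HQ] := @polynomial_approx_disc g (A * rho) (q ^+ n) dg r0 _ qn0.
  exists (C * expR (lam * (4 * (A * rho)))) => z zr.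
  rewrite (le_trans (gC z)) // ler_wpM2l // ler_expR ler_wpM2l ?(ltW lam0) //.
  by rewrite (le_trans (normIm_le _)).
pose S := C * expR (lam * (A * h)) + 1.
have QS w : cmod w = rho -> cmod Q.[jk A w] <= S.
  move=> wr; have [j1 j2] := jk_cmod (ltW A0) (ltW rho1) wr.
  have -> : Q.[jk A w] = g (jk A w) - (g (jk A w) - Q.[jk A w]) by ring.
  rewrite (le_trans (cmodB _ _)) // /S lerD //; last by apply: le_trans qn1; exact: HQ.
  by apply: le_trans (gC _) _; rewrite ler_wpM2l // ler_expR ler_wpM2l ?(ltW lam0).
have [P sP HP] := chebyshev_truncation n A0 rho1 QS.
exists P => // x xA.
have xr : cmod x%:C <= A * rho.
  rewrite cmod_real (le_trans _ (_ : A <= _)) ?ler_norml // ler_pMr //; lra.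
have -> : g x%:C - P.[x%:C] = (g x%:C - Q.[x%:C]) + (Q.[x%:C] - P.[x%:C]) by ring.
rewrite (le_trans (cmodD _ _)) // (le_trans (lerD (HQ _ xr) (HP _ xA))) //.
rewrite [leRHS]mulrDl mul1r lerD2l.
have SK : rho^-1 ^+ n * S <= K0 * q ^+ n.
  rewrite /S /K0 mulrDr mulrDl mulr1 mul1r; apply: lerD; last first.
    by apply: lerXn2r; rewrite ?nnegrE ?invr_ge0 ?expR_ge0 ?(ltW rho0).
  rewrite -ek mulrCA -mulrA ler_wpM2l // [leRHS]mulrCA ler_wpM2l ?exprn_ge0 ?invr_ge0 ?(ltW rho0) //.
  rewrite -expRD ler_expR.
  have -> : lam * (A * h) = kap * h * a n by rewrite /A /kap; field; rewrite gt_eqF.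
  have -> : kap * `|D| * h + kap * h * n%:R = kap * h * (n%:R + `|D|) by ring.
  apply: ler_wpM2l; first by rewrite mulr_ge0 // ltW.
  by rewrite (le_trans (aD n n0)) // lerD2l ler_norm.
have S0 : 0 <= S by rewrite addr_ge0 // mulr_ge0 // expR_ge0.
have rVn : 0 <= rho^-1 ^+ n by rewrite exprn_ge0 // invr_ge0 ltW.
have -> : 2 * S * (rho^-1 ^+ n.+1 / (1 - rho^-1)) =
  2 / (1 - rho^-1) * (rho^-1 * (rho^-1 ^+ n * S)) by rewrite exprS; ring.
have -> : 2 * K0 / (1 - rho^-1) * q ^+ n = 2 / (1 - rho^-1) * (K0 * q ^+ n) by ring.
apply: ler_wpM2l; first by rewrite divr_ge0 // ltW.
apply: le_trans SK; rewrite ler_piMl ?mulr_ge0 //.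
by rewrite invf_le1 // ltW.
Qed.

End PhragmenLindelof.

(** * Quasinorms with respect to the completed Lebesgue measure *)

Section LebesgueLayer.
Context {R : realType}.
Notation "x %:C" := (real_complex R x).
Notation mu := (@completed_lebesgue_measure R).
Notation LR := (lebesgueType R).
Implicit Types (f h : R -> R[i]) (p r : R) (Om : set R).

Lemma borel_lebesgue (A : set R) : measurable (A : set R) ->
  measurable (A : set LR).
Proof. by move=> mA; apply: sub_caratheodory. Qed.

Lemma measurable_borel_lebesgue (u : R -> R) :
  measurable_fun [set: R] u ->
  measurable_fun (T := LR) [set: R] u.
Proof.
move=> mu_ _ B mB; rewrite setTI; apply: borel_lebesgue.
by rewrite -[X in measurable X]setTI; exact: mu_.
Qed.

Lemma measurable_segment (a b : R) : measurable (`[a, b]%classic : set LR).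
Proof. by apply: borel_lebesgue; exact: measurable_itv. Qed.

Lemma completed_segment (a b : R) : a <= b -> mu `[a, b]%classic = (b - a)%:E.
Proof.
move=> ab; rewrite -[LHS]/(lebesgue_measure `[a, b]%classic).
rewrite lebesgue_measure_itv /= lte_fin; case: ltP => // ba.
have -> : a = b by lra.
by rewrite subrr.
Qed.

(** Both measures agree on Borel sets, so this is a change of variables along
    the identity from the Lebesgue to the Borel sigma-algebra. *)
Lemma ge0_integral_completed (u : R -> R) :
  measurable_fun [set: R] u -> (forall x, 0 <= u x) ->
  (\int[mu]_x (u x)%:E = \int[@lebesgue_measure R]_x (u x)%:E)%E.
Proof.
move=> mu_ u0.
have mid : measurable_fun [set: LR] (id : LR -> measurableTypeR R).
  by move=> _ B mB; rewrite setTI; exact: borel_lebesgue.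
have P := @ge0_integral_pushforward _ _ LR (measurableTypeR R) R id mid mu setT (EFin \o u) measurableT.
have mEu : measurable_fun [set: measurableTypeR R] (EFin \o u) by exact/measurable_EFinP.
rewrite preimage_setT in P.
transitivity (\int[pushforward mu (id : LR -> measurableTypeR R)]_y ((EFin \o u) y))%E.
  by rewrite P // => x _ /=; rewrite lee_fin.
exact: (@eq_measure_integral _ (measurableTypeR R) R setT).
Qed.

Lemma ge0_integral_scale (u : R -> R) (rho : R) : continuous u ->
  (forall x, 0 <= u x) -> 0 < rho ->
  (\int[mu]_x (u (rho * x))%:E = (rho^-1)%:E * \int[mu]_x (u x)%:E)%E.
Proof.
move=> cu u0 r0.
have cr : continuous (fun x : R => rho * x).
  by move=> x; apply: cvgM; [exact: cvg_cst|exact: cvg_id].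
have cur : continuous (fun x => u (rho * x)).
  by move=> x; apply: (@continuous_comp _ _ _ (fun x => rho * x) u); [exact: cr|exact: cu].
rewrite !ge0_integral_completed //; try exact: continuous_measurable_fun.
pose F x : R := rho * x.
have dF (x : R) : is_derive x 1 F rho.
  by apply: is_derive_eq; rewrite -[_ *: _]/(_ * _) mulr1.
have F1 : F^`()%classic = cst rho.
  by apply/funext => x; rewrite derive1E derive_val.
have := @increasing_ge0_integration_by_substitutionT R F u.
rewrite F1 => ->; last 9 first.
- by move=> x y xy; rewrite /F ltr_pM2l.
- by move=> x; exact: cvg_cst.
- exact: is_cvg_cst.
- exact: is_cvg_cst.
- by move=> x; have [] := dF x.
- by apply: gt0_cvgMrNy => //; exact: cvg_id.
- by apply: gt0_cvgMry => //; exact: cvg_id.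
- by [].
- by [].
under [in RHS]eq_integral => x _ do rewrite /= EFinM muleC.
rewrite ge0_integralZl_EFin ?(ltW r0) //; last 2 first.
- by move=> x _; rewrite lee_fin; exact: u0.
- apply/measurable_EFinP; exact: (@continuous_measurable_fun _ (fun x => u (rho * x)) cur).
by rewrite muleA -EFinM mulVf ?gt_eqF // mul1e.
Qed.

(** The p-th power of the quasinorm, finite or not: it avoids taking roots of
    extended reals. *)
Definition Lpint p Om f : \bar R := (\int[mu]_(x in Om) ((cmod (f x)) `^ p)%:E)%E.

Lemma Lpint_patch p Om f : p != 0 ->
  Lpint p Om f = (\int[mu]_x `| ((fun x => (cmod (f x))%:E) \_ Om) x | `^ p)%E.
Proof.
move=> p0; rewrite /Lpint integral_mkcond; apply: eq_integral => x _.
rewrite !patchE; case: ifP => _ /=.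
  by rewrite ger0_norm ?cmod_ge0 // poweR_EFin.
by rewrite normr0 powR0.
Qed.

Lemma Lpint_ge0 p Om f : (0 <= Lpint p Om f)%E.
Proof. by apply: integral_ge0 => x _; rewrite lee_fin powR_ge0. Qed.

Lemma Lpnorm_le p r Om f : 0 < p -> 0 <= r ->
  (Lpnorm p%:E Om f <= r%:E)%E <-> (Lpint p Om f <= (r `^ p)%:E)%E.
Proof.
move=> p0 r0; have pn0 : p != 0 by rewrite gt_eqF.
rewrite /Lpnorm unlock -Lpint_patch //.
have I0 := Lpint_ge0 p Om f; set I := Lpint _ _ _ in I0 *.
have E1 : ((I `^ p^-1) `^ p = I)%E by rewrite -poweRrM mulVf // poweRe1.
split=> H.
  rewrite -E1 -poweR_EFin; apply: gt0_ler_poweR => //; rewrite ?(ltW p0) //.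
  - by rewrite in_itv /= poweR_ge0 leey.
  - by rewrite in_itv /= lee_fin r0 leey.
have -> : r%:E = (((r `^ p)%:E) `^ p^-1)%E.
  by rewrite poweR_EFin -powRrM divff // powRr1.
apply: gt0_ler_poweR => //; rewrite ?invr_ge0 ?(ltW p0) //.
- by rewrite in_itv /= I0 leey.
- by rewrite in_itv /= lee_fin powR_ge0 leey.
Qed.

Lemma completed_setT_gt0 : (0 < mu [set: R])%E.
Proof.
apply: (@lt_le_trans _ _ (mu `[0, 1]%classic)).
  by rewrite completed_segment // subr0 lte01.
by apply: le_measure => //; rewrite inE; [exact: measurable_segment|exact: measurableT].
Qed.

Lemma completed_ae_filter : Filter (almost_everywhere mu).
Proof. exact: (@ae_filter_ringOfSetsType _ LR). Qed.

Lemma Lpnorm_inf_le r Om f : 0 <= r ->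
  (Lpnorm +oo%E Om f <= r%:E)%E <-> {ae mu, forall x, Om x -> cmod (f x) <= r}.
Proof.
move=> r0; rewrite /Lpnorm unlock completed_setT_gt0.
split=> [/ess_supP H|H].
  apply: (@filterS _ _ completed_ae_filter _ _ _ H) => x /=; rewrite patchE; case: ifPn => [_|/negP h] /=.
    by rewrite ger0_norm ?cmod_ge0 // lee_fin.
  by move=> _ /mem_set.
apply/ess_supP; apply: (@filterS _ _ completed_ae_filter _ _ _ H) => x {}H /=; rewrite patchE; case: ifPn => [|_] /=.
  by rewrite inE => /H; rewrite ger0_norm ?cmod_ge0 // lee_fin.
by rewrite normr0 lee_fin.
Qed.

Lemma cmeasurable_cmod f : cmeasurable f ->
  measurable_fun (T := LR) [set: R] (fun x => cmod (f x)).
Proof.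
move=> [mr mi].
have -> : (fun x => cmod (f x)) = (fun x => (complex.Re (f x) ^+ 2 + complex.Im (f x) ^+ 2) `^ 2^-1).
  apply/funext => x; rewrite powR12_sqrt ?addr_ge0 ?sqr_ge0 //.
  by case: (f x).
have m2 : measurable_fun (T := LR) [set: R]
    ((fun x : LR => complex.Re (f x) ^+ 2) \+ (fun x : LR => complex.Im (f x) ^+ 2)).
  by apply: measurable_funD; apply: measurable_funX.
exact: (measurableT_comp (measurable_powR 2^-1) m2).
Qed.

Lemma ccont_cmeasurable (g : R[i] -> R[i]) : ccont g ->
  cmeasurable (fun x => g x%:C).
Proof.
move=> cg; split.
  apply: (@measurable_borel_lebesgue (fun x : R => complex.Re (g x%:C))).
  by apply: continuous_measurable_fun; exact: ccont_Re.
apply: (@measurable_borel_lebesgue (fun x : R => complex.Im (g x%:C))).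
apply: continuous_measurable_fun.
move=> x; apply/cvgrPdist_le => /= e e0.
have [d d0 H] := cg x%:C e e0.
apply/nbhs_ballP; exists d => //= t; rewrite /ball /= distrC => /ltW td.
rewrite distrC -cImB (le_trans (normIm_le _)) //.
have -> : t%:C = x%:C + (t - x)%:C by rewrite -rmorphD addrC subrK.
by apply: H; rewrite cmod_real.
Qed.

Lemma cmeasurableB f h : cmeasurable f -> cmeasurable h ->
  cmeasurable (fun x => f x - h x).
Proof.
move=> [f1 f2] [h1 h2]; split.
  have -> : (fun x => complex.Re (f x - h x)) = (fun x => complex.Re (f x)) \- (fun x => complex.Re (h x)).
    by apply/funext => x; rewrite cReB.
  exact: measurable_funB.
have -> : (fun x => complex.Im (f x - h x)) = (fun x => complex.Im (f x)) \- (fun x => complex.Im (h x)).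
  by apply/funext => x; rewrite cImB.
exact: measurable_funB.
Qed.

End LebesgueLayer.

(** * Comparison of integrals of nonnegative functions *)

Section IntegralComparison.
Context d (T : measurableType d) (R : realType).
Variable mu : {measure set T -> \bar R}.
Implicit Types (D : set T) (F G H : T -> R).

Lemma integral_le_lincomb D F G H (a b : R) : measurable D ->
  measurable_fun D F -> measurable_fun D G -> measurable_fun D H ->
  0 <= a -> 0 <= b -> (forall x, 0 <= F x) -> (forall x, 0 <= G x) ->
  (forall x, 0 <= H x) -> (forall x, D x -> F x <= a * G x + b * H x) ->
  (\int[mu]_(x in D) (F x)%:E <=
   a%:E * \int[mu]_(x in D) (G x)%:E + b%:E * \int[mu]_(x in D) (H x)%:E)%E.
Proof.
move=> mD /measurable_EFinP mF /measurable_EFinP mG /measurable_EFinP mH a0 b0 F0 G0 H0 FGH.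
have aG0 x : 0 <= a * G x by rewrite mulr_ge0.
have bH0 x : 0 <= b * H x by rewrite mulr_ge0.
have E (c : R) (K : T -> R) : 0 <= c -> (forall x, 0 <= K x) -> measurable_fun D (EFin \o K) ->
    (c%:E * \int[mu]_(x in D) (K x)%:E = \int[mu]_(x in D) (c * K x)%:E)%E.
  by move=> c0 K0 mK; under [RHS]eq_integral do rewrite EFinM;
    rewrite ge0_integralZl_EFin // => x _; rewrite lee_fin.
rewrite (E a G) // (E b H) //.
have mcK (c : R) (K : T -> R) : measurable_fun D (EFin \o K) ->
    measurable_fun D (fun x => (c * K x)%:E).
  by move=> mK; under eq_fun do rewrite EFinM; exact: measurable_funeM.
rewrite -ge0_integralD //; first last.
- exact: mcK.
- by move=> x _; rewrite lee_fin.
- exact: mcK.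
- by move=> x _; rewrite lee_fin.
apply: ge0_le_integral => //.
- by move=> x _; rewrite lee_fin.
- by apply: emeasurable_funD; exact: mcK.
Qed.

Lemma integral_subset D D' F : measurable D -> measurable D' ->
  measurable_fun D' F -> (forall x, 0 <= F x) -> D `<=` D' ->
  (\int[mu]_(x in D) (F x)%:E <= \int[mu]_(x in D') (F x)%:E)%E.
Proof.
move=> mD mD' mF F0 DD'; apply: ge0_subset_integral => //; first exact/measurable_EFinP.
by move=> x _; rewrite lee_fin.
Qed.

Lemma integral_le_cst D F (c : R) : measurable D -> measurable_fun D F ->
  (forall x, 0 <= F x) -> 0 <= c -> (forall x, D x -> F x <= c) ->
  (\int[mu]_(x in D) (F x)%:E <= c%:E * mu D)%E.
Proof.
move=> mD mF F0 c0 Fc; rewrite -integral_cst //; apply: ge0_le_integral => //.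
- by move=> x _; rewrite lee_fin.
- exact/measurable_EFinP.
Qed.

Lemma integral_ge_cst D F (c : R) : measurable D -> measurable_fun D F ->
  (forall x, 0 <= F x) -> 0 <= c -> (forall x, D x -> c <= F x) ->
  (c%:E * mu D <= \int[mu]_(x in D) (F x)%:E)%E.
Proof.
move=> mD mF F0 c0 Fc; rewrite -integral_cst //; apply: ge0_le_integral => //.
exact/measurable_EFinP.
Qed.

End IntegralComparison.

(** * Quasi-triangle inequalities and the Nikolskii inequality *)

Section LpTools.
Context {R : realType}.
Notation "x %:C" := (real_complex R x).
Notation mu := (@completed_lebesgue_measure R).
Notation LR := (lebesgueType R).
Implicit Types (f u v w : R -> R[i]) (p r eta : R) (Om : set R).

(** Either y <= eta x, and the first term dominates, or x < y / eta, and the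
    second one does.  Unlike the triangle inequality this holds for every
    p > 0, and for small eta the constant in front of the first term is close
    to 1, which is what limits require. *)
Lemma powR_quasi_triangle p eta (x y : R) : 0 < p -> 0 < eta -> 0 <= x -> 0 <= y ->
  (x + y) `^ p <= (1 + eta) `^ p * x `^ p + (1 + eta^-1) `^ p * y `^ p.
Proof.
move=> p0 e0 x0 y0.
have e1 : 0 <= 1 + eta by rewrite addr_ge0 // ltW.
have e2 : 0 <= 1 + eta^-1 by rewrite addr_ge0 // invr_ge0 ltW.
rewrite -!powRM //; have [h|h] := leP y (eta * x).
  apply: (@le_trans _ _ (((1 + eta) * x) `^ p)); last by rewrite lerDl powR_ge0.
  by apply: ge0_ler_powR; rewrite ?nnegrE ?(ltW p0) ?addr_ge0 ?mulr_ge0 //; lra.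
apply: (@le_trans _ _ (((1 + eta^-1) * y) `^ p)); last by rewrite lerDr powR_ge0.
apply: ge0_ler_powR; rewrite ?nnegrE ?(ltW p0) ?addr_ge0 ?mulr_ge0 //.
rewrite mulrDl mul1r addrC lerD2l ler_pdivlMl //; exact: ltW.
Qed.

Lemma measurable_Lpint f p Om : cmeasurable f ->
  measurable_fun (T := LR) Om (fun x => (cmod (f x)) `^ p).
Proof.
move=> /cmeasurable_cmod mf.
exact: (measurable_funTS (measurableT_comp (measurable_powR p) mf)).
Qed.

Lemma Lpint_triangle p eta Om w u v : 0 < p -> 0 < eta ->
  measurable (Om : set LR) -> cmeasurable w -> cmeasurable u -> cmeasurable v ->
  (forall x, Om x -> cmod (w x) <= cmod (u x) + cmod (v x)) ->
  (Lpint p Om w <= ((1 + eta) `^ p)%:E * Lpint p Om u +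
                   ((1 + eta^-1) `^ p)%:E * Lpint p Om v)%E.
Proof.
move=> p0 e0 mO mw mu_ mv wuv.
have P0 (h : R -> R[i]) x : 0 <= cmod (h x) `^ p by exact: powR_ge0.
apply: (integral_le_lincomb mu mO (measurable_Lpint p mw) (measurable_Lpint p mu_)
  (measurable_Lpint p mv) (powR_ge0 _ _) (powR_ge0 _ _) (P0 w) (P0 u) (P0 v)).
move=> x /wuv wx.
apply: le_trans (powR_quasi_triangle p0 e0 (cmod_ge0 _) (cmod_ge0 _)).
by apply: ge0_ler_powR; rewrite ?nnegrE ?(ltW p0) ?addr_ge0 ?cmod_ge0.
Qed.

Lemma Lpint_subset p (Om Om' : set R) f : measurable (Om : set LR) ->
  measurable (Om' : set LR) -> cmeasurable f -> Om `<=` Om' ->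
  (Lpint p Om f <= Lpint p Om' f)%E.
Proof.
move=> mO mO' mf sub.
exact: (integral_subset mu mO mO' (measurable_Lpint p mf) (fun x => powR_ge0 _ _) sub).
Qed.

Lemma Lpint_le_bound p (B a b : R) f : 0 <= p -> a <= b -> cmeasurable f ->
  (forall x, a <= x <= b -> cmod (f x) <= B) ->
  (Lpint p `[a, b] f <= (B `^ p * (b - a))%:E)%E.
Proof.
move=> p0 ab mf fB.
have B0 : 0 <= B.
  by apply: le_trans (cmod_ge0 (f a)) (fB a _); rewrite lexx.
rewrite EFinM -(completed_segment ab).
apply: (integral_le_cst mu (measurable_segment a b) (measurable_Lpint p mf)
  (fun x => powR_ge0 _ _) (powR_ge0 _ _)).
move=> x /=; rewrite in_itv /= => /fB fx.
by apply: ge0_ler_powR; rewrite ?nnegrE ?cmod_ge0.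
Qed.

Lemma Lpint_ge_bound p (c a b : R) Om f : measurable (Om : set LR) -> cmeasurable f ->
  0 <= c -> a <= b -> `[a, b] `<=` Om ->
  (forall x, a <= x <= b -> c <= cmod (f x) `^ p) ->
  ((c * (b - a))%:E <= Lpint p Om f)%E.
Proof.
move=> mO mf c0 ab sub cf.
apply: le_trans (Lpint_subset p (measurable_segment a b) mO mf sub).
rewrite EFinM -(completed_segment ab).
apply: (integral_ge_cst mu (measurable_segment a b) (measurable_Lpint p mf)
  (fun x => powR_ge0 _ _) c0).
by move=> x /=; rewrite in_itv /=; exact: cf.
Qed.

Lemma Lpnorm_fin (p : \bar R) Om (f : R -> R[i]) : (Lpnorm p Om f < +oo)%E ->
  exists2 r : R, 0 <= r & (Lpnorm p Om f <= r%:E)%E.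
Proof.
move=> Hf; have N0 : (0 <= Lpnorm p Om f)%E by exact: Lnorm_ge0.
exists (fine (Lpnorm p Om f)); first exact: fine_ge0.
by rewrite fineK // ge0_fin_numE.
Qed.

Lemma measurable_line : measurable ([set: R] : set LR).
Proof. exact: measurableT. Qed.

Lemma Lpnorm_subset_le (p : \bar R) (r : R) Om f : (0 < p)%E -> 0 <= r ->
  measurable (Om : set LR) -> cmeasurable f ->
  (Lpnorm p [set: R] f <= r%:E)%E -> (Lpnorm p Om f <= r%:E)%E.
Proof.
case: p => [p||//] p0 r0 mO mf.
  rewrite lte_fin in p0; move=> /(Lpnorm_le _ _ p0 r0) H; apply/(Lpnorm_le _ _ p0 r0).
  apply: le_trans H; exact: Lpint_subset mO measurable_line mf (@subsetT _ _).
move=> /(Lpnorm_inf_le _ _ r0) H; apply/(Lpnorm_inf_le _ _ r0).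
by apply: (@filterS _ _ (@completed_ae_filter R) _ _ _ H) => x Hx _; exact: Hx.
Qed.

(** A crude form of the triangle inequality valid for all p: norms of sums are
    bounded in terms of bounds on the norms of the summands, uniformly in Om. *)
Lemma Lpnorm_quasi_triangle (p : \bar R) (r s : R) : (0 < p)%E -> 0 <= r -> 0 <= s ->
  exists2 K : R, 0 <= K & forall Om w u v, measurable (Om : set LR) ->
    cmeasurable w -> cmeasurable u -> cmeasurable v ->
    (forall x, Om x -> cmod (w x) <= cmod (u x) + cmod (v x)) ->
    (Lpnorm p Om u <= r%:E)%E -> (Lpnorm p Om v <= s%:E)%E ->
    (Lpnorm p Om w <= K%:E)%E.
Proof.
case: p => [p||//] p0 r0 s0; last first.
  have rs : 0 <= r + s by rewrite addr_ge0.
  exists (r + s) => // Om w u v mO mw mu_ mv wuv.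
  move=> /(Lpnorm_inf_le _ _ r0) Hu /(Lpnorm_inf_le _ _ s0) Hv.
  apply/(Lpnorm_inf_le _ _ rs); apply: (@filterS2 _ _ (@completed_ae_filter R) _ _ _ _ Hu Hv).
  by move=> x hu hv Ox; rewrite (le_trans (wuv x Ox)) // lerD; [|exact: hu|exact: hv].
rewrite lte_fin in p0; pose K : R := 2 `^ p * r `^ p + 2 `^ p * s `^ p.
have K0 : 0 <= K by rewrite addr_ge0 // mulr_ge0 ?powR_ge0.
exists (K `^ p^-1); first exact: powR_ge0.
move=> Om w u v mO mw mu_ mv wuv.
move=> /(Lpnorm_le _ _ p0 r0) Hu /(Lpnorm_le _ _ p0 s0) Hv.
apply/(Lpnorm_le _ _ p0 (powR_ge0 _ _)); rewrite -powRrM mulVf ?gt_eqF // powRr1 //.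
have e12 : 1 + 1 = 2 :> R by lra.
have := Lpint_triangle p0 ltr01 mO mw mu_ mv wuv; rewrite invr1 e12 => /le_trans; apply.
rewrite /K EFinD [(2 `^ p * r `^ p)%:E]EFinM [(2 `^ p * s `^ p)%:E]EFinM.
have h2 : (0 <= (2 `^ p)%:E)%E by rewrite lee_fin powR_ge0.
exact: (leeD (lee_wpmul2l h2 Hu) (lee_wpmul2l h2 Hv)).
Qed.

(** Continuity of the quasinorm under small perturbations, for all p: take eta
    so small that (1 + eta) l < l + delta and let e fill the remaining gap
    between the p-th powers. *)
Lemma Lpnorm_add_small p (l delta : R) : 0 < p -> 0 <= l -> 0 < delta ->
  exists2 e : R, 0 < e & forall Om w u v, measurable (Om : set LR) ->
    cmeasurable w -> cmeasurable u -> cmeasurable v ->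
    (forall x, Om x -> cmod (w x) <= cmod (u x) + cmod (v x)) ->
    (Lpnorm p%:E Om u <= l%:E)%E -> (Lpint p Om v <= e%:E)%E ->
    (Lpnorm p%:E Om w <= (l + delta)%:E)%E.
Proof.
move=> p0 l0 d0; have ldp : 0 < l + delta by rewrite ltr_wpDl.
pose eta := delta / (l + delta); have e0 : 0 < eta by rewrite divr_gt0.
pose gap := (l + delta) `^ p - ((1 + eta) * l) `^ p.
have el : (1 + eta) * l < l + delta.
  have : delta * l / (l + delta) < delta.
    by rewrite ltr_pdivrMr // ltr_pM2l // ltrDl.
  by rewrite /eta mulrDl mul1r mulrAC; lra.
have gap0 : 0 < gap.
  by rewrite subr_gt0 gt0_ltr_powR // ?nnegrE ?(ltW ldp) // mulr_ge0 // addr_ge0 // ltW.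
have c1 : 0 < (1 + eta^-1) `^ p by rewrite powR_gt0 // addr_gt0 // invr_gt0.
exists (gap / (1 + eta^-1) `^ p); first by rewrite divr_gt0.
move=> Om w u v mO mw mu_ mv tri /(Lpnorm_le _ _ p0 l0) ul ve.
apply/(Lpnorm_le _ _ p0 (ltW ldp)).
apply: le_trans (Lpint_triangle p0 e0 mO mw mu_ mv tri) _.
have -> : (l + delta) `^ p = (1 + eta) `^ p * l `^ p + gap.
  by rewrite /gap (powRM p (addr_ge0 ler01 (ltW e0)) l0) [RHS]addrC subrK.
rewrite EFinD [((1 + eta) `^ p * l `^ p)%:E]EFinM.
have c2 : (0 <= ((1 + eta) `^ p)%:E)%E by rewrite lee_fin powR_ge0.
have c3 : (0 <= ((1 + eta^-1) `^ p)%:E)%E by rewrite lee_fin powR_ge0.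
apply: (leeD (lee_wpmul2l c2 ul) _).
apply: le_trans (lee_wpmul2l c3 ve) _.
by rewrite -EFinM lee_fin mulrC divfK // gt_eqF.
Qed.

Lemma continuous_cmod_line (g : R[i] -> R[i]) : ccont g ->
  continuous (fun x : R => cmod (g x%:C)).
Proof.
move=> cg x; apply/cvgrPdist_le => /= e e0.
have [d d0 H] := cg x%:C e e0.
apply/nbhs_ballP; exists d => //= t; rewrite /ball /= distrC => /ltW td.
rewrite distrC (le_trans (ler_dist_cmod _ _)) //.
have -> : t%:C = x%:C + (t - x)%:C by rewrite -rmorphD addrC subrK.
by apply: H; rewrite cmod_real.
Qed.

(** A point where a continuous function exceeds K has a one-sided interval of
    such points within the segment, and this interval has positive measure. *)
Lemma ae_bound_continuous (g : R[i] -> R[i]) (A K : R) : ccont g -> 0 < A ->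
  {ae mu, forall x, `[- A, A]%classic x -> cmod (g x%:C) <= K} ->
  forall x, - A <= x <= A -> cmod (g x%:C) <= K.
Proof.
move=> cg A0 [N [mN N0 HN]] x xA; rewrite leNgt; apply/negP => Kx.
have e0 : 0 < (cmod (g x%:C) - K) / 2 by rewrite divr_gt0 // subr_gt0.
have [d d0 H] := cg x%:C _ e0.
pose dl := Num.min d A; have dl0 : 0 < dl by rewrite lt_min d0.
have dld : dl <= d by rewrite ge_min lexx.
have dlA : dl <= A by rewrite ge_min lexx orbT.
have [a [b [ab sub1 sub2]]] : exists a b, [/\ a < b,
    (forall t, a <= t <= b -> - A <= t <= A) &
    (forall t, a <= t <= b -> `|t - x| <= d)].
  have [x0|x0] := leP x 0.
    by clear -x0 dl0 dld dlA xA; exists x, (x + dl);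
      split=> [|t ?|t ?]; rewrite ?ler_norml; lra.
  by clear -x0 dl0 dld dlA xA; exists (x - dl), x;
    split=> [|t ?|t ?]; rewrite ?ler_norml; lra.
have big (t : R) : a <= t <= b -> K < cmod (g t%:C).
  move=> tab; have := H (t - x)%:C; rewrite cmod_real => /(_ (sub2 _ tab)).
  have -> : x%:C + (t - x)%:C = t%:C by rewrite -rmorphD addrC subrK.
  move=> h; have := le_trans (ler_dist_cmod _ _) h; rewrite ler_norml.
  by clear -Kx; lra.
have : (mu `[a, b]%classic <= mu N)%E.
  apply: le_measure; rewrite ?inE //; first exact: measurable_segment.
  move=> t /=; rewrite in_itv /= => tab; apply: HN => /= h.
  have tA : `[- A, A]%classic t by rewrite /= in_itv /=; exact: sub1.
  by have := h tA; rewrite leNgt big.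
move=> h; have : (mu `[a, b]%classic <= 0)%E.
  by apply: le_trans h _; rewrite le_eqVlt; apply/orP; left; apply/eqP; exact: N0.
have E : (b - a)%:E = mu `[a, b]%classic by rewrite (completed_segment (ltW ab)).
have ba : (0 < (b - a)%:E)%E by rewrite lte_fin subr_gt0.
by apply/negP; rewrite -ltNge; rewrite E in ba.
Qed.

(** The weight tames polynomials near the end points of [-A, A], where their
    values are not bounded by a constant multiple of the L_p norm, even when
    the degree is of order A. *)
Definition weight (A : R) (j : nat) : {poly R[i]} :=
  (1 - (A%:C^-1 *: 'X) ^+ 2) ^+ j.

Lemma weightE A j (z : R[i]) : (weight A j).[z] = (1 - (z / A%:C) ^+ 2) ^+ j.
Proof. by rewrite /weight !hornerE mulrC. Qed.

Lemma weight_real A j (x : R) : (weight A j).[x%:C] = ((1 - (x / A) ^+ 2) ^+ j)%:C.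
Proof. by rewrite weightE rmorphXn rmorphB rmorph1 rmorphXn fmorph_div. Qed.

Lemma size_weight A j : (size (weight A j) <= (2 * j).+1)%N.
Proof.
rewrite /weight (leq_trans (size_poly_exp_leq _ _)) // ltnS leq_mul2r.
apply/orP; right; rewrite -subn1 leq_subLR (leq_trans (size_polyD _ _)) //.
rewrite geq_max size_poly1 /= size_polyN (leq_trans (size_poly_exp_leq _ _)) //.
have : (size (A%:C^-1 *: 'X : {poly R[i]}) <= 2)%N.
  by rewrite (leq_trans (size_scale_leq _ _)) // size_polyX.
by case: (size _) => [|[|[|]]].
Qed.

Lemma poly_segment_max P (A : R) : 0 < A -> exists2 x0, - A <= x0 <= A &
  forall x, - A <= x <= A -> cmod P.[x%:C] <= cmod P.[x0%:C] :> R.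
Proof.
move=> A0; have AA : - A <= A by lra.
have cP : ccont (fun z => P.[z]) by exact: cdiff_ccont (cdiff_horner P).
have [c cA H] := EVT_max AA (continuous_subspaceT (continuous_cmod_line cP)).
by exists c; [move: cA; rewrite in_itv|move=> x xA; apply: H; rewrite in_itv].
Qed.

Lemma cmeasurable_horner (P : {poly R[i]}) : cmeasurable (fun x : R => P.[x%:C]).
Proof.
by apply: (@ccont_cmeasurable _ (fun z => P.[z])); exact: cdiff_ccont (cdiff_horner P).
Qed.

(** At the maximum point of Q = P (1 - x^2/A^2)^j, [nikolskii_interval] yields an
    interval of length about S A / N on which |Q| is at least half the maximum,
    while the weight there is at most S^(2j).  So the integral of |P|^p is at
    least a constant times max^p S^(1 - 2jp) A / N, and since 2jp >= 1 the power
    of S is at least 1.  The hypothesis on B keeps N / A bounded. *)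
Theorem nikolskii (p : \bar R) : (0 < p)%E -> exists j, forall B K : R, 0 <= K ->
  exists M : R, forall (A : R) N (P : {poly R[i]}), 0 < A -> (0 < N)%N ->
    (N + 2 * j)%:R <= B * A -> (size P <= N.+1)%N ->
    (Lpnorm p `[(- A)%R, A]%classic (fun x : R => P.[x%:C]) <= K%:E)%E ->
    seg_bounded (P * weight A j) A M.
Proof.
case: p => [p||//]; last first.
  move=> _; exists 0%N => B K K0; exists K => A N P A0 _ _ _ /(Lpnorm_inf_le _ _ K0) PK.
  have cP : ccont (fun z => P.[z]) by exact: cdiff_ccont (cdiff_horner P).
  by move=> x xA; rewrite /weight expr0 mulr1; apply: (ae_bound_continuous cP A0 PK).
rewrite lte_fin => p0; pose j := (Num.truncn p^-1).+1; exists j => B K K0.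
have jp : 1 <= (2 * j)%:R * p.
  have : p^-1 <= j%:R by rewrite ltW // truncnS_gt.
  rewrite -ler_pdivrMr // div1r => /le_trans; apply.
  by rewrite ler_nat mul2n -addnn leq_addl.
(* The constant of nikolskii_interval. *)
pose c0 : R := cos 1 / (32 * expR 1).
have c00 : 0 < c0 by rewrite divr_gt0 ?cos1_gt0 // mulr_gt0 // expR_gt0.
exists (2 * (K `^ p * B / c0) `^ p^-1) => A N P A0 N0 NB sP PK.
set Q := P * weight A j; set N' := (N + 2 * j)%N in NB.
have N'0 : (0 < N')%N by rewrite addn_gt0 N0.
have N'R : 0 < N'%:R :> R by rewrite ltr0n.
have B0 : 0 < B by rewrite -(pmulr_lgt0 B A0) (lt_le_trans N'R).
have sQ : (size Q <= N'.+1)%N.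
  rewrite (leq_trans (size_polyMleq _ _)) // -subn1 leq_subLR.
  by rewrite (leq_trans (leq_add sP (size_weight A j))) // addSn addnS add1n.
have [x0 x0A maxQ] := poly_segment_max Q A0.
set M := cmod Q.[x0%:C] in maxQ; have M0 : 0 <= M by exact: cmod_ge0.
have [a [b [S [aA bA /andP[S0 S1] len HS]]]] :=
  @nikolskii_interval _ A N' Q M x0 A0 N'0 sQ maxQ x0A erefl.
have ab : a <= b.
  rewrite -subr_ge0 (le_trans _ len) // divr_ge0 ?(ltW N'R) //.
  by rewrite mulr_ge0 ?(ltW S0) // mulr_ge0 ?(ltW A0) // ltW.
suff MK : (M / 2) `^ p <= K `^ p * B / c0.
  move=> x /maxQ; move/le_trans; apply.
  have M2 : 0 <= M / 2 by rewrite divr_ge0.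
  have : M / 2 <= (K `^ p * B / c0) `^ p^-1.
    have -> : M / 2 = ((M / 2) `^ p) `^ p^-1 by rewrite -powRrM divff ?gt_eqF // powRr1.
    by apply: ge0_ler_powR; rewrite ?nnegrE ?invr_ge0 ?(ltW p0) ?powR_ge0 // (le_trans _ MK) ?powR_ge0.
  by lra.
move: PK => /(Lpnorm_le _ _ p0 K0) PK.
have low : (((M / 2) `^ p * S^-1 * (b - a))%:E <= (K `^ p)%:E)%E.
  have c1 : 0 <= (M / 2) `^ p * S^-1 by rewrite mulr_ge0 ?powR_ge0 // invr_ge0 ltW.
  have sub : `[a, b]%classic `<=` `[- A, A]%classic.
    by move=> x /=; rewrite !in_itv /= => /andP[h1 h2]; apply/andP; split; lra.
  apply: (le_trans (Lpint_ge_bound (measurable_segment (- A) A)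
    (cmeasurable_horner P) c1 ab sub _) PK).
  move=> x xab; have [h1 h2] := HS x xab.
  have xA : -1 <= x / A <= 1.
    by rewrite ler_pdivlMr // ler_pdivrMr // mulN1r mul1r; lra.
  have w0 : 0 <= 1 - (x / A) ^+ 2.
    by rewrite subr_ge0 -[leRHS](expr1n _ 2) -[leLHS]real_normK ?num_real //
      lerXn2r ?nnegrE // ler_norml.
  have : M / 2 <= cmod P.[x%:C] * (S ^+ 2) ^+ j.
    rewrite (le_trans h1) // /Q hornerM cmodM weight_real cmod_real ger0_norm ?exprn_ge0 //.
    by rewrite ler_wpM2l ?cmod_ge0 // lerXn2r ?nnegrE ?sqr_ge0.
  rewrite -exprM => hM.
  have hMp : (M / 2) `^ p <= cmod P.[x%:C] `^ p * S.
    apply: (@le_trans _ _ ((cmod P.[x%:C] * S ^+ (2 * j)) `^ p)).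
      by apply: ge0_ler_powR; rewrite ?nnegrE ?(ltW p0) ?divr_ge0 ?mulr_ge0 ?cmod_ge0 ?exprn_ge0 ?(ltW S0).
    rewrite powRM ?cmod_ge0 ?exprn_ge0 ?(ltW S0) // ler_wpM2l ?powR_ge0 //.
    rewrite -powR_mulrn ?(ltW S0) // -powRrM.
    by apply: ge1r_powR => //; rewrite S0.
  by rewrite ler_pdivrMr.
rewrite lee_fin in low.
have : (M / 2) `^ p * S^-1 * (c0 * A * S / N'%:R) <= K `^ p.
  by apply: le_trans low; rewrite ler_wpM2l // mulr_ge0 ?powR_ge0 // invr_ge0 ltW.
have -> : (M / 2) `^ p * S^-1 * (c0 * A * S / N'%:R) = (M / 2) `^ p * c0 * (A / N'%:R).
  by field; rewrite !gt_eqF.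
move=> H; rewrite ler_pdivlMr // -ler_pdivrMr // (le_trans _ H) //.
apply: ler_wpM2l; first by rewrite mulr_ge0 ?powR_ge0 // ltW.
by rewrite ler_pdivlMr // mulrC ler_pdivrMr // mulrC.
Qed.

End LpTools.

(** * Entire functions of exponential type in L_p *)

Section BandApproximation.
Context {R : realType}.
Notation "x %:C" := (real_complex R x).
Notation mu := (@completed_lebesgue_measure R).
Notation LR := (lebesgueType R).
Implicit Types (g : R[i] -> R[i]).

Lemma entire_cdiff g : entire g <-> forall z, cdiff g z.
Proof. by split=> H z; apply/derivable_cdiff; exact: H. Qed.

Lemma exp_type_bound (sigma eps : R) g : exp_type sigma g -> 0 < eps ->
  exists2 C : R, 0 <= C & forall z, cmod (g z) <= C * expR ((sigma + eps) * cmod z).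
Proof.
move=> H /H[C HC]; exists C => //.
by have := HC 0; rewrite cmod0 mulr0 expR0 mulr1; apply: le_trans; exact: cmod_ge0.
Qed.

(** Taylor polynomials of degree proportional to m, on the disc |z| <= m: on the
    disc of radius 2 e m the growth of g is exp(2 e s m), and a degree L m with
    L > 2 e s makes the Taylor remainder win. *)
Lemma section_approx g (sigma : R) : B_ sigma g -> exists (L : nat) (C : R),
  [/\ (0 < L)%N, 0 <= C & forall m, (0 < m)%N ->
    exists2 P : {poly R[i]}, (size P <= L * m)%N &
      forall z, cmod z <= m%:R -> cmod (g z - P.[z]) <= C * expR (- m%:R)].
Proof.
move=> [/entire_cdiff dg tg]; have [C C0 gC] := exp_type_bound tg ltr01.
pose s := `|sigma + 1|; have s0 : 0 <= s by exact: normr_ge0.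
have gs z : cmod (g z) <= C * expR (s * cmod z).
  rewrite (le_trans (gC z)) // ler_wpM2l // ler_expR ler_wpM2r ?cmod_ge0 //.
  exact: ler_norm.
set e := expR 1 : R; have e0 : 0 < e by exact: expR_gt0.
(* The Taylor remainder is at most exp (2 e s m - L m) <= exp (- m). *)
pose L := (Num.truncn (2 * e * s + 1)).+1.
have L1 : 2 * e * s + 1 <= L%:R by rewrite ltW // truncnS_gt.
exists L, C; split => // m m0; have mR : 0 < m%:R :> R by rewrite ltr0n.
have r0 : 0 < 2 * e * m%:R by rewrite !mulr_gt0.
have [|P sP HP] := @taylor_polynomial _ g (2 * e * m%:R)
    (C * expR (s * (2 * e * m%:R))) (L * m) dg r0.
  by move=> z zr; rewrite (le_trans (gs z)) // ler_wpM2l // ler_expR ler_wpM2l.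
exists P => // z zm; have e1 : 1 <= e by have := expR_ge1Dx (1 : R); rewrite -/e; lra.
apply: le_trans (HP z _) _.
  by rewrite (le_trans zm) // ler_peMl ?(ltW mR) //; lra.
rewrite -mulrA ler_wpM2l //.
have q : 2 * cmod z / (2 * e * m%:R) <= expR (-1).
  rewrite expRN -/e ler_pdivrMr // [leRHS](_ : _ = 2 * m%:R); last by field; rewrite gt_eqF.
  by rewrite ler_pM2l.
have q' : (2 * cmod z / (2 * e * m%:R)) ^+ (L * m) <= expR (- (L * m)%:R).
  have -> : - (L * m)%:R = (L * m)%:R * (-1) :> R by rewrite mulrN1.
  rewrite expRM_natl.
  by apply: lerXn2r; rewrite ?nnegrE ?expR_ge0 // divr_ge0 ?(ltW r0) // mulr_ge0 ?cmod_ge0.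
apply: le_trans (ler_wpM2l (expR_ge0 _) q') _.
rewrite -expRD ler_expR natrM.
have : (2 * e * s + 1) * m%:R <= L%:R * m%:R by rewrite ler_pM2r.
lra.
Qed.

(** Exponentially small errors on [-m, m] stay bounded in L_p in spite of the
    length 2m. *)
Lemma section_Lp_bound (p : \bar R) g (C : R) : (0 < p)%E -> ccont g -> 0 <= C ->
  (Lpnorm p [set: R] (fun x : R => g x%:C) < +oo)%E ->
  exists2 K : R, 0 <= K & forall m (P : {poly R[i]}), (0 < m)%N ->
    (forall z, cmod z <= m%:R -> cmod (g z - P.[z]) <= C * expR (- m%:R)) ->
    (Lpnorm p `[(- m%:R)%R, m%:R]%classic (fun x : R => P.[x%:C]) <= K%:E)%E.
Proof.
move=> p0 cg C0 /Lpnorm_fin[r r0 gr].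
have mg := ccont_cmeasurable cg.
have inI m (x : R) : - m%:R <= x <= m%:R -> cmod x%:C <= m%:R.
  by rewrite cmod_real ler_norml.
have [s s0 Hs] : exists2 s : R, 0 <= s & forall m (P : {poly R[i]}), (0 < m)%N ->
    (forall z, cmod z <= m%:R -> cmod (g z - P.[z]) <= C * expR (- m%:R)) ->
    (Lpnorm p `[(- m%:R)%R, m%:R]%classic (fun x : R => g x%:C - P.[x%:C])%R <= s%:E)%E.
  case: p p0 {gr} => [p||//] p0; last first.
    exists C => // m P m0 gP; apply/(Lpnorm_inf_le _ _ C0).
    apply: (@filterE _ _ (@completed_ae_filter R)) => x.
    rewrite /= in_itv /= => xm; rewrite (le_trans (gP _ (inI _ _ xm))) // ler_piMr // expR_le1.
  rewrite lte_fin in p0; pose K := C `^ p * (2 / p).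
  have K0 : 0 <= K by rewrite mulr_ge0 ?powR_ge0 // divr_ge0 // ltW.
  exists (K `^ p^-1); first exact: powR_ge0.
  move=> m P m0 gP; apply/(Lpnorm_le _ _ p0 (powR_ge0 _ _)).
  rewrite -powRrM mulVf ?gt_eqF // powRr1 //.
  have mm : - m%:R <= m%:R :> R by rewrite ge0_cp //.
  have mgP := cmeasurableB mg (cmeasurable_horner P).
  apply: le_trans (Lpint_le_bound (ltW p0) mm mgP (fun x xm => gP _ (inI _ _ xm))) _.
  rewrite lee_fin powRM ?expR_ge0 // -mulrA ler_wpM2l ?powR_ge0 //.
  have -> : expR (- m%:R) `^ p = (expR (m%:R * p))^-1 by rewrite -expRM mulNr expRN.
  rewrite mulrC ler_pdivrMr ?expR_gt0 // opprK -mulr2n -[_ *+ 2]mulr_natl.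
  rewrite mulrAC -[leRHS]mulrA ler_pM2l // ler_pdivlMr //.
  by rewrite (le_trans _ (expR_ge1Dx _)) // lerDr.
have [K K0 HK] := Lpnorm_quasi_triangle p0 r0 s0.
exists K => // m P m0 gP; have mP := cmeasurable_horner P.
have mO := measurable_segment (- m%:R : R) m%:R.
apply: (HK _ _ _ _ mO mP mg (cmeasurableB mg mP) _ (Lpnorm_subset_le p0 r0 mO mg gr) (Hs m P m0 gP)).
by move=> x _; rewrite -{1}[P.[x%:C]](subKr (g x%:C)) cmodB.
Qed.

(** A function of exponential type in L_p is bounded on the real line, and more:
    the Taylor polynomials of g on |z| <= m have bounded L_p norm on [-m, m],
    hence are bounded on [-m/2, m/2] by [nikolskii] (where the weight is bounded
    below), and [bernstein_walsh_shift] around a real x with |x| <= m/4 transfers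
    this to complex arguments at a rate which does not depend on x. *)
Theorem strip_bound (p : \bar R) g (sigma : R) : (0 < p)%E -> B_ sigma g ->
  (Lpnorm p [set: R] (fun x : R => g x%:C) < +oo)%E ->
  exists M K : R, forall (x : R) z, cmod (g (x%:C + z)) <= M * expR (K * cmod z).
Proof.
move=> p0 Bg gLp; have dg : forall z, cdiff g z by apply/entire_cdiff; case: Bg.
have [L [C [L0 C0 HL]]] := section_approx Bg.
have [K K0 HK] := section_Lp_bound p0 (cdiff_ccont dg) C0 gLp.
have [j Hj] := nikolskii p0; have [M HM] := Hj (L + 2 * j)%:R K K0.
exists (2 ^+ j * `|M| + C), (4 * L%:R) => x z.
(* Then x + z is in the disc |z| <= m, and [x - m/4, x + m/4] in [-m/2, m/2]. *)
pose m := (Num.truncn (4 * `|x| + 4 * cmod z)).+1.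
have mB : 4 * `|x| + 4 * cmod z <= m%:R by rewrite ltW // truncnS_gt.
have mR : 0 < m%:R :> R by rewrite ltr0n.
have [P sP HP] := HL m isT.
have sP' : (size P <= (L * m).+1)%N by rewrite (leq_trans sP).
have Lm0 : (0 < L * m)%N by rewrite muln_gt0 L0.
have LmB : (L * m + 2 * j)%:R <= (L + 2 * j)%:R * m%:R :> R.
  by rewrite -natrM ler_nat mulnDl leq_add2l leq_pmulr.
have wP := HM m%:R (L * m)%N P mR Lm0 LmB sP' (HK m P isT HP).
have half (t : R) : - (m%:R / 2) <= t <= m%:R / 2 -> cmod P.[t%:C] <= 2 ^+ j * `|M|.
  move=> tm; have tm' : - m%:R <= t <= m%:R by lra.
  have := wP t tm'; rewrite hornerM cmodM weight_real cmod_real => H.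
  have w12 : (1 / 2) ^+ j <= `|(1 - (t / m%:R) ^+ 2) ^+ j|.
    rewrite normrX; apply: lerXn2r; rewrite ?nnegrE //.
    have : `|t / m%:R| <= 1 / 2.
      by rewrite normrM normfV (gtr0_norm mR) ler_pdivrMr // ler_norml; lra.
    move=> h; have : (t / m%:R) ^+ 2 <= 1 / 2.
      by rewrite -real_normK ?num_real // expr2; have := normr_ge0 (t / m%:R); nra.
    by move=> h2; rewrite ger0_norm; lra.
  have : cmod P.[t%:C] * (1 / 2) ^+ j <= `|M|.
    apply: le_trans (ler_norm M); apply: le_trans H.
    by rewrite ler_wpM2l ?cmod_ge0.
  by rewrite div1r exprVn ler_pdivrMr ?exprn_gt0 // mulrC.
have A0 : 0 < m%:R / 4 :> R by rewrite divr_gt0.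
have xm : `|x| <= m%:R / 4 by have := cmod_ge0 z; lra.
have := @bernstein_walsh_shift _ (m%:R / 4) (L * m) P (2 ^+ j * `|M|) x z A0 sP'.
move=> /(_ _)/wrap[].
  move=> t; move: xm; rewrite ler_norml => /andP[h1 h2] /andP[h3 h4].
  by apply: half; apply/andP; split; lra.
have -> : (L * m)%:R * (cmod z / (m%:R / 4)) = 4 * L%:R * cmod z.
  by rewrite natrM; field; rewrite gt_eqF.
move=> H; have zm : cmod (x%:C + z) <= m%:R.
  by rewrite (le_trans (cmodD _ _)) // cmod_real; have := cmod_ge0 z; have := normr_ge0 x; lra.
have -> : g (x%:C + z) = P.[x%:C + z] + (g (x%:C + z) - P.[x%:C + z]) by ring.
rewrite (le_trans (cmodD _ _)) // mulrDl lerD // (le_trans (HP _ zm)) //.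
apply: ler_wpM2l => //; apply: (@le_trans _ _ 1).
  by rewrite expR_le1 oppr_le0 ltW.
apply: le_trans (expR_ge1Dx _); rewrite lerDl.
by apply: mulr_ge0; [apply: mulr_ge0|exact: cmod_ge0].
Qed.

(** [strip_bound] supplies the strip growth which [phragmen_lindelof] needs, and
    lam is taken halfway between tau and sigma. *)
Theorem band_approx (p : \bar R) g (tau sigma D : R) (a : nat -> R) : (0 < p)%E ->
  0 <= tau -> tau < sigma -> B_ tau g ->
  (Lpnorm p [set: R] (fun x : R => g x%:C) < +oo)%E ->
  (forall n, (0 < n)%N -> 0 < a n) -> (forall n, (0 < n)%N -> a n <= n%:R + D) ->
  exists K q : R, [/\ 0 <= K, 0 < q < 1 & forall n, (0 < n)%N ->
    exists2 P : {poly R[i]}, (size P <= n.+1)%N &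
      forall x, - (a n / sigma) <= x <= a n / sigma ->
        cmod (g x%:C - P.[x%:C]) <= K * q ^+ n].
Proof.
move=> p0 t0 ts Bg gLp a0 aD; have [M [K gM]] := strip_bound p0 Bg gLp.
have dg : forall z, cdiff g z by apply/entire_cdiff; case: Bg.
have e0 : 0 < (sigma - tau) / 2 by rewrite divr_gt0 // subr_gt0.
have [_ /exp_type_bound/(_ e0)[C C0 gC]] := Bg.
have lam0 : 0 < tau + (sigma - tau) / 2 by rewrite ltr_wpDl.
have [C' gC'] := phragmen_lindelof dg (ltW lam0) gC gM.
apply: (exponential_approx dg lam0 _ gC' a0 aD); lra.
Qed.

End BandApproximation.

(** * The upper bound by functions of smaller type *)

Section LpComparison.
Context {R : realType}.
Notation "x %:C" := (real_complex R x).
Notation mu := (@completed_lebesgue_measure R).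
Notation LR := (lebesgueType R).
Implicit Types (f u v w : R -> R[i]) (Om : set R).

Lemma Lpnorm_sub_fin (p : \bar R) f (g : R[i] -> R[i]) : (0 < p)%E -> ccont g ->
  in_LpR p f -> (Lpnorm p [set: R] (fun x => f x - g x%:C)%R < +oo)%E ->
  (Lpnorm p [set: R] (fun x : R => g x%:C) < +oo)%E.
Proof.
move=> p0 cg [mf /Lpnorm_fin[r r0 fr]] /Lpnorm_fin[s s0 fgs].
have [K K0 HK] := Lpnorm_quasi_triangle p0 r0 s0.
have mg := ccont_cmeasurable cg.
apply: (@le_lt_trans _ _ K%:E); last exact: ltry.
apply: (HK _ _ _ _ measurable_line mg mf (cmeasurableB mf mg) _ fr fgs).
by move=> x _; rewrite -{1}[g x%:C](subKr (f x)) cmodB.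
Qed.

(** Write Q = s^2: Bernoulli's inequality bounds n s^n, and the other factor
    s^n tends to 0. *)
Lemma linear_geometric_small (c D Q e : R) : 0 < Q < 1 -> 0 < e ->
  exists n0, forall n, (n0 <= n)%N -> c * (n%:R + D) * Q ^+ n <= e.
Proof.
move=> /andP[Q0 Q1] e0; pose s := Num.sqrt Q.
have s0 : 0 < s by rewrite sqrtr_gt0.
have Qs : Q = s ^+ 2 by rewrite sqr_sqrtr // ltW.
have s1 : s < 1 by rewrite -(ltr_pXn2r (n := 2)) ?nnegrE ?(ltW s0) // -Qs expr1n.
pose h := s^-1 - 1; have h0 : 0 < h by rewrite subr_gt0 invf_gt1.
have bern (n : nat) : n%:R * s ^+ n <= h^-1.
  rewrite -ler_pdivlMr ?exprn_gt0 // -exprVn.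
  have : 1 + n%:R * h <= s^-1 ^+ n.
    have -> : s^-1 = 1 + h by rewrite /h addrC subrK.
    elim: n => [|n IH]; first by rewrite mul0r addr0 expr0.
    rewrite exprS (le_trans _ (ler_wpM2l _ IH)) //; last by rewrite addr_ge0 // ltW.
    rewrite -natr1; have : 0 <= n%:R * h * h by rewrite !mulr_ge0 // ltW.
    by lra.
  move=> H; rewrite ler_pdivlMl //; lra.
pose B := `|c| * (h^-1 + `|D|) + 1.
have B0 : 0 < B by rewrite ltr_pwDr // mulr_ge0 // addr_ge0 // invr_ge0 ltW.
have sc : `|s| < 1 by rewrite gtr0_norm.
have eB : 0 < e / B by rewrite divr_gt0.
have /cvgrPdist_le/(_ _ eB)[n0 _ H] := cvg_expr sc.
exists n0 => n n0n; have := H n n0n; rewrite sub0r normrN normrX gtr0_norm // => sn.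
rewrite Qs -exprM mulnC exprM expr2 mulrA.
have sn1 : 0 <= s ^+ n <= 1 by rewrite exprn_ge0 ?exprn_ile1 // ltW.
have : c * (n%:R + D) * s ^+ n <= B.
  apply: (@le_trans _ _ (`|c| * (n%:R * s ^+ n + `|D|))); last first.
    by apply: (@le_trans _ _ (`|c| * (h^-1 + `|D|))); [rewrite ler_wpM2l // lerD2r|rewrite lerDl].
  rewrite -mulrA (le_trans (ler_norm _)) // normrM ler_wpM2l // mulrDl.
  rewrite (le_trans (ler_normD _ _)) // !normrM normr_nat (ger0_norm (andP sn1).1) lerD2l.
  by rewrite ler_piMr // (andP sn1).2.
move=> H1; apply: (@le_trans _ _ (B * s ^+ n)).
  by rewrite ler_wpM2r // (andP sn1).1.
by rewrite mulrC -ler_pdivlMr.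
Qed.

End LpComparison.

Section UpperBound.
Context {R : realType}.
Notation "x %:C" := (real_complex R x).
Notation mu := (@completed_lebesgue_measure R).
Notation LR := (lebesgueType R).
Implicit Types (f u v w : R -> R[i]) (Om : set R) (g : R[i] -> R[i]).

Lemma E_le n f (p : \bar R) (A : R) (r : \bar R) (P : {poly R[i]}) : (size P <= n.+1)%N ->
  (Lpnorm p `[(- A)%R, A]%classic (fun x => f x - P.[x%:C])%R <= r)%E -> (E_ n f p A <= r)%E.
Proof. by move=> sP; apply: le_trans; apply: ereal_inf_lbound; exists P. Qed.

(** The polynomials of [band_approx] for g are at distance at most l from f up to
    an error (K q^n)^p 2 A_n in the p-th power, which tends to 0. *)
Theorem E_upper_bound (p : \bar R) f g (tau sigma l delta D : R) (a : nat -> R) :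
  (0 < p)%E -> in_LpR p f -> 0 <= tau -> tau < sigma -> B_ tau g -> 0 <= l ->
  (Lpnorm p [set: R] (fun x => f x - g x%:C)%R <= l%:E)%E -> 0 < delta ->
  (forall n, (0 < n)%N -> 0 < a n) -> (forall n, (0 < n)%N -> a n <= n%:R + D) ->
  exists n0, forall n, (n0 <= n)%N -> (E_ n f p (a n / sigma)%R <= (l + delta)%:E)%E.
Proof.
move=> p0 fLp t0 ts Bg l0 fgl d0 a0 aD.
have s0 : 0 < sigma by rewrite (le_lt_trans t0).
have dg : forall z, cdiff g z by apply/entire_cdiff; case: Bg.
have cg := cdiff_ccont dg; have mg := ccont_cmeasurable cg; have [mf _] := fLp.
have gLp : (Lpnorm p [set: R] (fun x : R => g x%:C) < +oo)%E.
  by apply: Lpnorm_sub_fin fLp _ => //; exact: le_lt_trans fgl (ltry _).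
have [K [q [K0 q01 HK]]] := band_approx p0 t0 ts Bg gLp a0 aD.
have /andP[q0 q1] := q01.
have tri (P : {poly R[i]}) (x : R) :
    cmod (f x - P.[x%:C]) <= cmod (f x - g x%:C) + cmod (g x%:C - P.[x%:C]).
  by rewrite (le_trans _ (cmodD _ _)) // addrA subrK.
have ld0 : 0 <= l + delta by rewrite addr_ge0 // ltW.
case: p p0 fLp fgl gLp => [p||//] p0 fLp fgl gLp; last first.
  have qc : `|q| < 1 by rewrite gtr0_norm.
  have eB : 0 < delta / (K + 1) by rewrite divr_gt0 // ltr_wpDl.
  have /cvgrPdist_le/(_ _ eB)[n0 _ H] := cvg_expr qc.
  exists n0.+1 => n n0n; have n0' : (0 < n)%N by exact: leq_trans n0n.
  have := H n (ltnW n0n); rewrite sub0r normrN normrX gtr0_norm // => sn.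
  have Kq : K * q ^+ n <= delta.
    apply: (@le_trans _ _ ((K + 1) * q ^+ n)).
      by rewrite ler_wpM2r ?exprn_ge0 ?(ltW q0) // lerDl.
    by rewrite mulrC -ler_pdivlMr // ltr_wpDl.
  have [P sP HP] := HK n n0'.
  apply: (E_le sP); apply/(Lpnorm_inf_le _ _ ld0).
  move: fgl => /(Lpnorm_inf_le _ _ l0) fgl.
  apply: (@filterS _ _ (@completed_ae_filter R) _ _ _ fgl) => x Hx.
  rewrite /= in_itv /= => /HP xP; rewrite (le_trans (tri P x)) // lerD //; first exact: Hx.
  exact: le_trans Kq.
rewrite lte_fin in p0; have [e e0 He] := Lpnorm_add_small p0 l0 d0.
pose Q := q `^ p.
have Q01 : 0 < Q < 1.
  by rewrite powR_gt0 // /Q; have := gt0_ltr_powR p0 (ltW q0) ler01 q1; rewrite powR1.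
have [n0 Hn0] := linear_geometric_small (K `^ p * (2 / sigma)) D Q01 e0.
exists n0.+1 => n n0n; have n0' : (0 < n)%N by exact: leq_trans n0n.
have [P sP HP] := HK n n0'.
have mP := cmeasurable_horner P; have A0 : 0 < a n / sigma by rewrite divr_gt0 // a0.
have AA : - (a n / sigma) <= a n / sigma by lra.
have mO := measurable_segment (- (a n / sigma)) (a n / sigma).
apply: (E_le sP); apply: (He _ _ _ _ mO (cmeasurableB mf mP) (cmeasurableB mf mg)
  (cmeasurableB mg mP) (fun x _ => tri P x)).
  exact: Lpnorm_subset_le mO (cmeasurableB mf mg) fgl.
apply: le_trans (Lpint_le_bound (ltW p0) AA (cmeasurableB mg mP) HP) _.
rewrite lee_fin (le_trans _ (Hn0 n (ltnW n0n))) //.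
have -> : (K * q ^+ n) `^ p = K `^ p * Q ^+ n.
  rewrite powRM ?exprn_ge0 ?(ltW q0) //; congr (_ * _).
  by rewrite -(powR_mulrn n (powR_ge0 q p)) -(powR_mulrn n (ltW q0)) -!powRrM mulrC.
rewrite [leLHS](_ : _ = (K `^ p * (2 / sigma)) * a n * Q ^+ n); last first.
  by field; rewrite gt_eqF.
rewrite ler_wpM2r ?exprn_ge0 ?powR_ge0 // ler_wpM2l ?aD //.
by rewrite mulr_ge0 ?powR_ge0 // divr_ge0 // ltW.
Qed.

End UpperBound.

(** * Consequences of Fatou's lemma *)

Section FatouTools.
Context d (T : measurableType d) (R : realType).
Variable mu : {measure set T -> \bar R}.

Lemma fatou_le (F : nat -> T -> R) (G : T -> R) (v : nat -> R) (l : R) :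
  (forall k, measurable_fun [set: T] (F k)) -> (forall k x, 0 <= F k x) ->
  (forall x, (fun k => F k x) @ \oo --> G x) ->
  (forall k, (\int[mu]_x (F k x)%:E <= (v k)%:E)%E) -> v @ \oo --> l ->
  (\int[mu]_x (G x)%:E <= l%:E)%E.
Proof.
move=> mF F0 FG Fv vl.
have mF' k : measurable_fun [set: T] (fun x => (F k x)%:E) by apply/measurable_EFinP; exact: mF.
have F0' k x : [set: T] x -> (0 <= (F k x)%:E)%E by move=> _; rewrite lee_fin.
have EG x : limn_einf (fun k => (F k x)%:E) = (G x)%:E.
  by apply: (cvg_limn_einf_sup _).1; apply: cvg_EFin; [exact: nearW|exact: FG].
have := fatou mu measurableT mF' F0'.
under eq_integral do rewrite EG.
move=> /le_trans; apply.
have vl' : (fun k => (v k)%:E) @ \oo --> l%:E by apply: cvg_EFin; [exact: nearW|exact: vl].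
rewrite limn_einf_lim -(cvg_lim (@ereal_hausdorff R) vl').
apply: lee_lim; [exact: is_cvg_einfs|by apply/cvg_ex; exists l%:E|].
apply: nearW => k; apply: le_trans (Fv k); apply: ereal_inf_lbound; exists k => //=.
Qed.

(** Fatou's lemma applied to c (G + F k) - D k, which is nonnegative and tends
    to 2 c G: if the integrals of the D k stayed above e, then the integral of
    2 c G would not exceed itself minus e. *)
Lemma riesz_scheffe (F D : nat -> T -> R) (G : T -> R) (J : nat -> R) (c I e : R) :
  0 <= c -> 0 < e ->
  (forall k, measurable_fun [set: T] (F k)) -> (forall k, measurable_fun [set: T] (D k)) ->
  measurable_fun [set: T] G ->
  (forall k x, 0 <= F k x) -> (forall k x, 0 <= D k x) -> (forall x, 0 <= G x) ->
  (forall k x, D k x <= c * (G x + F k x)) ->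
  (forall x, (fun k => F k x) @ \oo --> G x) -> (forall x, (fun k => D k x) @ \oo --> (0 : R)) ->
  (\int[mu]_x (G x)%:E)%E = I%:E -> (forall k, (\int[mu]_x (F k x)%:E)%E = (J k)%:E) ->
  J @ \oo --> I -> exists k, (\int[mu]_x (D k x)%:E < e%:E)%E.
Proof.
move=> c0 e0 mF mD mG F0 D0 G0 DFG FG Dz IG IF JI.
apply: contrapT => /forallNP H.
have De k : (e%:E <= \int[mu]_x (D k x)%:E)%E by rewrite leNgt; apply/negP; exact: H.
pose h k x := c * (G x + F k x) - D k x.
have h0 k x : 0 <= h k x by rewrite subr_ge0.
have mh k : measurable_fun [set: T] (h k).
  apply: measurable_funB => //; apply: measurable_funM; first exact: measurable_cst.
  exact: measurable_funD.
have mE (u : T -> R) : measurable_fun [set: T] u -> measurable_fun [set: T] (fun x => (u x)%:E).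
  by move=> mu_; apply/measurable_EFinP.
have IcGF k : (\int[mu]_x (c * (G x + F k x))%:E = (c * (I + J k))%:E)%E.
  under eq_integral do rewrite EFinM EFinD.
  rewrite ge0_integralZl_EFin //; last first.
  - by apply: emeasurable_funD; exact: mE.
  - by move=> x _; rewrite adde_ge0 // lee_fin.
  rewrite ge0_integralD //; first by rewrite IG IF -EFinD -EFinM.
  - by move=> x _; rewrite lee_fin.
  - exact: mE.
  - by move=> x _; rewrite lee_fin.
  - exact: mE.
have hI k : (\int[mu]_x (h k x)%:E <= (c * (I + J k) - e)%:E)%E.
  rewrite EFinB leeBrDr //.
  rewrite -IcGF; under [X in (_ <= X)%E]eq_integral => x _.
    rewrite -[c * _](subrK (D k x)) EFinD.
    over.
  rewrite ge0_integralD //; first by apply: leeD.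
  - by move=> x _; rewrite lee_fin; exact: h0.
  - exact: mE (h k) (mh k).
  - by move=> x _; rewrite lee_fin.
  - exact: mE.
have hlim x : (fun k => h k x) @ \oo --> c * (G x + G x) - 0.
  apply: cvgB; last exact: Dz.
  by apply: cvgM; [exact: cvg_cst|apply: cvgD; [exact: cvg_cst|exact: FG]].
have vlim : (fun k => c * (I + J k) - e) @ \oo --> c * (I + I) - e.
  apply: cvgB; last exact: cvg_cst.
  by apply: cvgM; [exact: cvg_cst|apply: cvgD; [exact: cvg_cst|exact: JI]].
have := fatou_le mh h0 hlim hI vlim.
under eq_integral do rewrite subr0 EFinM EFinD.
rewrite ge0_integralZl_EFin //; last first.
- by apply: emeasurable_funD; exact: mE.
- by move=> x _; rewrite adde_ge0 // lee_fin.
rewrite ge0_integralD //; first by rewrite IG -EFinD -EFinM lee_fin; lra.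
- by move=> x _; rewrite lee_fin.
- exact: mE.
- by move=> x _; rewrite lee_fin.
- exact: mE.
Qed.

End FatouTools.

(** * Dilations in L_p *)

Section Dilation.
Context {R : realType}.
Notation "x %:C" := (real_complex R x).
Notation mu := (@completed_lebesgue_measure R).
Notation LR := (lebesgueType R).
Implicit Types (f u v w : R -> R[i]) (g : R[i] -> R[i]).

(** At 0 the map t |-> t^p is only continuous, for p < 1, hence the two cases. *)
Lemma cvg_powR (U : Type) (F : set_system U) {FF : Filter F} (u : U -> R) (a p : R) :
  0 < p -> (forall x, 0 <= u x) -> 0 <= a -> u @ F --> a ->
  (fun x => u x `^ p) @ F --> a `^ p.
Proof.
move=> p0 u0; rewrite le_eqVlt => /orP[/eqP <-|a0] ua.
  rewrite powR0 ?gt_eqF //; apply/cvgrPdist_le => e e0.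
  have e1 : 0 < e `^ p^-1 by exact: powR_gt0.
  move/cvgrPdist_le/(_ _ e1): ua; apply: filterS => x.
  rewrite !sub0r !normrN (ger0_norm (u0 x)) ger0_norm ?powR_ge0 // => ux.
  have -> : e = (e `^ p^-1) `^ p by rewrite -powRrM mulVf ?gt_eqF // powRr1 // ltW.
  by apply: ge0_ler_powR; rewrite ?nnegrE ?(ltW p0) // ltW.
apply: (@continuous_cvg _ _ _ _ _ _ (fun t : R => t `^ p)) => //.
apply: differentiable_continuous; apply/derivable1_diffP; apply: derivable_powR.
by rewrite in_itv /= andbT.
Qed.

Lemma B_dilation g (sigma rho : R) : 0 < rho -> B_ sigma g ->
  B_ (rho * sigma) (fun z => g (rho%:C * z)).
Proof.
move=> r0 [/entire_cdiff dg tg]; split.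
  apply/entire_cdiff => z; apply: (@cdiff_comp _ (fun z => rho%:C * z) g) => //.
  by apply: cdiffM; [exact: cdiff_cst|exact: cdiff_id].
move=> e e0; have [C HC] := tg (e / rho) (divr_gt0 e0 r0).
exists C => z; apply: le_trans (HC _) _; rewrite cmodM cmod_real (gtr0_norm r0).
rewrite le_eqVlt; apply/orP; left; apply/eqP; congr (_ * expR _).
by field; rewrite gt_eqF.
Qed.

(** Dilations g(rho_k x) with rho_k = 1 - 1/(k+2) converge to g pointwise, and
    their L_p integrals are those of g divided by rho_k, so [riesz_scheffe]
    gives convergence in L_p. *)
Theorem dilation_approx (p : R) f g (sigma l delta : R) : 0 < p -> 0 < sigma ->
  in_LpR p%:E f -> B_ sigma g -> 0 <= l ->
  (Lpnorm p%:E [set: R] (fun x => f x - g x%:C)%R <= l%:E)%E -> 0 < delta ->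
  exists tau h, [/\ 0 <= tau < sigma, B_ tau h &
    (Lpnorm p%:E [set: R] (fun x => f x - h x%:C)%R <= (l + delta)%:E)%E].
Proof.
move=> p0 s0 fLp Bg l0 fgl d0; have p0' : (0 < p%:E)%E by rewrite lte_fin.
have dg : forall z, cdiff g z by apply/entire_cdiff; case: Bg.
have cg := cdiff_ccont dg; have mg := ccont_cmeasurable cg; have [mf _] := fLp.
have [s s0' gs] : exists2 s : R, 0 <= s & (Lpnorm p%:E [set: R] (fun x : R => g x%:C) <= s%:E)%E.
  by apply: Lpnorm_fin; apply: Lpnorm_sub_fin fLp _ => //; exact: le_lt_trans fgl (ltry _).
move: gs => /(Lpnorm_le _ _ p0 s0') gs.
pose u (x : R) := cmod (g x%:C) `^ p; have u0 x : 0 <= u x by exact: powR_ge0.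
have cmg := continuous_cmod_line cg.
have cu : continuous u.
  by move=> x; apply: cvg_powR => //; [move=> y; exact: cmod_ge0|exact: cmod_ge0|exact: cmg].
pose I := fine (\int[mu]_x (u x)%:E)%E.
have IG : (\int[mu]_x (u x)%:E)%E = I%:E.
  rewrite fineK // ge0_fin_numE; first exact: le_lt_trans gs (ltry _).
  exact: Lpint_ge0.
pose rho k : R := 1 - (k.+2%:R)^-1.
have rho01 k : 0 < rho k < 1.
  by rewrite /rho subr_gt0 invf_lt1 ?ltr1n //= ltrBlDr ltrDl invr_gt0 ltr0n.
have rhol : rho @ \oo --> (1 : R).
  rewrite -[X in _ --> X]subr0; apply: cvgB; first exact: cvg_cst.
  by have := @cvg_harmonic R; rewrite -cvg_shiftS.
pose gk k z := g ((rho k)%:C * z).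
have Bgk k : B_ (rho k * sigma) (gk k) by apply: B_dilation; [case/andP: (rho01 k)|].
have mgk k : cmeasurable (fun x : R => gk k x%:C).
  by apply: ccont_cmeasurable; apply: cdiff_ccont; apply/entire_cdiff; case: (Bgk k).
have gkE k (x : R) : gk k x%:C = g (rho k * x)%:C by rewrite /gk rmorphM.
have IF k : (\int[mu]_x (cmod (gk k x%:C) `^ p)%:E)%E = ((rho k)^-1 * I)%:E.
  rewrite EFinM -IG -(ge0_integral_scale cu u0); last by case/andP: (rho01 k).
  by apply: eq_integral => x _; rewrite gkE.
have cvgx (x : R) : (fun k => rho k * x) @ \oo --> x.
  by rewrite -[X in _ --> X]mul1r; apply: cvgM => //; exact: cvg_cst.
have [e e0 He] := Lpnorm_add_small p0 l0 d0.
have mgD k := cmeasurableB mg (mgk k).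
pose F k (x : R) := cmod (gk k x%:C) `^ p.
pose D k (x : R) := cmod (g x%:C - gk k x%:C) `^ p.
have F0 k x : 0 <= F k x by exact: powR_ge0.
have D0 k x : 0 <= D k x by exact: powR_ge0.
have DFu k x : D k x <= 2 `^ p * (u x + F k x).
  have := powR_quasi_triangle p0 ltr01 (cmod_ge0 (g x%:C)) (cmod_ge0 (gk k x%:C)).
  have e12 : 1 + 1 = 2 :> R by lra.
  rewrite invr1 e12 -mulrDr; apply: le_trans.
  by apply: ge0_ler_powR; rewrite ?nnegrE ?(ltW p0) ?addr_ge0 ?cmod_ge0 ?cmodB.
have Fu x : (fun k => F k x) @ \oo --> u x.
  rewrite /F; under eq_fun do rewrite gkE.
  exact: (cvg_comp (fun k => rho k * x) u (cvgx x) (cu x)).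
have Dz x : (fun k => D k x) @ \oo --> (0 : R).
  rewrite -[X in _ --> X](@powR0 _ p) ?gt_eqF //.
  apply: cvg_powR => //; first by move=> k; exact: cmod_ge0.
  apply/cvgrPdist_le => /= eps e2; have [d' d'0 H] := cg x%:C eps e2.
  have /cvgrPdist_le/(_ _ d'0) := cvgx x; apply: filterS => k kx.
  rewrite sub0r normrN ger0_norm ?cmod_ge0 // gkE cmodBC.
  have -> : (rho k * x)%:C = x%:C + (rho k * x - x)%:C by rewrite -rmorphD addrC subrK.
  by apply: H; rewrite cmod_real distrC.
have JI : (fun k => (rho k)^-1 * I) @ \oo --> I.
  have ri : (fun k => (rho k)^-1) @ \oo --> (1 : R)^-1.
    by apply: cvgV => //; exact: oner_neq0.
  have J1 : (fun k => (rho k)^-1 * I) @ \oo --> (1 : R)^-1 * I.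
    by apply: cvgM; [exact: ri|exact: cvg_cst].
  by rewrite invr1 mul1r in J1.
have [k Hk] := riesz_scheffe (mu := mu) (powR_ge0 2 p) e0 (fun k => measurable_Lpint p (mgk k))
  (fun k => measurable_Lpint p (mgD k)) (measurable_Lpint p mg) F0 D0 u0 DFu Fu Dz IG IF JI.
have /andP[r0 r1] := rho01 k.
exists (rho k * sigma), (gk k); split => //.
  by rewrite mulr_ge0 ?(ltW r0) ?(ltW s0) //= gtr_pMl.
apply: (He _ _ _ _ measurable_line (cmeasurableB mf (mgk k)) (cmeasurableB mf mg) (mgD k) _ fgl
  (ltW Hk)).
by move=> x _; rewrite (le_trans _ (cmodD _ _)) // addrA subrK.
Qed.

End Dilation.

(** * Limits along an ultrafilter *)

Section UltraLimit.
Context {R : realType}.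
Variables (U : set_system nat) (UU : UltraFilter U).
Implicit Types (w : nat -> R[i]) (c : R[i]).

Let PU : ProperFilter U := @ultra_proper _ _ UU.

(** Limits along an ultrafilter select limits of all bounded sequences at once,
    compatibly with algebraic operations, so that a limit function is obtained
    without diagonal extraction. *)
Definition ulim w c := forall e : R, 0 < e -> U [set n | cmod (w n - c) <= e].

(** A cluster point of the image filter in a compact segment; the ultrafilter
    decides whether the sequence is close to it. *)
Lemma ultra_bounded_real (u : nat -> R) (b : R) : (forall n, `|u n| <= b) ->
  exists c : R, forall e : R, 0 < e -> U [set n | `|u n - c| <= e].
Proof.
move=> ub; have PF : ProperFilter (u @ U) by exact: fmap_proper_filter.
have Ub : (u @ U) `[- b, b]%classic.
  by apply: (@filterS _ U _ setT _ _ filterT) => n _; rewrite /= in_itv /= -ler_norml.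
have [c [_ cc]] := @segment_compact R (- b) b _ PF Ub.
exists c => e e0; have [//|H] := in_ultra_setVsetC [set n | `|u n - c| <= e] UU.
have FA : (u @ U) [set x : R | ~ (`|x - c| <= e)] by exact: H.
have [x [/= xe xc]] := cc _ _ FA (nbhsx_ballx c e e0).
by exfalso; apply: xe; rewrite distrC ltW.
Qed.

Lemma ultra_bounded w (b : R) : (forall n, cmod (w n) <= b) -> exists c, ulim w c.
Proof.
move=> wb.
have [c1 H1] := ultra_bounded_real (fun n => le_trans (normRe_le (w n)) (wb n)).
have [c2 H2] := ultra_bounded_real (fun n => le_trans (normIm_le (w n)) (wb n)).
exists (Complex c1 c2) => e e0; have e2 : 0 < e / 2 by rewrite divr_gt0.
apply: filterS2 (H1 _ e2) (H2 _ e2) => n /= h1 h2.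
rewrite (le_trans (cmod_leReIm _)) // cReB cImB /= (splitr e); exact: lerD.
Qed.

Lemma ulim_le w c (b : R) : ulim w c -> U [set n | cmod (w n) <= b] -> cmod c <= b.
Proof.
move=> wc wb; apply/ler_addgt0Pr => e e0.
have [n [/= h1 h2]] := filter_ex (filterI wb (wc e e0)).
have -> : c = w n - (w n - c) by rewrite subKr.
by rewrite (le_trans (cmodB _ _)) // lerD.
Qed.

Lemma ulimB w c w' c' : ulim w c -> ulim w' c' -> ulim (fun n => w n - w' n) (c - c').
Proof.
move=> H H' e e0; have e2 : 0 < e / 2 by rewrite divr_gt0.
apply: filterS2 (H _ e2) (H' _ e2) => n /= h1 h2.
have -> : w n - w' n - (c - c') = (w n - c) - (w' n - c') by ring.
by rewrite (le_trans (cmodB _ _)) // (splitr e) lerD.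
Qed.

Lemma ulimMr w c z : ulim w c -> ulim (fun n => w n * z) (c * z).
Proof.
move=> H e e0; have z1 : 0 < cmod z + 1 by rewrite ltr_wpDl // cmod_ge0.
have e2 : 0 < e / (cmod z + 1) by rewrite divr_gt0.
apply: filterS (H _ e2) => n /= h; rewrite -mulrBl cmodM.
apply: (@le_trans _ _ (e / (cmod z + 1) * cmod z)); first by rewrite ler_wpM2r ?cmod_ge0.
by rewrite mulrAC ler_pdivrMr // ler_pM2l // lerDl.
Qed.

End UltraLimit.

(** * Compactness of polynomials of bounded exponential growth *)

Section Compactness.
Context {R : realType}.
Notation "x %:C" := (real_complex R x).
Implicit Types (P : {poly R[i]}) (z h : R[i]).

(** The coefficients of P(z + X) are at most T 2^-k by [coef_bound], so the
    terms of order at least 2 sum up to at most T |h|^2 for |h| <= 1. *)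
Lemma poly_second_order P z (T : R) : (forall w, cmod w = 2 -> cmod P.[z + w] <= T) ->
  exists D, cmod D <= T /\ forall h, cmod h <= 1 ->
    cmod (P.[z + h] - P.[z] - D * h) <= T * cmod h ^+ 2.
Proof.
move=> PT; pose p := P \Po ('X + z%:P).
have pE h : p.[h] = P.[z + h] by rewrite /p horner_comp !hornerE addrC.
have pc k : cmod p`_k * 2 ^+ k <= T by apply: coef_bound => // w w2; rewrite pE PT.
have T0 : 0 <= T by have := pc 0%N; rewrite expr0 mulr1; apply: le_trans; exact: cmod_ge0.
exists p`_1; split.
  by apply: le_trans (pc 1%N); rewrite expr1 ler_peMr ?cmod_ge0 // ler1n.
move=> h h1; have h0 := cmod_ge0 h.
have -> : P.[z + h] - P.[z] - p`_1 * h = \sum_(2 <= k < (size p).+2) p`_k * h ^+ k.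
  have -> : P.[z] = p`_0 by rewrite -[z in LHS]addr0 -pE -horner_coef0.
  have -> : P.[z + h] = \sum_(0 <= k < (size p).+2) p`_k * h ^+ k.
    by rewrite -pE big_mkord -horner_coef_wide // ltnW.
  by rewrite big_ltn // big_ltn // expr0 expr1; ring.
apply: le_trans (cmod_sum _ _ _) _.
apply: (@le_trans _ _ (\sum_(2 <= k < (size p).+2) T * cmod h ^+ 2 * 2^-1 ^+ k)).
  apply: ler_sum_nat => k /andP[k2 _]; rewrite cmodM cmodX.
  apply: (@le_trans _ _ ((T * 2^-1 ^+ k) * cmod h ^+ 2)); last by rewrite mulrAC.
  apply: ler_pM; rewrite ?cmod_ge0 ?exprn_ge0 //; last exact: ler_wiXn2l.
  by rewrite exprVn ler_pdivlMr ?exprn_gt0.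
rewrite -mulr_sumr ler_piMr ?mulr_ge0 ?exprn_ge0 //.
apply: le_trans (geometric_tail _ _ _ _) _; rewrite ?invr_ge0 ?invf_lt1 ?ltr1n //.
have -> : 1 - 2^-1 = 2^-1 :> R by field.
by rewrite expr2 mulfK ?invr_eq0 ?pnatr_eq0 // invf_le1 // ler1n.
Qed.

(** A Montel theorem.  The limit g and its derivative are limits along an
    ultrafilter of the values and of the linear coefficients of the Q n; the
    second order bound of [poly_second_order] is uniform in n and passes to the
    limit, so g is entire.  A genuine sequence of indices, as Fatou's lemma
    demands, is obtained by requiring closeness at stage m on the grid of mesh
    1/(m+1) in [-m, m]; uniform Lipschitz bounds fill in the points between. *)
Theorem montel_exp_type (Q : nat -> {poly R[i]}) (s : nat -> R) (K S sigma : R) :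
  0 <= S -> (forall n, s n <= S) ->
  (forall n z, cmod (Q n).[z] <= K * expR (s n * cmod z)) ->
  (forall e : R, 0 < e -> exists n0, forall n, (n0 <= n)%N -> s n <= sigma + e) ->
  exists2 g, B_ sigma g & exists2 phi : nat -> nat, (forall m, (m <= phi m)%N) &
    forall (x e : R), 0 < e -> exists m0, forall m, (m0 <= m)%N ->
      cmod ((Q (phi m)).[x%:C] - g x%:C) <= e.
Proof.
move=> S0 sS QK slim.
have [U [UU Uoo]] := ultraFilterLemma (@eventually_filter).
have PU : ProperFilter U := @ultra_proper _ _ UU.
have K0 : 0 <= K.
  by have := QK 0%N 0; rewrite cmod0 mulr0 expR0 mulr1; apply: le_trans; exact: cmod_ge0.
have QS n z : cmod (Q n).[z] <= K * expR (S * cmod z).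
  by rewrite (le_trans (QK n z)) // ler_wpM2l // ler_expR ler_wpM2r ?cmod_ge0.
pose T z := K * expR (S * (cmod z + 2)).
have T0 z : 0 <= T z by rewrite mulr_ge0 // expR_ge0.
have QT n z w : cmod w = 2 -> cmod (Q n).[z + w] <= T z.
  move=> w2; rewrite (le_trans (QS n _)) // ler_wpM2l // ler_expR ler_wpM2l //.
  by rewrite (le_trans (cmodD _ _)) // w2.
have /choice[D HD] : forall nz : nat * R[i], exists D, cmod D <= T nz.2 /\
    forall h, cmod h <= 1 ->
    cmod ((Q nz.1).[nz.2 + h] - (Q nz.1).[nz.2] - D * h) <= T nz.2 * cmod h ^+ 2.
  by move=> [n z]; apply: poly_second_order => w; exact: QT.
have /choice[g Hg] : forall z, exists c, ulim U (fun n => (Q n).[z]) c.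
  by move=> z; apply: (ultra_bounded UU (b := K * expR (S * cmod z))) => n; exact: QS.
have /choice[D' HD'] : forall z, exists c, ulim U (fun n => D (n, z)) c.
  by move=> z; apply: (ultra_bounded UU (b := T z)) => n; case: (HD (n, z)).
have gdiff z h : cmod h <= 1 -> cmod (g (z + h) - g z - D' z * h) <= T z * cmod h ^+ 2.
  move=> h1; have := ulimB UU (ulimB UU (Hg (z + h)) (Hg z)) (ulimMr UU h (HD' z)).
  move/ulim_le; apply => //; apply: (@filterS _ U _ setT _ _ filterT) => n _ /=.
  by case: (HD (n, z)) => _; apply.
have D'T z : cmod (D' z) <= T z.
  apply: (ulim_le UU (HD' z)); apply: (@filterS _ U _ setT _ _ filterT) => n _ /=.
  by case: (HD (n, z)).
have lip z (u0 u1 d : R[i]) h : cmod h <= 1 -> cmod d <= T z ->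
    cmod (u1 - u0 - d * h) <= T z * cmod h ^+ 2 -> cmod (u1 - u0) <= 2 * T z * cmod h.
  move=> h1 dT H; have -> : u1 - u0 = (u1 - u0 - d * h) + d * h by rewrite subrK.
  rewrite (le_trans (cmodD _ _)) // cmodM.
  have h0 := cmod_ge0 h; have := ler_wpM2r h0 dT.
  have : T z * cmod h ^+ 2 <= T z * cmod h.
    by rewrite ler_wpM2l // expr2 ler_piMl.
  by lra.
exists g.
  split.
    apply/entire_cdiff => z; exists (D' z) => e e0.
    have d0 : 0 < Num.min 1 (e / (T z + 1)).
      by rewrite lt_min ltr01 divr_gt0 // ltr_wpDl.
    exists (Num.min 1 (e / (T z + 1))) => // h; rewrite le_min => /andP[h1 h2].
    rewrite (le_trans (gdiff z h h1)) // expr2 mulrA ler_wpM2r ?cmod_ge0 //.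
    move: h2; rewrite ler_pdivlMr ?ltr_wpDl // => h2.
    by have := cmod_ge0 h; lra.
  move=> e e0; exists K => z; apply: (ulim_le UU (Hg z)).
  have [n0 Hn0] := slim e e0; apply: Uoo; exists n0 => // n /= n0n.
  by rewrite (le_trans (QK n z)) // ler_wpM2l // ler_expR ler_wpM2r ?cmod_ge0 // Hn0.
(* The grid of mesh 1/(m+1) in [-m, m]. *)
pose y m i : R := - m%:R + i%:R / m.+1%:R.
have fin m N : U [set n | forall i, (i < N)%N ->
    cmod ((Q n).[(y m i)%:C] - g (y m i)%:C) <= m.+1%:R^-1].
  elim: N => [|N IH]; first by apply: (@filterS _ U _ setT _ _ filterT).
  have m0 : 0 < m.+1%:R^-1 :> R by rewrite invr_gt0 ltr0n.
  apply: filterS2 IH (Hg (y m N)%:C _ m0) => n /= h1 h2 i.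
  by rewrite ltnS leq_eqVlt => /orP[/eqP ->|/h1].
have /choice[phi Hphi] : forall m, exists n, (m <= n)%N /\
    forall i, (i < (2 * m * m.+1).+1)%N ->
      cmod ((Q n).[(y m i)%:C] - g (y m i)%:C) <= m.+1%:R^-1.
  move=> m; have Um : U [set n | (m <= n)%N] by apply: Uoo; exists m.
  have [n [/= h1 h2]] := filter_ex (filterI Um (fin m (2 * m * m.+1).+1)).
  by exists n.
exists phi => [m|x e e0]; first by case: (Hphi m).
pose L := 4 * T x%:C + 1; have L0 : 0 < L by rewrite ltr_wpDl // mulr_ge0.
exists (Num.truncn (`|x| + L / e)).+1 => m mb.
have mR : `|x| + L / e <= m%:R.
  by rewrite ltW // (lt_le_trans (truncnS_gt _)) // ler_nat.
have Le0 : 0 < L / e by rewrite divr_gt0.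
have m1 : 0 < m.+1%:R :> R by rewrite ltr0n.
have m1e : m.+1%:R = m%:R + 1 :> R by rewrite natr1.
have xm : - m%:R <= x <= m%:R by rewrite -ler_norml; lra.
have /andP[xm1 xm2] := xm.
have v0 : 0 <= (x + m%:R) * m.+1%:R by rewrite mulr_ge0 ?(ltW m1) //; lra.
(* The index of the grid point just below x. *)
pose i := Num.truncn ((x + m%:R) * m.+1%:R).
have /andP[i1 i2] : i%:R <= (x + m%:R) * m.+1%:R < i.+1%:R by exact: truncn_itv.
have iN : (i < (2 * m * m.+1).+1)%N.
  rewrite ltnS -(ler_nat R) (le_trans i1) // !natrM ler_pM2r //; lra.
pose h := (y m i - x)%:C.
have hm : cmod h <= m.+1%:R^-1.
  rewrite /h cmod_real.
  have -> : y m i - x = - (((x + m%:R) * m.+1%:R - i%:R) / m.+1%:R).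
    have gen (c b t d : R) : d != 0 -> - c + b / d - t = - (((t + c) * d - b) / d).
      by move=> d0; field.
    by rewrite /y gen // gt_eqF.
  rewrite normrN normrM [`|_^-1|]gtr0_norm ?invr_gt0 // ler_piMl ?invr_ge0 ?(ltW m1) //.
  by rewrite -natr1 in i2; rewrite ger0_norm ?subr_ge0 //; lra.
have h1 : cmod h <= 1.
  by rewrite (le_trans hm) // invf_le1 // m1e lerDr.
have xh : (y m i)%:C = x%:C + h by rewrite /h -rmorphD addrC subrK.
have [_ /(_ i iN)] := Hphi m; rewrite xh => H2.
have H1 : cmod ((Q (phi m)).[x%:C + h] - (Q (phi m)).[x%:C]) <= 2 * T x%:C * cmod h.
  have [d1 d2] := HD (phi m, x%:C); exact: (lip _ _ _ _ _ h1 d1 (d2 h h1)).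
have H3 : cmod (g (x%:C + h) - g x%:C) <= 2 * T x%:C * cmod h.
  exact: (lip _ _ _ _ _ h1 (D'T _) (gdiff _ _ h1)).
have -> : (Q (phi m)).[x%:C] - g x%:C = ((Q (phi m)).[x%:C + h] - g (x%:C + h)) +
    ((g (x%:C + h) - g x%:C) - ((Q (phi m)).[x%:C + h] - (Q (phi m)).[x%:C])) by ring.
apply: le_trans (cmodD _ _) _; apply: le_trans (lerD H2 (cmodB _ _)) _.
apply: (@le_trans _ _ (L / m.+1%:R)).
  apply: le_trans (lerD (lexx _) (lerD H3 H1)) _.
  have : 4 * T x%:C * cmod h <= 4 * T x%:C * m.+1%:R^-1.
    by rewrite ler_wpM2l // mulr_ge0.
  rewrite /L mulrDl mul1r; move: (m.+1%:R^-1) (T x%:C) (cmod h) => q t r.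
  by lra.
rewrite ler_pdivrMr // mulrC -ler_pdivrMr // m1e.
by have := normr_ge0 x; lra.
Qed.

End Compactness.

(** * The lower bound *)

Section LowerBound.
Context {R : realType}.
Notation "x %:C" := (real_complex R x).
Notation mu := (@completed_lebesgue_measure R).
Notation LR := (lebesgueType R).
Implicit Types (f : R -> R[i]) (g : R[i] -> R[i]).

Lemma weight_bounds (A : R) j (x : R) : 0 < A -> `|x| <= A ->
  1 - j%:R * (x / A) ^+ 2 <= (1 - (x / A) ^+ 2) ^+ j <= 1.
Proof.
move=> A0 xA; set t := (x / A) ^+ 2; have t0 : 0 <= t by exact: sqr_ge0.
have t1 : t <= 1.
  rewrite /t -real_normK ?num_real // exprn_ile1 // normrM normfV (gtr0_norm A0).
  by rewrite ler_pdivrMr // mul1r.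
rewrite exprn_ile1 ?subr_ge0 // ?gerBl // andbT.
elim: j => [|j IH]; first by rewrite mul0r subr0 expr0.
rewrite exprS; apply: le_trans (ler_wpM2l _ IH); last by rewrite subr_ge0.
rewrite -natr1; have : 0 <= j%:R * t * t by exact: (mulr_ge0 (mulr_ge0 (ler0n _ _) t0) t0).
by lra.
Qed.

(** Division by the weight, which is close to 1 at a fixed x when A is large. *)
Lemma unweight (A : R) j (x e : R) (P : {poly R[i]}) (c : R[i]) : 0 < A -> `|x| <= A ->
  0 < e -> e <= 1 / 2 -> j%:R * (x / A) ^+ 2 <= e ->
  cmod ((P * weight A j).[x%:C] - c) <= e -> cmod (P.[x%:C] - c) <= 2 * e * (1 + cmod c).
Proof.
move=> A0 xA e0 e1 te; rewrite hornerM weight_real.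
set w := (1 - _) ^+ j => H; have /andP[w1 w2] := weight_bounds j A0 xA.
rewrite -/w in w1 w2; have w3 : 1 / 2 <= w by lra.
have wp : 0 < w by lra.
have : cmod ((P.[x%:C] - c) * w%:C) <= e * (1 + cmod c).
  have -> : (P.[x%:C] - c) * w%:C = (P.[x%:C] * w%:C - c) + c * (1 - w)%:C.
    by rewrite rmorphB rmorph1; ring.
  rewrite (le_trans (cmodD _ _)) // mulrDr mulr1 lerD // cmodM cmod_real.
  rewrite ger0_norm ?subr_ge0 // mulrC ler_wpM2r ?cmod_ge0 //; lra.
rewrite cmodM cmod_real (gtr0_norm wp) => H2.
have := cmod_ge0 (P.[x%:C] - c); nra.
Qed.

(** Near-best polynomials, made bounded by the weight, are compact by
    [montel_exp_type]; the lower semicontinuity of the quasinorm under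
    pointwise convergence transfers the bound l to the limit. *)
Theorem A_lower_bound (p : \bar R) f (sigma l D : R) (a : nat -> R) :
  (0 < p)%E -> in_LpR p f -> 0 < sigma -> 0 <= l ->
  (forall n, (0 < n)%N -> 0 < a n) -> (forall n, (0 < n)%N -> `|a n - n%:R| <= D) ->
  (forall N, exists2 n, (N <= n)%N & exists2 P : {poly R[i]}, (size P <= n.+1)%N &
    (Lpnorm p `[(- (a n / sigma))%R, (a n / sigma)%R]%classic
       (fun x => f x - P.[x%:C])%R <= l%:E)%E) ->
  (A_ sigma f p <= l%:E)%E.
Proof.
move=> p0 [mf /Lpnorm_fin[r r0 fr]] s0 l0 a0 aD HP.
have D0 : 0 <= D by apply: le_trans (normr_ge0 _) (aD 1%N isT).
(* For n >= 2 D the bound on a n gives a n >= n / 2, hence n / A_n <= 2 sigma. *)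
pose N0 := (Num.truncn (2 * D)).+1.
have /choice[nP HnP] : forall k, exists nP : nat * {poly R[i]},
    [/\ (N0 + k <= nP.1)%N, (size nP.2 <= nP.1.+1)%N &
     (Lpnorm p `[(- (a nP.1 / sigma))%R, (a nP.1 / sigma)%R]%classic
       (fun x => f x - nP.2.[x%:C])%R <= l%:E)%E].
  by move=> k; have [n nk [P sP PE]] := HP (N0 + k)%N; exists (n, P).
pose n k := (nP k).1; pose P k := (nP k).2; pose A k := a (n k) / sigma.
have nk k : (N0 + k <= n k)%N by case: (HnP k).
have sP k : (size (P k) <= (n k).+1)%N by case: (HnP k).
have PE k : (Lpnorm p `[(- A k)%R, A k]%classic (fun x => f x - (P k).[x%:C])%R <= l%:E)%E.
  by case: (HnP k).
have n0 k : (0 < n k)%N by rewrite (leq_trans _ (nk k)).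
have A0 k : 0 < A k by rewrite divr_gt0 // a0.
have an k : (n k)%:R - D <= a (n k).
  by have := aD _ (n0 k); rewrite ler_norml; lra.
have nD k : 2 * D <= (n k)%:R.
  by rewrite ltW // (lt_le_trans (truncnS_gt _)) // ler_nat (leq_trans _ (nk k)) // leq_addr.
have mO k := measurable_segment (- A k) (A k).
have mP k := cmeasurable_horner (P k).
have [K K0 HK] := Lpnorm_quasi_triangle p0 r0 l0.
have PK k : (Lpnorm p `[(- A k)%R, A k]%classic (fun x : R => (P k).[x%:C]) <= K%:E)%E.
  apply: (HK _ _ _ _ (mO k) (mP k) mf (cmeasurableB mf (mP k)) _
    (Lpnorm_subset_le p0 r0 (mO k) mf fr) (PE k)).
  by move=> x _; rewrite -{1}[(P k).[x%:C]](subKr (f x)) cmodB.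
have [j Hj] := nikolskii p0.
pose B := 2 * sigma * (1 + (2 * j)%:R).
have B0 : 0 < B by rewrite mulr_gt0 ?mulr_gt0 // ltr_wpDr.
have nB k : (n k + 2 * j)%:R <= B * A k.
  have -> : B * A k = (1 + (2 * j)%:R) * (2 * a (n k)) by rewrite /B /A; field; rewrite gt_eqF.
  apply: (@le_trans _ _ ((1 + (2 * j)%:R) * (n k)%:R)).
    rewrite natrD mulrDl mul1r lerD2l -natrM ler_nat leq_pmulr //.
  by rewrite ler_wpM2l ?addr_ge0 //; have := an k; have := nD k; lra.
have [M HM] := Hj B K K0.
have QM k := HM (A k) (n k) (P k) (A0 k) (n0 k) (nB k) (sP k) (PK k).
pose Q k := P k * weight (A k) j.
have sQ k : (size (Q k) <= (n k + 2 * j).+1)%N.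
  rewrite (leq_trans (size_polyMleq _ _)) // -subn1 leq_subLR.
  by rewrite (leq_trans (leq_add (sP k) (size_weight (A k) j))) // addSn addnS add1n.
pose s k := (n k + 2 * j)%:R / A k.
have sB k : s k <= B by rewrite ler_pdivrMr.
have Qexp k z : cmod (Q k).[z] <= M * expR (s k * cmod z).
  by have := bernstein_walsh z (A0 k) (sQ k) (QM k); rewrite mulrA mulrAC.
have slim e : 0 < e -> exists n0, forall k, (n0 <= k)%N -> s k <= sigma + e.
  move=> e0; pose c := (sigma * (2 * j)%:R + (sigma + e) * D) / e.
  exists (Num.truncn c).+1 => k ck.
  have cn : c <= (n k)%:R.
    rewrite ltW // (lt_le_trans (truncnS_gt _)) // ler_nat (leq_trans ck) //.
    by rewrite (leq_trans _ (nk k)) // leq_addl.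
  rewrite ler_pdivrMr // natrD /A mulrA ler_pdivlMr //.
  have : (sigma + e) * ((n k)%:R - D) <= (sigma + e) * a (n k).
    by rewrite ler_wpM2l // addr_ge0 // ltW.
  by move: cn; rewrite ler_pdivrMr //; lra.
have [g Bg [phi phim Qg]] := montel_exp_type (ltW B0) sB Qexp slim.
have cg : ccont g by apply: cdiff_ccont; apply/entire_cdiff; case: Bg.
have mg := ccont_cmeasurable cg.
have cvgP (x e : R) : 0 < e -> exists m0, forall m, (m0 <= m)%N ->
    `|x| <= A (phi m) /\ cmod ((P (phi m)).[x%:C] - g x%:C) <= e.
  move=> e0; have g1 : 0 < 1 + cmod (g x%:C) by rewrite ltr_pwDl // cmod_ge0.
  pose e' := Num.min (1 / 2) (e / (2 * (1 + cmod (g x%:C)))).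
  have e'0 : 0 < e' by rewrite lt_min !divr_gt0 // mulr_gt0.
  have e'1 : e' <= 1 / 2 by rewrite ge_min lexx.
  have e'2 : 2 * e' * (1 + cmod (g x%:C)) <= e.
    have : e' <= e / (2 * (1 + cmod (g x%:C))) by rewrite ge_min lexx orbT.
    by rewrite ler_pdivlMr ?mulr_gt0 //; lra.
  have [m0 Hm0] := Qg x e' e'0.
  (* For A >= b the weight at x is at least 1 - e'. *)
  pose b := 1 + `|x| + j%:R * x ^+ 2 / e'.
  have b1 : 0 <= j%:R * x ^+ 2 / e'.
    by apply: divr_ge0 (ltW e'0); apply: mulr_ge0 (ler0n _ _) (sqr_ge0 _).
  exists (maxn m0 (Num.truncn (sigma * b + D)).+1) => m; rewrite geq_max => /andP[m1 m2].
  have Ab : b <= A (phi m).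
    rewrite /A ler_pdivlMr // mulrC (le_trans _ (an _)) // lerBrDr.
    rewrite ltW // (lt_le_trans (truncnS_gt _)) // ler_nat (leq_trans m2) //.
    by rewrite (leq_trans (phim m)) // (leq_trans _ (nk _)) // leq_addl.
  have xA : `|x| <= A (phi m) by rewrite /b in Ab; lra.
  have A1 : 1 <= A (phi m) by have := normr_ge0 x; rewrite /b in Ab; lra.
  split=> //; apply: le_trans e'2; apply: unweight (Hm0 m m1) => //.
  rewrite expr_div_n mulrA ler_pdivrMr ?exprn_gt0 // -ler_pdivrMl // mulrC.
  apply: (@le_trans _ _ (A (phi m))); first by have := normr_ge0 x; rewrite /b in Ab; lra.
  by rewrite expr2 ler_peMr // ltW.
suff gl : (Lpnorm p [set: R] (fun x => f x - g x%:C)%R <= l%:E)%E.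
  by apply: le_trans gl; apply: ereal_inf_lbound; exists g.
have inA k (x : R) : `|x| <= A k -> `[(- A k)%R, A k]%classic x.
  by rewrite /= in_itv /= ler_norml.
case: p p0 {fr HP HnP HK PK Hj HM} PE => [p||//] p0 PE; last first.
  apply/(Lpnorm_inf_le _ _ l0).
  have H k := (Lpnorm_inf_le _ _ l0).1 (PE k).
  have Hall := @ae_foralln _ LR _ mu _ H.
  apply: (@filterS _ _ (@completed_ae_filter R) _ _ _ Hall) => x Hx _.
  apply/ler_addgt0Pr => e e0; have [m0 /(_ m0 (leqnn _))[xA Pg]] := cvgP x e e0.
  have -> : f x - g x%:C = (f x - (P (phi m0)).[x%:C]) + ((P (phi m0)).[x%:C] - g x%:C).
    by rewrite addrA subrK.
  by rewrite (le_trans (cmodD _ _)) // lerD // Hx //; exact: inA.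
rewrite lte_fin in p0; apply/(Lpnorm_le _ _ p0 l0).
pose u k (x : R) := cmod (f x - (P k).[x%:C]) `^ p.
pose F m := (u (phi m)) \_ (`[(- A (phi m))%R, A (phi m)]%classic).
have mu_ k := measurable_Lpint p (cmeasurableB mf (mP k)).
apply: (@fatou_le _ LR _ mu F _ (fun=> l `^ p)).
- move=> m; apply/(measurable_restrictT _ (mO (phi m))); exact: mu_.
- by move=> m x; rewrite /F patchE; case: ifP => // _; exact: powR_ge0.
- move=> x; apply: (@cvg_trans _ ((fun m => u (phi m) x) @ \oo)).
    apply: near_eq_cvg; have [m0 Hm0] := cvgP x 1 ltr01; exists m0 => // m /= m0m.
    by rewrite /F patchE mem_set //; apply: inA; case: (Hm0 m m0m).
  apply: cvg_powR => //; [by move=> m; exact: cmod_ge0|exact: cmod_ge0|].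
  apply/cvgrPdist_le => e e0; have [m0 Hm0] := cvgP x e e0; exists m0 => // m /= m0m.
  rewrite (le_trans (ler_dist_cmod _ _)) //.
  have -> : f x - g x%:C - (f x - (P (phi m)).[x%:C]) = (P (phi m)).[x%:C] - g x%:C by ring.
  by case: (Hm0 m m0m).
- move=> m; have H := (Lpnorm_le _ _ p0 l0).1 (PE (phi m)); apply: le_trans H.
  rewrite /Lpint [leRHS]integral_mkcond le_eqVlt; apply/orP; left; apply/eqP.
  by apply: eq_integral => x _; rewrite /F !patchE; case: ifP.
- exact: cvg_cst.
Qed.

End LowerBound.



(** * Upper and lower limits of extended real sequences *)

Section Limits.
Context {R : realType}.
Implicit Types (u : nat -> \bar R) (x y : \bar R).

Lemma limn_einf_lt_frequently u x : (limn_einf u < x)%E ->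
  forall N, exists2 n, (N <= n)%N & (u n < x)%E.
Proof.
move=> ux N; have H : (einfs u N < x)%E.
  apply: le_lt_trans ux; rewrite limn_einf_lim.
  rewrite (cvg_lim (@ereal_hausdorff R) (@cvg_einfs_sup R u)).
  by apply: ereal_sup_ubound; exists N.
by have [_ [n /= Nn <-] unx] := ereal_inf_lt H; exists n.
Qed.

Lemma limn_esup_le_eventually u x N : (forall n, (N <= n)%N -> (u n <= x)%E) ->
  (limn_esup u <= x)%E.
Proof.
move=> ux; apply: (@le_trans _ _ (esups u N)).
  rewrite limn_esup_lim (cvg_lim (@ereal_hausdorff R) (@cvg_esups_inf R u)).
  by apply: ereal_inf_lbound; exists N.
by apply: ge_ereal_sup => _ [n /= Nn <-]; exact: ux.
Qed.

Lemma limn_einf_ge0 u : (forall n, (0 <= u n)%E) -> (0 <= limn_einf u)%E.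
Proof.
move=> u0; rewrite leNgt; apply/negP => /limn_einf_lt_frequently/(_ 0%N)[n _].
by rewrite ltNge u0.
Qed.

(** The sequence is squeezed between its tail infima and tail suprema. *)
Lemma cvg_einf_esup u x : (limn_esup u <= x)%E -> (x <= limn_einf u)%E -> u @ \oo --> x.
Proof.
move=> ux xu; have le := limn_einf_sup u.
have Ei : limn_einf u = x by apply/eqP; rewrite eq_le xu (le_trans le).
have Es : limn_esup u = x by apply/eqP; rewrite eq_le ux (le_trans xu).
apply: (@squeeze_cvge _ _ _ _ (einfs u) u (esups u)).
- apply: nearW => n; apply/andP; split.
    by apply: ereal_inf_lbound; exists n => /=.
  by apply: ereal_sup_ubound; exists n => /=.
- by rewrite -Ei limn_einf_lim; exact: is_cvg_einfs.
- by rewrite -Es limn_esup_lim; exact: is_cvg_esups.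
Qed.

Lemma ereal_between x y : (0 <= x)%E -> (x < y)%E ->
  exists2 r : R, 0 <= r & (x < r%:E < y)%E.
Proof.
case: x => [x||] //=; last by case: y.
rewrite lee_fin => x0; case: y => [y||] //=.
  rewrite lte_fin => xy; exists ((x + y) / 2); first by lra.
  by rewrite !lte_fin; apply/andP; split; lra.
by move=> _; exists (x + 1); rewrite ?ltry ?lte_fin ?ltrDl ?ltr01 // addr_ge0.
Qed.

End Limits.

(** * The best approximation quantities *)

Section BestApproximation.
Context {R : realType}.
Notation "x %:C" := (real_complex R x).
Implicit Types (p : \bar R) (f : R -> R[i]) (g : R[i] -> R[i]).

Lemma E_ge0 n f p (A : R) : (0 <= E_ n f p A)%E.
Proof. by apply: le_ereal_inf_tmp => _ [P _ <-]; exact: Lnorm_ge0. Qed.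

Lemma A_ge0 (sigma : R) f p : (0 <= A_ sigma f p)%E.
Proof. by apply: le_ereal_inf_tmp => _ [g _ <-]; exact: Lnorm_ge0. Qed.

Lemma A_nonincreasing f p : {homo (fun tau : R => A_ tau f p) : x y / x <= y >-> (y <= x)%E}.
Proof.
move=> tau tau' tt; apply: ereal_inf_le_tmp => _ [g [eg tg] <-].
exists g => //; split=> // e e0; have [C C0 HC] := exp_type_bound tg e0.
exists C => z; rewrite (le_trans (HC z)) // ler_wpM2l // ler_expR.
by rewrite ler_wpM2r ?cmod_ge0 // lerD2r.
Qed.

(** The left limit exists by monotonicity, so that the value of lim is
    meaningful. *)
Lemma A_left_ge (sigma : R) f p (x : \bar R) : 0 < sigma ->
  (forall tau, 0 <= tau -> tau < sigma -> (x <= A_ tau f p)%E) -> (x <= A_left sigma f p)%E.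
Proof.
move=> s0 H; apply: lime_ge.
  rewrite -[sigma]opprK at_leftN.
  apply: (@nondecreasing_at_right_is_cvge R (fun t => A_ (- t) f p) (- sigma)).
  by apply: nearW => y t t' _ _ tt'; apply: A_nonincreasing; rewrite lerN2.
near=> tau; apply: H; [near: tau; exact: nbhs_left_ge|near: tau; exact: nbhs_left_lt].
Unshelve. all: by end_near. Qed.

(** An infimum over g is bounded below as soon as each g gives an eventual upper
    bound, up to an arbitrarily small delta. *)
Lemma limn_esup_le_A (u : nat -> \bar R) f p (rho : R) :
  (forall g l delta, B_ rho g -> 0 <= l ->
    (Lpnorm p [set: R] (fun x => f x - g x%:C)%R <= l%:E)%E -> 0 < delta ->
    exists N, forall n, (N <= n)%N -> (u n <= (l + delta)%:E)%E) ->
  (limn_esup u <= A_ rho f p)%E.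
Proof.
move=> H; rewrite leNgt; apply/negP => Au.
have [r r0 /andP[Ar ru]] := ereal_between (A_ge0 _ _ _) Au.
have r0' : (0 <= r%:E)%E by rewrite lee_fin.
have [r' _ /andP[rr' r'u]] := ereal_between r0' ru.
have [_ [g Bg <-] gr] := ereal_inf_lt Ar.
have d0 : 0 < r' - r by rewrite subr_gt0 -lte_fin.
have [N HN] := H g r (r' - r) Bg r0 (ltW gr) d0.
have : (limn_esup u <= r'%:E)%E.
  by apply: (limn_esup_le_eventually (N := N)) => n Nn; have := HN n Nn; rewrite addrC subrK.
by rewrite leNgt r'u.
Qed.

End BestApproximation.

Theorem theorem1p2 (R : realType) (a : nat -> R) (C : R)
  (a_gt0 : forall n : nat, (0 < n)%N -> 0 < a n)
  (a_bound : forall n : nat, (0 < n)%N -> `|a n - n%:R| <= C)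
  (p : \bar R) (p_gt0 : (0 < p)%E)
  (f : R -> R[i]) (fLp : in_LpR p f)
  (sigma : R) (sigma_gt0 : 0 < sigma) :
  (p = +oo%E ->
    [/\ (A_ sigma f +oo%E <=
           limn_einf (fun n : nat => E_ n f +oo%E (a n / sigma)))%E,
        (limn_einf (fun n : nat => E_ n f +oo%E (a n / sigma)) <=
           limn_esup (fun n : nat => E_ n f +oo%E (a n / sigma)))%E
      & (limn_esup (fun n : nat => E_ n f +oo%E (a n / sigma)) <=
           A_left sigma f +oo%E)%E]) /\
  ((p < +oo)%E ->
    (fun n : nat => E_ n f p (a n / sigma)) @ \oo --> A_ sigma f p).
Proof.
set u := fun n : nat => E_ n f p (a n / sigma).
have aC n : (0 < n)%N -> a n <= n%:R + C.
  by move=> /a_bound; rewrite ler_norml; lra.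
have low : (A_ sigma f p <= limn_einf u)%E.
  rewrite leNgt; apply/negP => uA.
  have u0 : (0 <= limn_einf u)%E by apply: limn_einf_ge0 => n; exact: E_ge0.
  have [l l0 /andP[ul lA]] := ereal_between u0 uA.
  suff : (A_ sigma f p <= l%:E)%E by rewrite leNgt lA.
  apply: (A_lower_bound p_gt0 fLp sigma_gt0 l0 a_gt0 a_bound) => N.
  have [n Nn En] := limn_einf_lt_frequently ul N.
  have [_ [P sP <-] Pl] := ereal_inf_lt En.
  by exists n => //; exists P => //; exact: ltW.
have up (tau : R) : 0 <= tau -> tau < sigma -> (limn_esup u <= A_ tau f p)%E.
  move=> t0 ts; apply: limn_esup_le_A => g l delta Bg l0 gl d0.
  exact: E_upper_bound p_gt0 fLp t0 ts Bg l0 gl d0 a_gt0 aC.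
split=> [poo|pfin].
  move: @u low up; rewrite poo => u low up; split => //; first exact: limn_einf_sup.
  exact: A_left_ge.
apply: cvg_einf_esup (low) => {low up}.
rewrite /u; case: p p_gt0 fLp pfin {u} => [p||//] p_gt0 fLp // _.
apply: limn_esup_le_A => g l delta Bg l0 gl d0.
have d2 : 0 < delta / 2 by rewrite divr_gt0.
(* For p finite, type sigma is reached through slightly smaller types. *)
have [tau [h [/andP[t0 ts] Bh hl]]] := dilation_approx p_gt0 sigma_gt0 fLp Bg l0 gl d2.
have l2 : 0 <= l + delta / 2 by rewrite addr_ge0 // ltW.
have [N HN] := E_upper_bound p_gt0 fLp t0 ts Bh l2 hl d2 a_gt0 aC.
by exists N => n Nn; have := HN n Nn; rewrite -addrA -splitr.
Qed.
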